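(* Let $F(t,z)\not\equiv 0$ be an entire function on $\mathbb{C}^2$ satisfying the heat equation $\partial_tF=\partial_z^2F$, whose initial condition $f(z)=F(0,z)$ is odd and whose $z$-order $\rho_z$ satisfies $\rho_z<2$. Then $F(t,\cdot)$ is odd for every $t$; write $F(t,z)=z\,\Psi(t,z^2)$ with $\Psi(t,\mu)$ entire in $(t,\mu)$, and let $\mu_1(t),\mu_2(t),\ldots$ be the zeros of $\Psi(t,\cdot)$, listed with multiplicity (so that the zeros of $F(t,\cdot)$ are $0,\pm z_1(t),\pm z_2(t),\ldots$ with $\mu_k(t)=z_k(t)^2$). Let $\mu_k(t)$ be a branch of these zeros, i.e. a holomorphic function on a domain $D\subset\mathbb{C}$ with $\Psi(t,\mu_k(t))=0$ for all $t\in D$. Then $$\mu_k'(t)=-6-8\mu_k(t)\sum_{j\neq k}\frac{1}{\mu_k(t)-\mu_j(t)}$$ for all $t\in D$ except for a discrete subset of $D$, where for each $t$ the sum runs over all the other zeros $\mu_j(t)$ of $\Psi(t,\cdot)$.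
   Context: The $z$-order of $F$ is the order of the entire function $z\mapsto F(t,z)$, which does not depend on $t\in\mathbb{C}$. The order of an entire function $g$ is $\limsup_{r\to\infty}\frac{\ln\ln M(r)}{\ln r}$ with $M(r)=\max_{|z|=r}|g(z)|$. A discrete subset of $D$ means a subset without accumulation points in $D$. *)

(* Defs.v *)
From Stdlib Require Import Reals List.
From Coquelicot Require Import Coquelicot.
Open Scope C_scope.

(** ** Holomorphic functions

    [ex_derive] and [ex_filterdiff] are taken over the field [C_AbsRing], so
    that differentiability means complex differentiability. *)

Definition holomorphic_on (D : C -> Prop) (f : C -> C) : Prop :=
  forall z, D z -> ex_derive (K := C_AbsRing) (V := C_NormedModule) f z.

Definition entire (f : C -> C) : Prop := holomorphic_on (fun _ => True) f.

Definition entire2 (F : C -> C -> C) : Prop :=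
  forall p : C * C,
    ex_filterdiff (K := C_AbsRing)
      (U := prod_NormedModule C_AbsRing C_NormedModule C_NormedModule)
      (V := C_NormedModule)
      (fun q => F (fst q) (snd q)) (locally p).

(* Not phrased with [C_derive], which takes the limit of the difference quotient
   along the real direction only. *)
Definition heat_equation (F : C -> C -> C) : Prop :=
  exists Fz Fzz : C -> C -> C, forall t z : C,
    is_derive (K := C_AbsRing) (V := C_NormedModule)
      (fun w => F t w) z (Fz t z) /\
    is_derive (K := C_AbsRing) (V := C_NormedModule)
      (fun w => Fz t w) z (Fzz t z) /\
    is_derive (K := C_AbsRing) (V := C_NormedModule)
      (fun s => F s z) t (Fzz t z).

(** ** Order of growth *)

Definition max_modulus (g : C -> C) (r : R) : R :=
  real (Lub_Rbar (fun x => exists z : C, Cmod z = r /\ x = Cmod (g z))).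

Definition limsup_infty (u : R -> R) : Rbar :=
  Rbar_glb (fun l => exists a : R,
    l = Lub_Rbar (fun y => exists r : R, (a < r)%R /\ y = u r)).

(* [ln] is total with value 0 on nonpositive reals; this only matters for
   bounded (hence, if entire, constant) [g]. *)
Definition growth_order (g : C -> C) : Rbar :=
  limsup_infty (fun r => (ln (ln (max_modulus g r)) / ln r)%R).

(* For entire solutions of the heat equation the order of [F t] does not depend
   on [t]; it is read off at [t = 0]. *)
Definition z_order (F : C -> C -> C) : Rbar := growth_order (fun z => F 0 z).

(** ** Zeros listed with multiplicity *)

Definition zero_of_order (g : C -> C) (w : C) (m : nat) : Prop :=
  exists h : C -> C,
    entire h /\ h w <> 0 /\ forall z, g z = (z - w) ^ m * h z.

Definition has_card (P : nat -> Prop) (m : nat) : Prop :=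
  exists l : list nat, NoDup l /\ length l = m /\ forall n, In n l <-> P n.

(* The listing may be finite or infinite: indices sent to [None] are unused.
   The case [m = 0] says that only zeros of [g] are listed. *)
Definition lists_zeros (g : C -> C) (s : nat -> option C) : Prop :=
  forall w : C, exists m : nat,
    zero_of_order g w m /\ has_card (fun n => s n = Some w) m.

(* The listing 0, z_0, -z_0, z_1, -z_1, ... *)
Definition zero_and_pm (zs : nat -> option C) (n : nat) : option C :=
  match n with
  | O => Some (RtoC 0)
  | S p => if Nat.even p then zs (Nat.div2 p)
           else option_map Copp (zs (Nat.div2 p))
  end.

Definition is_sum_others (s : nat -> option C) (k : nat) (w l : C) : Prop :=
  is_series (K := C_AbsRing) (V := C_NormedModule)
    (fun j => match s j with
              | Some v => if Nat.eqb j k then RtoC 0 else 1 / (w - v)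
              | None => RtoC 0
              end) l.

(** ** Domains and discrete subsets *)

Definition connected_set (D : C -> Prop) : Prop :=
  forall U V : C -> Prop, open U -> open V ->
    (forall z, D z -> U z \/ V z) ->
    (exists z, D z /\ U z) -> (exists z, D z /\ V z) ->
    exists z, D z /\ U z /\ V z.

Definition complex_domain (D : C -> Prop) : Prop :=
  open D /\ connected_set D /\ exists z, D z.

Definition accumulation_point (E : C -> Prop) (a : C) : Prop :=
  forall eps : R, (0 < eps)%R ->
    exists z, E z /\ z <> a /\ (Cmod (z - a) < eps)%R.

Definition discrete_subset (D E : C -> Prop) : Prop :=
  (forall z, E z -> D z) /\ forall a, D a -> ~ accumulation_point E a.

(* Main.v *)
Require Import Defs.
From Stdlib Require Import Arith Factorial Reals List FinFun Lra Lia Psatz Classical ClassicalEpsilon.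
From Coquelicot Require Import Coquelicot.
Local Open Scope R_scope.

(** In the variable [mu = z ^ 2] the heat equation for [F t z = z * Psi t mu] becomes
    [Psi_t = 6 Psi_mu + 4 mu Psi_mumu] ([Psi_heat]). Differentiating [Psi t (mu_k t) = 0] in [t] gives
    [mu_k' = - 6 - 4 mu_k Psi_mumu / Psi_mu] wherever [Psi_mu] does not vanish on the branch, and for an
    entire function of order below 1 the quotient [Psi_mumu / (2 Psi_mu)] at a simple zero is the sum
    of the reciprocals of its differences [mu_k - mu_j] with the other zeros ([sum_over_zeros]).

    The order enters as follows. The expansion of [F] in powers of [t] has the even [z]-derivatives of
    [F 0] as coefficients ([heat_taylor]); this shows that every [F t] is odd, and that the growth
    of [F 0] passes to [F t], as its order is below 2 ([heat_growth]). Hence [Psi t] has order below 1.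
    For such a function [g] with a simple zero [w], divide by [z - w] and by the factors of the zeros
    in a disc of radius [R] around [w]. The quotient has no zeros in the disc, and the logarithm of its
    maximum modulus there is small compared with [R], so that its logarithmic derivative at [w] tends
    to 0 by the inequality of Borel and Caratheodory ([log_derive_bound], [target_approx]). The same
    quotient on larger circles bounds the number of zeros ([count_zeros]), which makes the series
    absolutely convergent and its sum independent of the listing.

    The exceptional set consists of the [t] with [Psi_mu = 0] on the branch. If it accumulated in the
    domain, [Psi_mu] would vanish on a whole piece of the branch; the heat equation then forces all
    the [mu]-derivatives to vanish there ([double_branch]), so that [Psi t = 0] for some [t], and
    [F = 0] by the expansion in time.

    The complex analysis rests on the theorem of Goursat, with one exceptional point allowed, which
    gives primitives ([primitive_exists]), Cauchy's formula and Taylor series. In two variables, separate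
    holomorphy and local boundedness suffice for everything that is needed ([derive_exchange],
    [joint_remainder]), because Cauchy's estimates make the remainders uniform. *)

(** * Limits and continuity of complex-valued functions *)

Lemma locally_Cmod : forall (z : C) (P : C -> Prop),
  locally (T := C_UniformSpace) z P <->
  exists d, 0 < d /\ forall y, Cmod (y - z) < d -> P y.
Proof.
  intros z P; split.
  - intros H. apply locally_C in H. destruct H as [d Hd].
    exists d; split. apply cond_pos. intros y Hy. apply Hd. exact Hy.
  - intros [d [Hd H]]. apply locally_C. exists (mkposreal d Hd). intros y Hy. apply H. exact Hy.
Qed.

(** The plane carries two uniform structures, as [C_AbsRing] and as [C_NormedModule];
    epsilon forms of convergence and, below, of differentiability are neutral between them. *)
Definition clim {T : Type} (F : (T -> Prop) -> Prop) (f : T -> C) (l : C) : Prop :=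
  forall eps, 0 < eps -> F (fun x => Cmod (f x - l) < eps).

Lemma clim_filterlim : forall {T} (F : (T -> Prop) -> Prop) {FF : Filter F} (f : T -> C) l,
  clim F f l <-> filterlim f F (locally (T := C_UniformSpace) l).
Proof.
  intros T F FF f l; split.
  - intros H P HP. apply locally_Cmod in HP. destruct HP as [d [Hd HP]].
    unfold filtermap. apply filter_imp with (2 := H d Hd). intros x Hx. apply HP, Hx.
  - intros H e He. apply (H (fun y => Cmod (y - l) < e)). apply locally_Cmod. exists e; auto.
Qed.

Lemma Cmod_sub_sym : forall a b : C, Cmod (a - b) = Cmod (b - a).
Proof. intros a b. rewrite <- Cmod_opp. f_equal. ring. Qed.

Lemma Cmod_self : forall a : C, Cmod (a - a) = 0.
Proof. intros a. replace (a - a)%C with (RtoC 0) by ring. apply Cmod_0. Qed.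

Lemma Cmod_tri3 : forall a b : C, Cmod (a - b) <= Cmod a + Cmod b.
Proof. intros a b. unfold Cminus. rewrite <- (Cmod_opp b). apply Cmod_triangle. Qed.

Lemma Cmod_tri_inv : forall a b : C, Cmod a - Cmod b <= Cmod (a - b).
Proof.
  intros a b. generalize (Cmod_triangle (a - b) b).
  replace (a - b + b)%C with a by ring. lra.
Qed.

Ltac cring := cbv beta; ring.

Section Limits.
Context {T : Type} {F : (T -> Prop) -> Prop} {FF : Filter F}.

Lemma clim_const : forall c : C, clim F (fun _ => c) c.
Proof.
  intros c e He. apply filter_forall. intros _.
  replace (c - c)%C with (RtoC 0) by ring. rewrite Cmod_0. exact He.
Qed.

Lemma clim_eq : forall (f : T -> C) (a b : C), clim F f a -> a = b -> clim F f b.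
Proof. intros; subst; auto. Qed.

Lemma clim_plus : forall (f g : T -> C) (a b : C), clim F f a -> clim F g b ->
  clim F (fun x => f x + g x)%C (a + b)%C.
Proof.
  intros f g a b Hf Hg e He.
  assert (He2 : 0 < e / 2) by lra.
  generalize (filter_and _ _ (Hf _ He2) (Hg _ He2)). apply filter_imp.
  intros x [H1 H2].
  replace (f x + g x - (a + b))%C with ((f x - a) + (g x - b))%C by ring.
  eapply Rle_lt_trans. apply Cmod_triangle. lra.
Qed.

Lemma clim_mult : forall (f g : T -> C) (a b : C), clim F f a -> clim F g b ->
  clim F (fun x => f x * g x)%C (a * b)%C.
Proof.
  intros f g a b Hf Hg e He.
  set (K := Cmod a + Cmod b + 1).
  assert (Ha := Cmod_ge_0 a). assert (Hb := Cmod_ge_0 b).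
  assert (HK : 0 < K) by (unfold K; lra).
  assert (He2 : 0 < Rmin 1 (e / (2 * K))).
  { apply Rmin_pos. lra. apply Rdiv_lt_0_compat; lra. }
  generalize (filter_and _ _ (Hf _ He2) (Hg _ He2)). apply filter_imp.
  intros x [H1 H2].
  assert (H1' := Rlt_le_trans _ _ _ H1 (Rmin_r _ _)).
  assert (H2' := Rlt_le_trans _ _ _ H2 (Rmin_r _ _)).
  assert (H2'' := Rlt_le_trans _ _ _ H2 (Rmin_l _ _)).
  replace (f x * g x - a * b)%C with ((f x - a) * g x + a * (g x - b))%C by ring.
  eapply Rle_lt_trans. apply Cmod_triangle. rewrite !Cmod_mult.
  assert (Hg1 : Cmod (g x) <= Cmod b + 1).
  { replace (g x) with ((g x - b) + b)%C by ring.
    eapply Rle_trans. apply Cmod_triangle. lra. }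
  assert (E : e / (2 * K) * K = e / 2) by (field; lra).
  assert (Cmod (f x - a) * Cmod (g x) <= Cmod (f x - a) * (Cmod b + 1)).
  { apply Rmult_le_compat_l; auto. apply Cmod_ge_0. }
  assert (Cmod (f x - a) * (Cmod b + 1) <= e / (2 * K) * (Cmod b + 1)).
  { apply Rmult_le_compat_r; lra. }
  assert (Cmod a * Cmod (g x - b) <= Cmod a * (e / (2 * K))).
  { apply Rmult_le_compat_l; lra. }
  assert (e / (2 * K) * (Cmod b + 1) + Cmod a * (e / (2 * K)) = e / 2).
  { rewrite <- E. unfold K. ring. }
  lra.
Qed.

Lemma clim_opp : forall (f : T -> C) (a : C), clim F f a -> clim F (fun x => - f x)%C (- a)%C.
Proof.
  intros f a Hf e He. generalize (Hf e He). apply filter_imp. intros x H.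
  replace (- f x - - a)%C with (- (f x - a))%C by ring. rewrite Cmod_opp. exact H.
Qed.

Lemma clim_minus : forall (f g : T -> C) (a b : C), clim F f a -> clim F g b ->
  clim F (fun x => f x - g x)%C (a - b)%C.
Proof. intros. unfold Cminus. apply clim_plus; auto. apply clim_opp; auto. Qed.

Lemma clim_inv : forall (f : T -> C) (a : C), clim F f a -> a <> 0%C ->
  clim F (fun x => / f x)%C (/ a)%C.
Proof.
  intros f a Hf Ha e He.
  assert (Ha' : 0 < Cmod a) by (apply Cmod_gt_0; auto).
  assert (He2 : 0 < Rmin (Cmod a / 2) (e * (Cmod a * Cmod a / 2))).
  { apply Rmin_pos. lra. apply Rmult_lt_0_compat; auto. nra. }
  generalize (Hf _ He2). apply filter_imp. intros x H.
  destruct (Rmin_Rgt_l _ _ _ H) as [H1 H2].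
  assert (H3 : Cmod a / 2 < Cmod (f x)).
  { generalize (Cmod_tri_inv a (a - f x)). replace (a - (a - f x))%C with (f x) by ring.
    rewrite (Cmod_sub_sym a (f x)). lra. }
  assert (Hfx : f x <> 0%C) by (apply Cmod_gt_0; lra).
  replace (/ f x - / a)%C with ((a - f x) * (/ f x * / a))%C by (field; auto).
  rewrite !Cmod_mult, !Cmod_inv by auto. rewrite Cmod_sub_sym.
  apply Rmult_lt_reg_r with (Cmod (f x) * Cmod a). nra.
  replace (Cmod (f x - a) * (/ Cmod (f x) * / Cmod a) * (Cmod (f x) * Cmod a)) with (Cmod (f x - a))
    by (field; lra).
  eapply Rlt_le_trans. exact H2. apply Rmult_le_compat_l; nra.
Qed.

Lemma clim_ext_loc : forall (f g : T -> C) (a : C),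
  F (fun x => f x = g x) -> clim F f a -> clim F g a.
Proof.
  intros f g a H Hf e He. generalize (filter_and _ _ H (Hf e He)). apply filter_imp.
  intros x [H1 H2]. rewrite <- H1. exact H2.
Qed.

End Limits.

Lemma clim_unique : forall {T} (F : (T -> Prop) -> Prop) {FF : ProperFilter F} (f : T -> C) (a b : C),
  clim F f a -> clim F f b -> a = b.
Proof.
  intros T F FF f a b Ha Hb. apply NNPP. intros N.
  assert (N' : (a - b)%C <> 0%C) by (apply Cminus_eq_contra; auto).
  apply Cmod_gt_0 in N'.
  assert (He2 : 0 < Cmod (a - b) / 2) by lra.
  destruct (filter_ex _ (filter_and _ _ (Ha _ He2) (Hb _ He2))) as [x [H1 H2]].
  generalize (Cmod_tri3 (f x - b) (f x - a)).
  replace (f x - b - (f x - a))%C with (a - b)%C by ring. lra.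
Qed.

Notation Rnbhs x := (locally (T := R_UniformSpace) x).
Notation Cnbhs z := (locally (T := C_UniformSpace) z).
Notation contR f x := (clim (Rnbhs x) f (f x)).
Notation contC f z := (clim (Cnbhs z) f (f z)).

Lemma clim_id : forall z : C, clim (Cnbhs z) (fun y => y) z.
Proof. intros z e He. apply locally_Cmod. exists e; auto. Qed.

Lemma clim_pow : forall {T} {F : (T -> Prop) -> Prop} {FF : Filter F} (f : T -> C) (a : C) n,
  clim F f a -> clim F (fun x => f x ^ n)%C (a ^ n)%C.
Proof.
  intros T F FF f a n H. induction n; simpl. apply clim_const. apply clim_mult; auto.
Qed.

Lemma clim_shift : forall a z : C, clim (Cnbhs z) (fun y => y - a)%C (z - a)%C.
Proof. intros. apply clim_minus. apply clim_id. apply clim_const. Qed.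

Lemma clim_comp : forall {T} {F : (T -> Prop) -> Prop} {FF : Filter F} (f : T -> C) (g : C -> C) (a b : C),
  clim F f a -> clim (Cnbhs a) g b -> clim F (fun x => g (f x)) b.
Proof.
  intros T F FF f g a b Hf Hg e He. specialize (Hg e He).
  apply locally_Cmod in Hg. destruct Hg as [d [Hd Hg]].
  generalize (Hf d Hd). apply filter_imp. intros x Hx. apply Hg, Hx.
Qed.

(** * Complex differentiation *)

Definition hasd (f : C -> C) (z l : C) : Prop :=
  forall eps, 0 < eps -> exists d, 0 < d /\
    forall y, Cmod (y - z) < d -> Cmod (f y - f z - (y - z) * l) <= eps * Cmod (y - z).

Lemma hasd_is_derive : forall f z l,
  hasd f z l <-> is_derive (K := C_AbsRing) (V := C_NormedModule) f z l.
Proof.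
  intros f z l; split.
  - intros H. split.
    + apply (is_linear_scal_l (K := C_AbsRing) (V := C_NormedModule) l).
    + intros x Hx. apply (is_filter_lim_locally_unique (V := AbsRing_NormedModule C_AbsRing)) in Hx. subst x.
      intros eps. destruct (H eps (cond_pos eps)) as [d [Hd H']].
      exists (mkposreal d Hd). intros y Hy. specialize (H' y Hy).
      exact H'.
  - intros [_ H] e He.
    specialize (H z (fun P HP => HP) (mkposreal e He)).
    destruct H as [d Hd]. exists d; split. apply cond_pos.
    intros y Hy. exact (Hd y Hy).
Qed.

(** The difference quotient, completed by the derivative, is continuous; all the rules
    of differentiation follow from the rules on limits through this form. *)
Lemma hasd_caratheodory : forall f z l,
  hasd f z l <-> exists phi : C -> C, clim (Cnbhs z) phi l /\ phi z = l /\
     forall y, f y = (f z + (y - z) * phi y)%C.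
Proof.
  intros f z l; split.
  - intros H.
    exists (fun y => if Ceq_dec y z then l else ((f y - f z) / (y - z))%C).
    split; [|split].
    + intros e He. destruct (H (e / 2)) as [d [Hd H']]. lra.
      apply locally_Cmod. exists d; split; auto. intros y Hy.
      destruct (Ceq_dec y z) as [E|E].
      * replace (l - l)%C with (RtoC 0) by ring. rewrite Cmod_0; auto.
      * specialize (H' y Hy).
        assert (E' : (y - z)%C <> 0%C) by (apply Cminus_eq_contra; auto).
        replace ((f y - f z) / (y - z) - l)%C with ((f y - f z - (y - z) * l) / (y - z))%C by (field; auto).
        rewrite Cmod_div by auto. apply Cmod_gt_0 in E'.
        apply Rmult_lt_reg_r with (Cmod (y - z)); auto. unfold Rdiv.
        rewrite Rmult_assoc, Rinv_l, Rmult_1_r by lra. nra.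
    + destruct (Ceq_dec z z); congruence.
    + intros y. destruct (Ceq_dec y z) as [E|E]. subst; ring.
      assert (E' : (y - z)%C <> 0%C) by (apply Cminus_eq_contra; auto). field; auto.
  - intros [phi [H1 [H2 H3]]] e He.
    specialize (H1 e He). apply locally_Cmod in H1. destruct H1 as [d [Hd H1]].
    exists d; split; auto. intros y Hy. rewrite (H3 y).
    replace (f z + (y - z) * phi y - f z - (y - z) * l)%C with ((phi y - l) * (y - z))%C by ring.
    rewrite Cmod_mult. apply Rmult_le_compat_r. apply Cmod_ge_0. left; auto.
Qed.

Lemma hasd_cont : forall f z l, hasd f z l -> contC f z.
Proof.
  intros f z l H. apply hasd_caratheodory in H. destruct H as [phi [H1 [H2 H3]]].
  apply (clim_ext_loc (fun y => f z + (y - z) * phi y)%C).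
  { apply filter_forall. intros; symmetry; apply H3. }
  apply (clim_eq _ (f z + (z - z) * l)%C); [|ring].
  apply clim_plus. apply clim_const. apply clim_mult; auto.
  apply clim_minus. apply clim_id. apply clim_const.
Qed.

Lemma hasd_unique : forall f z l m, hasd f z l -> hasd f z m -> l = m.
Proof.
  intros f z l m Hl Hm. apply NNPP; intros N.
  assert (N' : (l - m)%C <> 0%C) by (apply Cminus_eq_contra; auto).
  apply Cmod_gt_0 in N'.
  assert (He : 0 < Cmod (l - m) / 3) by lra.
  destruct (Hl _ He) as [d1 [Hd1 H1]]. destruct (Hm _ He) as [d2 [Hd2 H2]].
  set (h := Rmin d1 d2 / 2).
  assert (Hm1 := Rmin_l d1 d2). assert (Hm2 := Rmin_r d1 d2).
  assert (Hmp := Rmin_pos _ _ Hd1 Hd2).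
  assert (Eh : Cmod (z + RtoC h - z) = h).
  { replace (z + RtoC h - z)%C with (RtoC h) by ring. rewrite Cmod_R, Rabs_pos_eq; unfold h; lra. }
  specialize (H1 (z + RtoC h)%C). specialize (H2 (z + RtoC h)%C). rewrite Eh in *.
  assert (Hh : 0 < h /\ h < d1 /\ h < d2) by (unfold h; lra).
  specialize (H1 (proj1 (proj2 Hh))). specialize (H2 (proj2 (proj2 Hh))).
  generalize (Cmod_tri3 (f (z + RtoC h)%C - f z - (z + RtoC h - z) * m) (f (z + RtoC h)%C - f z - (z + RtoC h - z) * l)).
  replace (f (z + RtoC h)%C - f z - (z + RtoC h - z) * m - (f (z + RtoC h)%C - f z - (z + RtoC h - z) * l))%C
    with (RtoC h * (l - m))%C by ring.
  rewrite Cmod_mult, Cmod_R, Rabs_pos_eq by lra. nra.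
Qed.

Lemma hasd_ext_loc : forall f g z l, Cnbhs z (fun y => f y = g y) -> hasd f z l -> hasd g z l.
Proof.
  intros f g z l H Hf e He. destruct (Hf e He) as [d [Hd H']].
  assert (Hz : f z = g z).
  { exact (locally_singleton (T := C_UniformSpace) z _ H). }
  apply locally_Cmod in H. destruct H as [d' [Hd'' H]].
  exists (Rmin d d'). split. apply Rmin_pos; auto.
  intros y Hy. rewrite <- (H y), <- Hz.
  - apply H'. eapply Rlt_le_trans; [exact Hy|apply Rmin_l].
  - eapply Rlt_le_trans; [exact Hy|apply Rmin_r].
Qed.

Lemma hasd_ext : forall f g z l, (forall y, f y = g y) -> hasd f z l -> hasd g z l.
Proof. intros f g z l H. apply hasd_ext_loc, filter_forall, H. Qed.

Lemma hasd_eq : forall f z l m, hasd f z l -> l = m -> hasd f z m.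
Proof. intros; subst; auto. Qed.

Lemma hasd_const : forall c z, hasd (fun _ => c) z 0%C.
Proof.
  intros c z. apply hasd_caratheodory. exists (fun _ => 0%C).
  split; [apply clim_const|split; auto]. intros; ring.
Qed.

Lemma hasd_id : forall z, hasd (fun y => y) z 1%C.
Proof.
  intros z. apply hasd_caratheodory. exists (fun _ => 1%C).
  split; [apply clim_const|split; auto]. intros; ring.
Qed.

Lemma hasd_plus : forall f g z l m, hasd f z l -> hasd g z m ->
  hasd (fun y => f y + g y)%C z (l + m)%C.
Proof.
  intros f g z l m Hf Hg. apply hasd_caratheodory in Hf, Hg. apply hasd_caratheodory.
  destruct Hf as [p [P1 [P2 P3]]], Hg as [q [Q1 [Q2 Q3]]].
  exists (fun y => p y + q y)%C. split; [apply clim_plus; auto|]. split; [congruence|].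
  intros y. rewrite (P3 y), (Q3 y). ring.
Qed.

Lemma hasd_mult : forall f g z l m, hasd f z l -> hasd g z m ->
  hasd (fun y => f y * g y)%C z (l * g z + f z * m)%C.
Proof.
  intros f g z l m Hf Hg. assert (Cg := hasd_cont _ _ _ Hg).
  apply hasd_caratheodory in Hf, Hg. apply hasd_caratheodory.
  destruct Hf as [p [P1 [P2 P3]]], Hg as [q [Q1 [Q2 Q3]]].
  exists (fun y => p y * g y + f z * q y)%C. split.
  { apply clim_plus; apply clim_mult; auto. apply clim_const. }
  split; [congruence|].
  intros y. rewrite (P3 y).
  replace ((f z + (y - z) * p y) * g y)%C with (f z * g y + (y - z) * p y * g y)%C by ring.
  rewrite (Q3 y) at 1. ring.
Qed.

Lemma hasd_scal : forall c f z l, hasd f z l -> hasd (fun y => c * f y)%C z (c * l)%C.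
Proof.
  intros. eapply hasd_eq. apply hasd_mult; [apply hasd_const|eassumption]. cring.
Qed.

Lemma hasd_opp : forall f z l, hasd f z l -> hasd (fun y => - f y)%C z (- l)%C.
Proof.
  intros. apply (hasd_ext (fun y => (-1) * f y)%C). intros; cring.
  eapply hasd_eq. apply hasd_scal; eassumption. cring.
Qed.

Lemma hasd_minus : forall f g z l m, hasd f z l -> hasd g z m ->
  hasd (fun y => f y - g y)%C z (l - m)%C.
Proof. intros. unfold Cminus. apply hasd_plus; auto. apply hasd_opp; auto. Qed.

Lemma hasd_comp : forall f g z l m, hasd f (g z) l -> hasd g z m ->
  hasd (fun y => f (g y)) z (m * l)%C.
Proof.
  intros f g z l m Hf Hg. assert (Cg := hasd_cont _ _ _ Hg).
  apply hasd_caratheodory in Hf, Hg. apply hasd_caratheodory.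
  destruct Hf as [p [P1 [P2 P3]]], Hg as [q [Q1 [Q2 Q3]]].
  exists (fun y => q y * p (g y))%C. split.
  { apply clim_mult; auto. apply (clim_comp g p (g z)); auto. }
  split; [congruence|].
  intros y. rewrite (P3 (g y)). rewrite (Q3 y) at 1. cring.
Qed.

Lemma hasd_inv : forall f z l, hasd f z l -> f z <> 0%C ->
  hasd (fun y => / f y)%C z (- l / (f z * f z))%C.
Proof.
  intros f z l Hf Hz. assert (Cf := hasd_cont _ _ _ Hf).
  apply hasd_caratheodory in Hf. destruct Hf as [p [P1 [P2 P3]]].
  assert (HN : Cnbhs z (fun y => f y <> 0%C)).
  { assert (Hz' : 0 < Cmod (f z)) by (apply Cmod_gt_0; auto).
    generalize (Cf _ Hz'). apply filter_imp. intros y Hy E. rewrite E in Hy.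
    replace (0 - f z)%C with (- f z)%C in Hy by ring. rewrite Cmod_opp in Hy. lra. }
  assert (Hc : clim (Cnbhs z) (fun y => - p y * (/ f y * / f z))%C (- l * (/ f z * / f z))%C).
  { apply clim_mult. apply clim_opp; auto.
    apply clim_mult. apply clim_inv; auto. apply clim_const. }
  intros e He. specialize (Hc e He).
  apply locally_Cmod in HN. apply locally_Cmod in Hc.
  destruct HN as [d1 [Hd1 H1]]. destruct Hc as [d2 [Hd2 H2]].
  exists (Rmin d1 d2). split. apply Rmin_pos; auto.
  intros y Hy.
  destruct (Rmin_Rgt_l _ _ _ Hy) as [Hy1 Hy2].
  specialize (H1 y Hy1). specialize (H2 y Hy2).
  replace (/ f y - / f z - (y - z) * (- l / (f z * f z)))%C
    with ((- p y * (/ f y * / f z) - - l * (/ f z * / f z)) * (y - z))%C.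
  rewrite Cmod_mult. apply Rmult_le_compat_r. apply Cmod_ge_0. lra.
  replace (/ f y - / f z)%C with ((f z - f y) * (/ f y * / f z))%C by (field; auto).
  replace (f z - f y)%C with (- ((y - z) * p y))%C by (rewrite (P3 y) at 1; ring).
  cbv beta; field; auto.
Qed.

Lemma hasd_div : forall f g z l m, hasd f z l -> hasd g z m -> g z <> 0%C ->
  hasd (fun y => f y / g y)%C z ((l * g z - f z * m) / (g z * g z))%C.
Proof.
  intros. unfold Cdiv at 1. eapply hasd_eq. apply hasd_mult. eassumption.
  apply hasd_inv; eassumption. cbv beta; field; auto.
Qed.

Lemma hasd_shift : forall a z, hasd (fun y => y - a)%C z 1%C.
Proof.
  intros. eapply hasd_eq. apply hasd_minus. apply hasd_id. apply hasd_const. cring.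
Qed.

Lemma hasd_pow : forall n z, hasd (fun y => y ^ n)%C z (RtoC (INR n) * z ^ (pred n))%C.
Proof.
  induction n; intros z.
  - simpl. eapply hasd_eq. apply hasd_const. simpl; cring.
  - simpl. eapply hasd_eq. apply hasd_mult. apply hasd_id. apply IHn.
    destruct n as [|n].
    + simpl. cring.
    + change (Init.Nat.pred (S n)) with n.
      change (z ^ S n)%C with (z * z ^ n)%C.
      change (match n with 0%nat => 1 | S _ => INR n + 1 end) with (INR (S n)).
      rewrite RtoC_plus. cring.
Qed.

(** Cauchy's estimates provide remainders of this form. *)
Lemma hasd_quad : forall f z l d K, 0 < d -> 0 <= K ->
  (forall y, Cmod (y - z) <= d -> Cmod (f y - f z - (y - z) * l) <= K * (Cmod (y - z) * Cmod (y - z))) ->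
  hasd f z l.
Proof.
  intros f z l d K Hd HK H e He.
  assert (Hp : 0 < e / (K + 1)) by (apply Rdiv_lt_0_compat; lra).
  exists (Rmin d (e / (K + 1))). split. apply Rmin_pos; auto.
  intros y Hy. destruct (Rmin_Rgt_l _ _ _ Hy) as [H1 H2].
  eapply Rle_trans. apply H; lra. set (h := Cmod (y - z)) in *. assert (Hh : 0 <= h) by apply Cmod_ge_0.
  assert (h * (K + 1) <= e).
  { apply Rle_trans with (e / (K + 1) * (K + 1)). apply Rmult_le_compat_r; lra. right; field; lra. }
  nra.
Qed.

(** * Integrals of complex-valued functions of a real variable *)

Definition is_CI (f : R -> C) (a b : R) (l : C) : Prop :=
  is_RInt (V := C_R_NormedModule) f a b l.

Definition CI (f : R -> C) (a b : R) : C :=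
  RInt (V := C_R_CompleteNormedModule) f a b.

Definition contR_on (f : R -> C) (a b : R) : Prop :=
  forall x, Rmin a b <= x <= Rmax a b -> contR f x.

Lemma contR_continuous : forall (f : R -> C) x,
  contR f x <-> continuous (U := C_UniformSpace) f x.
Proof. intros f x. apply (clim_filterlim (Rnbhs x)). Qed.

Lemma is_CI_unique : forall f a b l, is_CI f a b l -> CI f a b = l.
Proof. intros. apply (is_RInt_unique (V := C_R_CompleteNormedModule)). exact H. Qed.

Lemma CI_correct : forall f a b, contR_on f a b -> is_CI f a b (CI f a b).
Proof.
  intros f a b H. apply (RInt_correct (V := C_R_CompleteNormedModule)).
  apply (ex_RInt_continuous (V := C_R_CompleteNormedModule)).
  intros z Hz. apply contR_continuous, H, Hz.
Qed.

Lemma is_CI_plus : forall f g a b l m, is_CI f a b l -> is_CI g a b m ->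
  is_CI (fun x => f x + g x)%C a b (l + m)%C.
Proof. intros. apply (is_RInt_plus (V := C_R_NormedModule)); auto. Qed.

Lemma is_CI_scal : forall c f a b l, is_CI f a b l -> is_CI (fun x => c * f x)%C a b (c * l)%C.
Proof.
  intros [c d] f a b l H.
  assert (H1 := is_RInt_fct_extend_fst (U := R_NormedModule) (V := R_NormedModule) f a b l H).
  assert (H2 := is_RInt_fct_extend_snd (U := R_NormedModule) (V := R_NormedModule) f a b l H).
  apply (is_RInt_fct_extend_pair (U := R_NormedModule) (V := R_NormedModule)); simpl.
  - apply (is_RInt_minus (V := R_NormedModule)); apply (is_RInt_scal (V := R_NormedModule)); auto.
  - apply (is_RInt_plus (V := R_NormedModule)); apply (is_RInt_scal (V := R_NormedModule)); auto.
Qed.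

Lemma is_CI_ext : forall f g a b l, (forall x, Rmin a b <= x <= Rmax a b -> f x = g x) ->
  is_CI f a b l -> is_CI g a b l.
Proof.
  intros f g a b l H. apply (is_RInt_ext (V := C_R_NormedModule)). intros x Hx. apply H. lra.
Qed.

Lemma is_CI_minus : forall f g a b l m, is_CI f a b l -> is_CI g a b m ->
  is_CI (fun x => f x - g x)%C a b (l - m)%C.
Proof. intros. apply (is_RInt_minus (V := C_R_NormedModule)); auto. Qed.

Lemma is_CI_Chasles : forall f a b c l m, is_CI f a b l -> is_CI f b c m ->
  is_CI f a c (l + m)%C.
Proof. intros. apply (is_RInt_Chasles (V := C_R_NormedModule)) with b; auto. Qed.

Lemma is_CI_const : forall c a b, is_CI (fun _ => c) a b (RtoC (b - a) * c)%C.
Proof.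
  intros. rewrite <- scal_R_Cmult. apply (is_RInt_const (V := C_R_NormedModule)).
Qed.

Lemma is_CI_swap : forall f a b l, is_CI f a b l -> is_CI f b a (- l)%C.
Proof. intros. apply (is_RInt_swap (V := C_R_NormedModule)); auto. Qed.

Lemma is_CI_norm : forall f a b l M, is_CI f a b l ->
  (forall x, Rmin a b <= x <= Rmax a b -> Cmod (f x) <= M) -> Cmod l <= Rabs (b - a) * M.
Proof.
  intros f a b l M H HM. rewrite Cmod_norm.
  apply (norm_RInt_le_const_abs (V := C_R_NormedModule) f); auto.
  intros x Hx. rewrite <- Cmod_norm. auto.
Qed.

Lemma CI_Chasles : forall f a b c,
  contR_on f a b -> contR_on f b c -> CI f a c = (CI f a b + CI f b c)%C.
Proof.
  intros. apply is_CI_unique. apply is_CI_Chasles with b; apply CI_correct; auto.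
Qed.

Lemma CI_minus : forall f g a b, contR_on f a b -> contR_on g a b ->
  CI (fun x => f x - g x)%C a b = (CI f a b - CI g a b)%C.
Proof. intros. apply is_CI_unique. apply is_CI_minus; apply CI_correct; auto. Qed.

Lemma CI_scal : forall c f a b, contR_on f a b ->
  CI (fun x => c * f x)%C a b = (c * CI f a b)%C.
Proof. intros. apply is_CI_unique. apply is_CI_scal; apply CI_correct; auto. Qed.

Lemma CI_norm : forall f a b M, contR_on f a b ->
  (forall x, Rmin a b <= x <= Rmax a b -> Cmod (f x) <= M) -> Cmod (CI f a b) <= Rabs (b - a) * M.
Proof. intros. apply is_CI_norm with f; auto. apply CI_correct; auto. Qed.

Definition hasdR (f : R -> C) (x : R) (l : C) : Prop :=
  is_derive (K := R_AbsRing) (V := C_R_NormedModule) f x l.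

Lemma hasdR_eps : forall f x l, hasdR f x l <->
  forall eps, 0 < eps -> exists d, 0 < d /\
    forall y, Rabs (y - x) < d -> Cmod (f y - f x - RtoC (y - x) * l) <= eps * Rabs (y - x).
Proof.
  intros f x l; split.
  - intros [_ H] e He.
    specialize (H x (fun P HP => HP) (mkposreal e He)).
    destruct H as [d Hd]. exists d; split. apply cond_pos.
    intros y Hy. specialize (Hd y Hy). rewrite <- scal_R_Cmult, Cmod_norm. exact Hd.
  - intros H. split.
    + apply (is_linear_scal_l (K := R_AbsRing) (V := C_R_NormedModule) l).
    + intros z Hz. apply (is_filter_lim_locally_unique (V := R_NormedModule)) in Hz. subst z.
      intros eps. destruct (H eps (cond_pos eps)) as [d [Hd H']].
      exists (mkposreal d Hd). intros y Hy. specialize (H' y Hy).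
      rewrite <- scal_R_Cmult, Cmod_norm in H'. exact H'.
Qed.

Lemma hasdR_cont : forall f x l, hasdR f x l -> contR f x.
Proof.
  intros f x l H. apply contR_continuous.
  apply (ex_derive_continuous (K := R_AbsRing) (V := C_R_NormedModule)). exists l. exact H.
Qed.

Lemma CI_derive : forall f df a b,
  (forall x, Rmin a b <= x <= Rmax a b -> hasdR f x (df x)) ->
  contR_on df a b -> CI df a b = (f b - f a)%C.
Proof.
  intros f df a b H Hc. apply is_CI_unique.
  apply (is_RInt_derive (V := C_R_CompleteNormedModule)); auto.
  intros x Hx. apply contR_continuous, Hc, Hx.
Qed.

Lemma Cmod_le_abs : forall z : C, Cmod z <= Rabs (fst z) + Rabs (snd z).
Proof.
  intros [x y]. simpl. unfold Cmod. simpl.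
  apply Rsqr_incr_0_var.
  - rewrite Rsqr_sqrt by nra. unfold Rsqr.
    generalize (Rabs_pos x) (Rabs_pos y) (Rsqr_abs x) (Rsqr_abs y). unfold Rsqr. nra.
  - generalize (Rabs_pos x) (Rabs_pos y). lra.
Qed.

Lemma Cmod_ge_fst : forall z : C, Rabs (fst z) <= Cmod z.
Proof. intros. eapply Rle_trans; [apply Rmax_l|apply Rmax_Cmod]. Qed.

Lemma Cmod_ge_snd : forall z : C, Rabs (snd z) <= Cmod z.
Proof. intros. eapply Rle_trans; [apply Rmax_r|apply Rmax_Cmod]. Qed.

Lemma hasdR_pair : forall (u v : R -> R) x du dv,
  is_derive u x du -> is_derive v x dv -> hasdR (fun t => (u t, v t)) x (du, dv).
Proof.
  intros u v x du dv [_ Hu] [_ Hv]. apply hasdR_eps. intros e He.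
  assert (He2 : 0 < e / 2) by lra.
  specialize (Hu x (fun P HP => HP) (mkposreal _ He2)).
  specialize (Hv x (fun P HP => HP) (mkposreal _ He2)).
  destruct Hu as [d1 H1], Hv as [d2 H2].
  exists (Rmin d1 d2). split. apply Rmin_pos; apply cond_pos.
  intros y Hy.
  destruct (Rmin_Rgt_l _ _ _ Hy) as [Hy1 Hy2].
  specialize (H1 y Hy1). specialize (H2 y Hy2).
  eapply Rle_trans. apply Cmod_le_abs.
  simpl in H1, H2. unfold norm, minus, plus, opp, scal in H1, H2; simpl in H1, H2.
  unfold abs, mult in H1, H2; simpl in H1, H2.
  simpl.
  match goal with |- Rabs ?A + Rabs ?B <= _ =>
    replace A with (u y + - u x + - ((y + - x) * du)) by ring;
    replace B with (v y + - v x + - ((y + - x) * dv)) by ring end.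
  unfold Rminus. lra.
Qed.

Lemma hasd_comp_R : forall F g x l m, hasd F (g x) l -> hasdR g x m ->
  hasdR (fun t => F (g t)) x (m * l)%C.
Proof.
  intros F g x l m HF Hg. assert (Cg := hasdR_cont _ _ _ Hg).
  apply hasd_caratheodory in HF. destruct HF as [p [P1 [P2 P3]]].
  rewrite hasdR_eps in Hg. apply hasdR_eps. intros e He.
  set (K := Cmod m + Cmod l + 2).
  assert (Hl := Cmod_ge_0 l). assert (Hm := Cmod_ge_0 m).
  set (e1 := Rmin 1 (e / K)).
  assert (He1 : 0 < e1).
  { apply Rmin_pos. lra. apply Rdiv_lt_0_compat; unfold K; lra. }
  destruct (Hg e1 He1) as [d1 [Hd1 H1]].
  destruct (clim_comp g p (g x) l Cg P1 e1 He1) as [d2 H2].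
  exists (Rmin d1 d2). split. apply Rmin_pos; auto. apply cond_pos.
  intros y Hy.
  destruct (Rmin_Rgt_l _ _ _ Hy) as [Hy1 Hy2].
  specialize (H1 y Hy1). specialize (H2 y Hy2).
  rewrite (P3 (g y)).
  replace (F (g x) + (g y - g x) * p (g y) - F (g x) - RtoC (y - x) * (m * l))%C
    with ((g y - g x - RtoC (y - x) * m) * p (g y) + RtoC (y - x) * m * (p (g y) - l))%C by ring.
  eapply Rle_trans. apply Cmod_triangle. rewrite !Cmod_mult, Cmod_R.
  assert (e1 <= 1) by apply Rmin_l.
  assert (e1 * K <= e).
  { apply Rle_trans with (e / K * K). apply Rmult_le_compat_r. unfold K; lra. apply Rmin_r.
    right; field. unfold K; lra. }
  assert (Hp : Cmod (p (g y)) <= Cmod l + 1).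
  { replace (p (g y)) with ((p (g y) - l) + l)%C by ring. eapply Rle_trans. apply Cmod_triangle. lra. }
  set (h := Rabs (y - x)) in *. assert (Hh : 0 <= h) by apply Rabs_pos.
  apply Rle_trans with (e1 * h * (Cmod l + 1) + h * Cmod m * e1).
  - apply Rplus_le_compat.
    + apply Rmult_le_compat; auto using Cmod_ge_0.
    + apply Rmult_le_compat_l. apply Rmult_le_pos; auto. lra.
  - apply Rle_trans with (h * (e1 * K)).
    + unfold K. assert (0 <= e1 * h) by (apply Rmult_le_pos; lra). nra.
    + rewrite Rmult_comm. apply Rmult_le_compat_r; auto.
Qed.

Lemma hasdR_hline : forall y x, hasdR (fun t => (t, y)) x 1%C.
Proof. intros. apply hasdR_pair; auto_derive; auto. Qed.

Lemma hasdR_vline : forall x y, hasdR (fun t => (x, t)) y Ci.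
Proof. intros. apply hasdR_pair; auto_derive; auto. Qed.

(** Contour integrals of [f z dz]; the factor [Ci] is the velocity of the vertical path. *)
Definition hseg (f : C -> C) (y a b : R) : C := CI (fun x => f (x, y)) a b.
Definition vseg (f : C -> C) (x c d : R) : C := (Ci * CI (fun y => f (x, y)) c d)%C.
Definition rect (f : C -> C) (a b c d : R) : C :=
  (hseg f c a b + vseg f b c d - hseg f d a b - vseg f a c d)%C.

Lemma contR_h : forall f x y, contC f (x, y) -> contR (fun t => f (t, y)) x.
Proof.
  intros f x y H. apply (clim_comp (fun t => (t, y)) f (x, y)); auto.
  exact (hasdR_cont _ _ _ (hasdR_hline y x)).
Qed.

Lemma contR_v : forall f x y, contC f (x, y) -> contR (fun t => f (x, t)) y.
Proof.
  intros f x y H. apply (clim_comp (fun t => (x, t)) f (x, y)); auto.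
  exact (hasdR_cont _ _ _ (hasdR_vline x y)).
Qed.

Definition contrect (f : C -> C) (a b c d : R) : Prop :=
  forall x y, a <= x <= b -> c <= y <= d -> contC f (x, y).

Lemma contrect_h : forall f a b c d y a' b', contrect f a b c d -> c <= y <= d ->
  a <= a' <= b -> a <= b' <= b -> contR_on (fun x => f (x, y)) a' b'.
Proof.
  intros f a b c d y a' b' H Hy Ha Hb x Hx. apply contR_h, H; auto.
  assert (a <= Rmin a' b') by (apply Rmin_glb; lra).
  assert (Rmax a' b' <= b) by (apply Rmax_lub; lra). lra.
Qed.

Lemma contrect_v : forall f a b c d x c' d', contrect f a b c d -> a <= x <= b ->
  c <= c' <= d -> c <= d' <= d -> contR_on (fun y => f (x, y)) c' d'.
Proof.
  intros f a b c d x c' d' H Hx Hc Hd y Hy. apply contR_v, H; auto.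
  assert (c <= Rmin c' d') by (apply Rmin_glb; lra).
  assert (Rmax c' d' <= d) by (apply Rmax_lub; lra). lra.
Qed.

Lemma rect_split : forall f a b c d m n, contrect f a b c d -> a <= m <= b -> c <= n <= d ->
  rect f a b c d = (rect f a m c n + rect f m b c n + rect f a m n d + rect f m b n d)%C.
Proof.
  intros f a b c d m n H Hm Hn. unfold rect, hseg, vseg.
  rewrite (CI_Chasles (fun x => f (x, c)) a m b), (CI_Chasles (fun x => f (x, d)) a m b),
    (CI_Chasles (fun y => f (a, y)) c n d), (CI_Chasles (fun y => f (b, y)) c n d).
  ring.
  all: first [eapply contrect_h | eapply contrect_v]; try eassumption; lra.
Qed.

Lemma rect_norm : forall f a b c d M, contrect f a b c d -> a <= b -> c <= d ->
  (forall x y, a <= x <= b -> c <= y <= d -> Cmod (f (x, y)) <= M) ->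
  Cmod (rect f a b c d) <= 2 * ((b - a) + (d - c)) * M.
Proof.
  intros f a b c d M H Hab Hcd HM. unfold rect.
  assert (Hh : forall y, c <= y <= d -> Cmod (hseg f y a b) <= (b - a) * M).
  { intros y Hy. unfold hseg. replace (b - a) with (Rabs (b - a)) by (apply Rabs_pos_eq; lra).
    apply CI_norm. eapply contrect_h; try eassumption; lra.
    intros x Hx. rewrite Rmin_left, Rmax_right in Hx by lra. apply HM; auto. }
  assert (Hv : forall x, a <= x <= b -> Cmod (vseg f x c d) <= (d - c) * M).
  { intros y Hy. unfold vseg. rewrite Cmod_mult, Cmod_Ci, Rmult_1_l.
    replace (d - c) with (Rabs (d - c)) by (apply Rabs_pos_eq; lra).
    apply CI_norm. eapply contrect_v; try eassumption; lra.
    intros x Hx. rewrite Rmin_left, Rmax_right in Hx by lra. apply HM; auto. }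
  assert (H1 := Hh c ltac:(lra)). assert (H2 := Hh d ltac:(lra)).
  assert (H3 := Hv a ltac:(lra)). assert (H4 := Hv b ltac:(lra)).
  eapply Rle_trans. apply Cmod_tri3.
  eapply Rle_trans. apply Rplus_le_compat_r. apply Cmod_tri3.
  eapply Rle_trans. apply Rplus_le_compat_r. apply Rplus_le_compat_r. apply Cmod_triangle.
  lra.
Qed.

(** On each side the integral is an increment of the primitive, and the increments cancel. *)
Lemma rect_primitive : forall F f a b c d, contrect f a b c d -> a <= b -> c <= d ->
  (forall x y, a <= x <= b -> c <= y <= d -> hasd F (x, y) (f (x, y))) ->
  rect f a b c d = 0%C.
Proof.
  intros F f a b c d H Hab Hcd HF.
  assert (Hh : forall y, c <= y <= d -> hseg f y a b = (F (b, y) - F (a, y))%C).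
  { intros y Hy. unfold hseg. apply (CI_derive (fun x => F (x, y))).
    - intros x Hx. rewrite Rmin_left, Rmax_right in Hx by lra.
      replace (f (x, y)) with (1 * f (x, y))%C by ring.
      apply (hasd_comp_R F (fun x => (x, y))). apply HF; auto. apply hasdR_hline.
    - eapply contrect_h; try eassumption; lra. }
  assert (Hv : forall x, a <= x <= b -> vseg f x c d = (F (x, d) - F (x, c))%C).
  { intros x Hx. unfold vseg. rewrite <- CI_scal by (eapply contrect_v; try eassumption; lra).
    apply (CI_derive (fun y => F (x, y))).
    - intros y Hy. rewrite Rmin_left, Rmax_right in Hy by lra.
      apply (hasd_comp_R F (fun y => (x, y))). apply HF; auto. apply hasdR_vline.
    - intros y Hy. apply clim_mult. apply clim_const.
      rewrite Rmin_left, Rmax_right in Hy by lra. apply contR_v. apply H; auto. }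
  unfold rect. rewrite !Hh, !Hv by lra. ring.
Qed.

Lemma rect_minus : forall f g a b c d, contrect f a b c d -> contrect g a b c d ->
  a <= b -> c <= d ->
  rect (fun z => f z - g z)%C a b c d = (rect f a b c d - rect g a b c d)%C.
Proof.
  intros f g a b c d Hf Hg Hab Hcd. unfold rect, hseg, vseg.
  rewrite !(CI_minus (fun x => f (x, _)) (fun x => g (x, _))).
  rewrite !(CI_minus (fun y => f (_, y)) (fun y => g (_, y))). ring.
  all: first [eapply contrect_h | eapply contrect_v]; try eassumption; lra.
Qed.

(** * The theorem of Goursat and primitives *)

Lemma nested_limit : forall u v : nat -> R,
  (forall n, u n <= u (S n)) -> (forall n, v (S n) <= v n) -> (forall n, u n <= v n) ->
  exists x, forall n, u n <= x <= v n.
Proof.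
  intros u v Hu Hv Huv.
  assert (Hu' : forall n k, u n <= u (n + k)%nat).
  { intros n k. induction k. rewrite Nat.add_0_r; lra. rewrite Nat.add_succ_r.
    eapply Rle_trans. exact IHk. apply Hu. }
  assert (Hv' : forall n k, v (n + k)%nat <= v n).
  { intros n k. induction k. rewrite Nat.add_0_r; lra. rewrite Nat.add_succ_r.
    eapply Rle_trans. apply Hv. exact IHk. }
  assert (H : forall m n, u m <= v n).
  { intros m n. apply Rle_trans with (u (m + n)%nat). apply Hu'.
    apply Rle_trans with (v (m + n)%nat). apply Huv. rewrite Nat.add_comm. apply Hv'. }
  destruct (completeness (fun x => exists n, x = u n)) as [x [Hx1 Hx2]].
  - exists (v 0%nat). intros y [n ->]. apply H.
  - exists (u 0%nat). exists 0%nat; auto.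
  - exists x. intros n. split. apply Hx1. exists n; auto.
    apply Hx2. intros y [m ->]. apply H.
Qed.

(** Otherwise repeated quartering would lead to a point around which the property fails
    at every scale. *)
Lemma rect_cousin : forall (P : R -> R -> R -> R -> Prop) a0 b0 c0 d0,
  a0 <= b0 -> c0 <= d0 ->
  (forall a b c d, a0 <= a -> a <= b -> b <= b0 -> c0 <= c -> c <= d -> d <= d0 ->
     P a ((a + b) / 2) c ((c + d) / 2) -> P ((a + b) / 2) b c ((c + d) / 2) ->
     P a ((a + b) / 2) ((c + d) / 2) d -> P ((a + b) / 2) b ((c + d) / 2) d -> P a b c d) ->
  (forall x y, a0 <= x <= b0 -> c0 <= y <= d0 -> exists e, 0 < e /\
     forall a b c d, a0 <= a -> a <= x <= b -> b <= b0 -> c0 <= c -> c <= y <= d -> d <= d0 ->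
     b - a < e -> d - c < e -> P a b c d) ->
  P a0 b0 c0 d0.
Proof.
  intros P a0 b0 c0 d0 Hab Hcd Hq Hl. apply NNPP. intros HN.
  pose (Q := fun s : R * R * R * R => let '(a, b, c, d) := s in P a b c d).
  pose (q1 := fun s : R * R * R * R => let '(a, b, c, d) := s in (a, (a + b) / 2, c, (c + d) / 2)).
  pose (q2 := fun s : R * R * R * R => let '(a, b, c, d) := s in ((a + b) / 2, b, c, (c + d) / 2)).
  pose (q3 := fun s : R * R * R * R => let '(a, b, c, d) := s in (a, (a + b) / 2, (c + d) / 2, d)).
  pose (q4 := fun s : R * R * R * R => let '(a, b, c, d) := s in ((a + b) / 2, b, (c + d) / 2, d)).
  pose (next := fun s => if excluded_middle_informative (Q (q1 s)) then
      if excluded_middle_informative (Q (q2 s)) then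
        if excluded_middle_informative (Q (q3 s)) then q4 s else q3 s
      else q2 s else q1 s).
  pose (s := fun n => Nat.iter n next (a0, b0, c0, d0)).
  pose (A := fun n => fst (fst (fst (s n)))). pose (B := fun n => snd (fst (fst (s n)))).
  pose (Cc := fun n => snd (fst (s n))). pose (Dd := fun n => snd (s n)).
  assert (Es : forall n, s n = (A n, B n, Cc n, Dd n)).
  { intros n. unfold A, B, Cc, Dd. destruct (s n) as [[[? ?] ?] ?]; auto. }
  assert (I : forall n, a0 <= A n /\ A n <= B n /\ B n <= b0 /\ c0 <= Cc n /\ Cc n <= Dd n /\ Dd n <= d0
     /\ ~ Q (s n) /\ B n - A n = (b0 - a0) * (/ 2) ^ n /\ Dd n - Cc n = (d0 - c0) * (/ 2) ^ n
     /\ A n <= A (S n) /\ B (S n) <= B n /\ Cc n <= Cc (S n) /\ Dd (S n) <= Dd n).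
  { assert (Step : forall n, a0 <= A n -> A n <= B n -> B n <= b0 -> c0 <= Cc n -> Cc n <= Dd n -> Dd n <= d0
     -> ~ Q (s n) -> ~ Q (s (S n)) /\ A n <= A (S n) /\ B (S n) <= B n /\ Cc n <= Cc (S n) /\ Dd (S n) <= Dd n
     /\ A (S n) <= B (S n) /\ Cc (S n) <= Dd (S n)
     /\ B (S n) - A (S n) = (B n - A n) / 2 /\ Dd (S n) - Cc (S n) = (Dd n - Cc n) / 2).
    { intros n h1 h2 h3 h4 h5 h6 hN.
      assert (E : s (S n) = next (s n)) by reflexivity.
      assert (HQ : ~ Q (next (s n)) /\ (next (s n) = q1 (s n) \/ next (s n) = q2 (s n) \/
         next (s n) = q3 (s n) \/ next (s n) = q4 (s n))).
      { unfold next. destruct (excluded_middle_informative (Q (q1 (s n)))) as [i1|i1]; [|tauto].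
        destruct (excluded_middle_informative (Q (q2 (s n)))) as [i2|i2]; [|tauto].
        destruct (excluded_middle_informative (Q (q3 (s n)))) as [i3|i3]; [|tauto].
        split; [|tauto]. intros i4. apply hN. rewrite Es in *. unfold Q, q1, q2, q3, q4 in *.
        apply Hq; auto. }
      destruct HQ as [HQ1 HQ2]. rewrite <- E in HQ1, HQ2. split; auto.
      rewrite (Es n) in HQ2. unfold q1, q2, q3, q4 in HQ2. rewrite (Es (S n)) in HQ2.
      destruct HQ2 as [K|[K|[K|K]]]; injection K as -> -> -> ->; repeat split; lra. }
    intros n. induction n.
    - destruct (Step 0%nat) as [? ?]; try (simpl; unfold A, B, Cc, Dd; simpl; lra); auto.
      unfold A, B, Cc, Dd in *; simpl in *. repeat split; try tauto; lra.
    - destruct IHn as [h1 [h2 [h3 [h4 [h5 [h6 [h7 [h8 [h9 h10]]]]]]]]].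
      destruct (Step n h1 h2 h3 h4 h5 h6 h7) as [k1 [k2 [k3 [k4 [k5 [k6 [k7 [k8 k9]]]]]]]].
      destruct (Step (S n)) as [l1 [l2 [l3 [l4 [l5 [l6 [l7 [l8 l9]]]]]]]]; try lra; auto.
      repeat split; try lra; auto; simpl; lra. }
  destruct (nested_limit A B) as [x Hx]; try (intros n; destruct (I n); tauto).
  destruct (nested_limit Cc Dd) as [y Hy]; try (intros n; destruct (I n); tauto).
  destruct (Hl x y) as [e [He H]].
  { generalize (Hx 0%nat) (I 0%nat). lra. } { generalize (Hy 0%nat) (I 0%nat). lra. }
  set (K := (b0 - a0) + (d0 - c0) + 1).
  destruct (pow_lt_1_zero (/ 2)) with (y := e / K) as [N HNN].
  { rewrite Rabs_pos_eq; lra. }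
  { apply Rdiv_lt_0_compat; unfold K; lra. }
  specialize (HNN N (Nat.le_refl _)).
  assert (Hp : 0 < (/ 2) ^ N) by (apply pow_lt; lra).
  rewrite Rabs_pos_eq in HNN by lra.
  assert (HK : (/ 2) ^ N * K < e).
  { apply Rmult_lt_reg_r with (/ K). apply Rinv_0_lt_compat; unfold K; lra.
    rewrite Rmult_assoc, Rinv_r, Rmult_1_r by (unfold K; lra). exact HNN. }
  destruct (I N) as [h1 [h2 [h3 [h4 [h5 [h6 [h7 [h8 [h9 h10]]]]]]]]].
  apply h7. rewrite Es. unfold Q. apply H; auto; unfold K in HK; nra.
Qed.

(** Near a point of differentiability [f] is affine up to a small multiple of the size of the
    rectangle, and affine functions have primitives. The resulting bound by a small multiple
    of the squared size is additive under quartering. *)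
Lemma goursat : forall f a b c d, a <= b -> c <= d ->
  (forall x y, a <= x <= b -> c <= y <= d -> exists l, hasd f (x, y) l) ->
  rect f a b c d = 0%C.
Proof.
  intros f a b c d Hab Hcd H.
  assert (Hc : contrect f a b c d).
  { intros x y Hx Hy. destruct (H x y Hx Hy) as [l Hl]. eapply hasd_cont; eassumption. }
  assert (Hs : forall a' b' c' d', a <= a' -> b' <= b -> c <= c' -> d' <= d -> contrect f a' b' c' d').
  { intros a' b' c' d' ? ? ? ? x y Hx Hy. apply Hc; lra. }
  assert (HE : forall e, 0 < e -> Cmod (rect f a b c d) <= e * (2 * ((b - a) + (d - c)) * ((b - a) + (d - c)))).
  { intros e He.
    apply (rect_cousin (fun a b c d => Cmod (rect f a b c d) <= e * (2 * ((b - a) + (d - c)) * ((b - a) + (d - c)))));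
      auto.
    - intros a' b' c' d' h1 h2 h3 h4 h5 h6 Q1 Q2 Q3 Q4.
      rewrite (rect_split f a' b' c' d' ((a' + b') / 2) ((c' + d') / 2)) by (try apply Hs; lra).
      eapply Rle_trans. apply Cmod_triangle.
      eapply Rle_trans. apply Rplus_le_compat_r. apply Cmod_triangle.
      eapply Rle_trans. apply Rplus_le_compat_r. apply Rplus_le_compat_r. apply Cmod_triangle.
      nra.
    - intros x y Hx Hy. destruct (H x y Hx Hy) as [l Hl].
      destruct (Hl e He) as [dl [Hdl Hl']].
      exists (dl / 2). split. lra.
      intros a' b' c' d' h1 h2 h3 h4 h5 h6 h7 h8.
      set (g := fun z : C => (f (x, y) + (z - (x, y)) * l)%C).
      assert (Hg : forall z, hasd (fun z => f (x, y) * z + l / 2 * ((z - (x, y)) * (z - (x, y))))%C z (g z)).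
      { intros z. eapply hasd_eq. apply hasd_plus. apply hasd_scal, hasd_id.
        apply hasd_scal. apply hasd_mult; apply hasd_shift. unfold g. cbv beta. field. }
      assert (Cg : forall a b c d, contrect g a b c d).
      { intros a1 b1 c1 d1 x1 y1 _ _. unfold g. apply clim_plus. apply clim_const.
        apply clim_mult. apply clim_shift. apply clim_const. }
      assert (E0 : rect g a' b' c' d' = 0%C).
      { eapply rect_primitive; try lra. apply Cg. intros. apply Hg. }
      assert (Er : rect f a' b' c' d' = rect (fun z => f z - g z)%C a' b' c' d').
      { rewrite rect_minus; try lra; auto. rewrite E0. ring. }
      rewrite Er.
      eapply Rle_trans. apply rect_norm with (M := e * ((b' - a') + (d' - c'))); try lra.
      + intros x1 y1 Hx1 Hy1. apply clim_minus. apply Hc; lra. apply (Cg a b c d); lra.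
      + intros x1 y1 Hx1 Hy1.
        assert (Hd : Cmod ((x1, y1) - (x, y)) <= (b' - a') + (d' - c')).
        { eapply Rle_trans. apply Cmod_le_abs. simpl.
          apply Rplus_le_compat; apply Rabs_le; lra. }
        unfold g. replace (f (x1, y1) - (f (x, y) + ((x1, y1) - (x, y)) * l))%C
          with (f (x1, y1) - f (x, y) - ((x1, y1) - (x, y)) * l)%C by ring.
        eapply Rle_trans. apply Hl'. lra. apply Rmult_le_compat_l; lra.
      + right; ring. }
  apply Cmod_eq_0. apply Rle_antisym; [|apply Cmod_ge_0].
  set (K := 2 * (b - a + (d - c)) * (b - a + (d - c))) in HE.
  assert (0 <= K) by (unfold K; nra).
  apply Rnot_lt_le. intros HN.
  specialize (HE (Cmod (rect f a b c d) / (2 * (K + 1)))).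
  assert (0 < Cmod (rect f a b c d) / (2 * (K + 1))) by (apply Rdiv_lt_0_compat; lra).
  specialize (HE H1).
  assert (Cmod (rect f a b c d) / (2 * (K + 1)) * (2 * (K + 1)) = Cmod (rect f a b c d)) by (field; lra).
  nra.
Qed.

Lemma rect_flat_x : forall f a c d, rect f a a c d = 0%C.
Proof.
  intros. unfold rect, hseg.
  assert (E : forall y, CI (fun x => f (x, y)) a a = 0%C).
  { intros y. apply is_CI_unique. apply (is_RInt_point (V := C_R_NormedModule)). }
  rewrite !E. ring.
Qed.

Lemma rect_flat_y : forall f a b c, rect f a b c c = 0%C.
Proof.
  intros. unfold rect, vseg.
  assert (E : forall x, CI (fun y => f (x, y)) c c = 0%C).
  { intros y. apply is_CI_unique. apply (is_RInt_point (V := C_R_NormedModule)). }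
  rewrite !E. ring.
Qed.

(** Cutting out a small rectangle around the exceptional point leaves pieces that are flat or
    avoid it, and the small rectangle contributes little. *)
Lemma goursat_except : forall f w a b c d, a <= b -> c <= d -> contrect f a b c d ->
  (forall x y, a <= x <= b -> c <= y <= d -> (x, y) <> w -> exists l, hasd f (x, y) l) ->
  rect f a b c d = 0%C.
Proof.
  intros f [wx wy] a b c d Hab Hcd Hc H.
  destruct (classic ((a <= wx <= b) /\ (c <= wy <= d))) as [[Hwx Hwy]|Hw].
  2:{ apply goursat; auto. intros x y Hx Hy. apply H; auto. intros E; injection E as -> ->. tauto. }
  assert (Hs : forall a' b' c' d', a <= a' -> b' <= b -> c <= c' -> d' <= d -> contrect f a' b' c' d').
  { intros a' b' c' d' ? ? ? ? x y Hx Hy. apply Hc; lra. }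
  assert (Hb : exists e0 M, 0 < e0 /\ 0 <= M /\ forall x y, Rabs (x - wx) <= e0 -> Rabs (y - wy) <= e0 -> Cmod (f (x, y)) <= M).
  { assert (H1 := Hc wx wy Hwx Hwy 1 Rlt_0_1). apply locally_Cmod in H1. destruct H1 as [e [He H1]].
    exists (e / 3), (Cmod (f (wx, wy)) + 1). split. lra. split. generalize (Cmod_ge_0 (f (wx, wy))); lra.
    intros x y Hx Hy.
    assert (Cmod (f (x, y) - f (wx, wy)) < 1).
    { apply H1. eapply Rle_lt_trans. apply Cmod_le_abs. simpl.
      unfold Rminus in Hx, Hy. lra. }
    generalize (Cmod_tri_inv (f (x, y)) (f (wx, wy))). lra. }
  destruct Hb as [e0 [M [He0 [HM Hb]]]].
  assert (HE : forall e, 0 < e -> e <= e0 -> Cmod (rect f a b c d) <= 2 * (4 * e) * M).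
  { intros e He Hee.
    set (a' := Rmax a (wx - e)). set (b' := Rmin b (wx + e)).
    set (c' := Rmax c (wy - e)). set (d' := Rmin d (wy + e)).
    assert (Ha' : a <= a' /\ wx - e <= a' /\ a' <= wx /\ (a' = a \/ a' = wx - e)).
    { unfold a', Rmax. destruct (Rle_dec a (wx - e)); lra. }
    assert (Hb' : b' <= b /\ b' <= wx + e /\ wx <= b' /\ (b' = b \/ b' = wx + e)).
    { unfold b', Rmin. destruct (Rle_dec b (wx + e)); lra. }
    assert (Hc' : c <= c' /\ wy - e <= c' /\ c' <= wy /\ (c' = c \/ c' = wy - e)).
    { unfold c', Rmax. destruct (Rle_dec c (wy - e)); lra. }
    assert (Hd' : d' <= d /\ d' <= wy + e /\ wy <= d' /\ (d' = d \/ d' = wy + e)).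
    { unfold d', Rmin. destruct (Rle_dec d (wy + e)); lra. }
    clearbody a' b' c' d'.
    assert (Z : forall x0 x1 y0 y1, a <= x0 -> x0 <= x1 -> x1 <= b -> c <= y0 -> y0 <= y1 -> y1 <= d ->
       x1 < wx \/ wx < x0 \/ y1 < wy \/ wy < y0 -> rect f x0 x1 y0 y1 = 0%C).
    { intros x0 x1 y0 y1 k1 k2 k3 k4 k5 k6 k7. apply goursat; auto. intros x y Hx Hy. apply H; try lra.
      intros E; injection E as -> ->. lra. }
    rewrite (rect_split f a b c d a' c'); try lra; auto.
    assert (Z1 : rect f a a' c c' = 0%C).
    { destruct Ha' as [? [? [? [E|E]]]]. rewrite E; apply rect_flat_x. apply Z; lra. }
    assert (Z2 : rect f a' b c c' = 0%C).
    { destruct Hc' as [? [? [? [E|E]]]]. rewrite E; apply rect_flat_y. apply Z; lra. }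
    assert (Z3 : rect f a a' c' d = 0%C).
    { destruct Ha' as [? [? [? [E|E]]]]. rewrite E; apply rect_flat_x. apply Z; lra. }
    rewrite Z1, Z2, Z3.
    rewrite (rect_split f a' b c' d b' d'); try lra; auto.
    2:{ apply Hs; lra. }
    assert (Z4 : rect f b' b c' d' = 0%C).
    { destruct Hb' as [? [? [? [E|E]]]]. rewrite E; apply rect_flat_x. apply Z; lra. }
    assert (Z5 : rect f a' b' d' d = 0%C).
    { destruct Hd' as [? [? [? [E|E]]]]. rewrite E; apply rect_flat_y. apply Z; lra. }
    assert (Z6 : rect f b' b d' d = 0%C).
    { destruct Hd' as [? [? [? [E|E]]]]. rewrite E; apply rect_flat_y. apply Z; lra. }
    rewrite Z4, Z5, Z6.
    match goal with |- Cmod ?X <= _ => replace X with (rect f a' b' c' d') by ring end.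
    eapply Rle_trans. apply rect_norm with (M := M); try lra. apply Hs; lra.
    intros x y Hx Hy. apply Hb; apply Rabs_le; lra.
    apply Rmult_le_compat_r; lra. }
  apply Cmod_eq_0. apply Rle_antisym; [|apply Cmod_ge_0].
  apply Rnot_lt_le. intros HN.
  set (X := Cmod (rect f a b c d)) in *.
  set (e := Rmin e0 (X / (16 * (M + 1)))).
  assert (0 < X / (16 * (M + 1))) by (apply Rdiv_lt_0_compat; lra).
  assert (He : 0 < e) by (apply Rmin_pos; auto).
  specialize (HE e He (Rmin_l _ _)).
  assert (He2 : e <= X / (16 * (M + 1))) by apply Rmin_r.
  assert (e * (16 * (M + 1)) <= X).
  { apply Rle_trans with (X / (16 * (M + 1)) * (16 * (M + 1))). apply Rmult_le_compat_r; lra.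
    right; field; lra. }
  nra.
Qed.

Lemma CI_swap : forall f a b, contR_on f a b -> CI f b a = (- CI f a b)%C.
Proof. intros. apply is_CI_unique. apply is_CI_swap, CI_correct; auto. Qed.

Definition disc (a : C) (r : R) (z : C) : Prop := Cmod (z - a) < r.

Lemma disc_corner : forall a r x y x' y', disc a r (x, y) ->
  Rmin (fst a) x <= x' <= Rmax (fst a) x -> Rmin (snd a) y <= y' <= Rmax (snd a) y ->
  disc a r (x', y').
Proof.
  intros [ax ay] r x y x' y' H Hx Hy. simpl in *. unfold disc in *.
  eapply Rle_lt_trans; [|exact H].
  assert (Ax : (x' - ax) * (x' - ax) <= (x - ax) * (x - ax)).
  { unfold Rmin, Rmax in Hx. destruct (Rle_dec ax x); nra. }
  assert (Ay : (y' - ay) * (y' - ay) <= (y - ay) * (y - ay)).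
  { unfold Rmin, Rmax in Hy. destruct (Rle_dec ay y); nra. }
  unfold Cmod. apply sqrt_le_1_alt. simpl. unfold Rminus in Ax, Ay. nra.
Qed.

(** The integral from [a] to [z] along a horizontal and then a vertical segment. *)
Definition prim_hv (f : C -> C) (a z : C) : C :=
  (hseg f (snd a) (fst a) (fst z) + vseg f (fst z) (snd a) (snd z))%C.

(** The two paths from the centre bound a rectangle inside the disc. The orders of the
    coordinates of its corners give four cases, which differ by signs. *)
Lemma prim_vh : forall f w a r z, (forall z, disc a r z -> contC f z) ->
  (forall z, disc a r z -> z <> w -> exists l, hasd f z l) -> disc a r z ->
  prim_hv f a z = (vseg f (fst a) (snd a) (snd z) + hseg f (snd z) (fst a) (fst z))%C.
Proof.
  intros f w [ax ay] r [x y] Hc Hd Hz. unfold prim_hv. simpl.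
  assert (Hin : forall x' y', Rmin ax x <= x' <= Rmax ax x -> Rmin ay y <= y' <= Rmax ay y ->
     disc (ax, ay) r (x', y')).
  { intros. apply disc_corner with x y; auto. }
  assert (Ch : forall y', Rmin ay y <= y' <= Rmax ay y -> contR_on (fun x => f (x, y')) ax x).
  { intros y' Hy' x' Hx'. apply contR_h, Hc, Hin; auto. }
  assert (Cv : forall x', Rmin ax x <= x' <= Rmax ax x -> contR_on (fun y => f (x', y)) ay y).
  { intros x' Hx' y' Hy'. apply contR_v, Hc, Hin; auto. }
  assert (Iax := conj (Rmin_l ax x) (Rmax_l ax x)). assert (Ix := conj (Rmin_r ax x) (Rmax_r ax x)).
  assert (Iay := conj (Rmin_l ay y) (Rmax_l ay y)). assert (Iy := conj (Rmin_r ay y) (Rmax_r ay y)).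
  assert (H0 : rect f (Rmin ax x) (Rmax ax x) (Rmin ay y) (Rmax ay y) = 0%C).
  { apply goursat_except with w; try lra.
    - intros x' y' Hx' Hy'. apply Hc, Hin; auto.
    - intros x' y' Hx' Hy' N. apply Hd; auto. }
  revert H0. unfold rect.
  assert (S1 : forall y', Rmin ay y <= y' <= Rmax ay y -> hseg f y' x ax = (- hseg f y' ax x)%C).
  { intros. apply CI_swap; auto. }
  assert (S2 : forall x', Rmin ax x <= x' <= Rmax ax x -> vseg f x' y ay = (- vseg f x' ay y)%C).
  { intros. unfold vseg. rewrite (CI_swap _ ay y); auto. ring. }
  rewrite <- (Cplus_0_r (hseg f ay ax x + vseg f x ay y)).
  assert (K : forall p q r s : C, (p + q - r - s)%C = 0%C -> (p + q = s + r)%C).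
  { intros p q r0 s0 E. replace (p + q)%C with ((p + q - r0 - s0) + (s0 + r0))%C by ring. rewrite E; ring. }
  rewrite Cplus_0_r.
  unfold Rmin, Rmax in *. destruct (Rle_dec ax x), (Rle_dec ay y); intros E.
  - apply K, E.
  - rewrite !S2 in E by lra. apply K.
    match type of E with ?X = _ => transitivity (- X)%C; [ring | rewrite E; ring] end.
  - rewrite !S1 in E by lra. apply K.
    match type of E with ?X = _ => transitivity (- X)%C; [ring | rewrite E; ring] end.
  - rewrite !S1, !S2 in E by lra. apply K.
    match type of E with ?X = _ => transitivity X; [ring | exact E] end.
Qed.

(** The increment from [z] to [z'] is an integral along two sides of a small rectangle: the
    vertical side comes from the definition of [prim_hv], the horizontal one from [prim_vh].
    The point [w] is there for difference quotients. *)
Theorem primitive_exists : forall (f : C -> C) w a r, (forall z, disc a r z -> contC f z) ->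
  (forall z, disc a r z -> z <> w -> exists l, hasd f z l) ->
  forall z, disc a r z -> hasd (prim_hv f a) z (f z).
Proof.
  intros f w a r Hc Hd [x y] Hz e He.
  destruct (proj1 (locally_Cmod _ _) (Hc _ Hz (e / 2) ltac:(lra))) as [d0 [Hd0 H0]].
  set (d := Rmin d0 (r - Cmod ((x, y) - a))).
  assert (Hdp : 0 < d) by (apply Rmin_pos; unfold disc in Hz; lra).
  exists d. split; auto. intros [x' y'] Hh.
  destruct (Rmin_Rgt_l _ _ _ Hh) as [Hh1 Hh2].
  assert (Hbox : forall x1 y1, Rmin x x' <= x1 <= Rmax x x' -> Rmin y y' <= y1 <= Rmax y y' ->
      Cmod ((x1, y1) - (x, y)) <= Cmod ((x', y') - (x, y))).
  { intros x1 y1 Hx1 Hy1. 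
    assert (Ax : (x1 - x) * (x1 - x) <= (x' - x) * (x' - x)).
    { unfold Rmin, Rmax in Hx1. destruct (Rle_dec x x'); nra. }
    assert (Ay : (y1 - y) * (y1 - y) <= (y' - y) * (y' - y)).
    { unfold Rmin, Rmax in Hy1. destruct (Rle_dec y y'); nra. }
    unfold Cmod. apply sqrt_le_1_alt. simpl. unfold Rminus in Ax, Ay. nra. }
  assert (Hin : forall x1 y1, Rmin x x' <= x1 <= Rmax x x' -> Rmin y y' <= y1 <= Rmax y y' ->
      disc a r (x1, y1)).
  { intros x1 y1 Hx1 Hy1. unfold disc.
    replace ((x1, y1) - a)%C with (((x1, y1) - (x, y)) + ((x, y) - a))%C by ring.
    eapply Rle_lt_trans. apply Cmod_triangle. generalize (Hbox x1 y1 Hx1 Hy1). lra. }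
  assert (Ix := conj (Rmin_l x x') (Rmax_l x x')). assert (Ix' := conj (Rmin_r x x') (Rmax_r x x')).
  assert (Iy := conj (Rmin_l y y') (Rmax_l y y')). assert (Iy' := conj (Rmin_r y y') (Rmax_r y y')).
  assert (E1 : (prim_hv f a (x', y') - prim_hv f a (x, y'))%C = hseg f y' x x').
  { rewrite !(prim_vh f w a r) by (auto; apply Hin; lra). simpl. unfold hseg.
    rewrite (CI_Chasles _ (fst a) x x'). ring.
    - intros t Ht. apply contR_h, Hc. apply disc_corner with x y'; auto.
      split; [apply Rmin_r|apply Rmax_r].
    - intros t Ht. apply contR_h, Hc. apply Hin; lra. }
  assert (E2 : (prim_hv f a (x, y') - prim_hv f a (x, y))%C = vseg f x y y').
  { unfold prim_hv. simpl. unfold vseg.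
    rewrite (CI_Chasles _ (snd a) y y'). ring.
    - intros t Ht. apply contR_v, Hc. apply disc_corner with x y; auto.
      split; [apply Rmin_r|apply Rmax_r].
    - intros t Ht. apply contR_v, Hc. apply Hin; lra. }
  assert (Hsmall : forall x1 y1, Rmin x x' <= x1 <= Rmax x x' -> Rmin y y' <= y1 <= Rmax y y' ->
      Cmod (f (x1, y1) - f (x, y)) <= e / 2).
  { intros x1 y1 Hx1 Hy1. left. apply H0. eapply Rle_lt_trans. apply Hbox; auto. auto. }
  assert (B1 : Cmod (hseg f y' x x' - RtoC (x' - x) * f (x, y)) <= Rabs (x' - x) * (e / 2)).
  { apply is_CI_norm with (fun t => f (t, y') - f (x, y))%C.
    - apply is_CI_minus. apply CI_correct. intros t Ht. apply contR_h, Hc, Hin; lra. apply is_CI_const.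
    - intros t Ht. apply Hsmall; lra. }
  assert (B2 : Cmod (vseg f x y y' - Ci * (RtoC (y' - y) * f (x, y))) <= Rabs (y' - y) * (e / 2)).
  { unfold vseg. replace (Ci * CI (fun t => f (x, t)) y y' - Ci * (RtoC (y' - y) * f (x, y)))%C
      with (Ci * (CI (fun t => f (x, t)) y y' - RtoC (y' - y) * f (x, y)))%C by ring.
    rewrite Cmod_mult, Cmod_Ci, Rmult_1_l.
    apply is_CI_norm with (fun t => f (x, t) - f (x, y))%C.
    - apply is_CI_minus. apply CI_correct. intros t Ht. apply contR_v, Hc, Hin; lra. apply is_CI_const.
    - intros t Ht. apply Hsmall; lra. }
  replace (prim_hv f a (x', y') - prim_hv f a (x, y) - ((x', y') - (x, y)) * f (x, y))%C
    with ((hseg f y' x x' - RtoC (x' - x) * f (x, y)) + (vseg f x y y' - Ci * (RtoC (y' - y) * f (x, y))))%C.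
  - eapply Rle_trans. apply Cmod_triangle.
    assert (A1 : Rabs (x' - x) <= Cmod ((x', y') - (x, y))) by exact (Cmod_ge_fst ((x', y') - (x, y))).
    assert (A2 : Rabs (y' - y) <= Cmod ((x', y') - (x, y))) by exact (Cmod_ge_snd ((x', y') - (x, y))).
    apply (Rmult_le_compat_r (e / 2)) in A1; [|lra]. apply (Rmult_le_compat_r (e / 2)) in A2; [|lra].
    lra.
  - rewrite <- E1, <- E2.
    assert (E : ((x', y') - (x, y))%C = (RtoC (x' - x) + Ci * RtoC (y' - y))%C).
    2:{ rewrite E. clear. generalize (prim_hv f a (x', y')) (prim_hv f a (x, y')) (prim_hv f a (x, y))
        (f (x, y)) (RtoC (x' - x)) (RtoC (y' - y)). intros p1 p2 p3 p4 p5 p6.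
        match goal with |- ?u = ?v => change (@eq C u v) end. ring. }
    apply injective_projections; simpl; ring.
Qed.

(** * Cauchy's formula and Taylor expansions *)

Definition holo (a : C) (r : R) (f : C -> C) : Prop :=
  forall z, disc a r z -> exists l, hasd f z l.

Lemma hasd_C_derive : forall f z, (exists l, hasd f z l) -> hasd f z (C_derive f z).
Proof.
  intros f z [l H]. apply hasd_is_derive. apply C_derive_correct. exact l.
  exists l. apply hasd_is_derive, H.
Qed.

Lemma C_derive_eq : forall f z l, hasd f z l -> C_derive f z = l.
Proof. intros f z l H. apply (hasd_unique f z); auto. apply hasd_C_derive. exists l; auto. Qed.

Definition circ (a : C) (r t : R) : C := (a + RtoC r * (cos t, sin t))%C.

Lemma circ_period : forall a r, circ a r (2 * PI) = circ a r 0.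
Proof. intros. unfold circ. rewrite cos_2PI, sin_2PI, cos_0, sin_0. reflexivity. Qed.

Lemma circ_mod : forall a r t, 0 <= r -> Cmod (circ a r t - a) = r.
Proof.
  intros a r t Hr. unfold circ.
  replace (a + RtoC r * (cos t, sin t) - a)%C with (RtoC r * (cos t, sin t))%C by ring.
  rewrite Cmod_mult, Cmod_R, Rabs_pos_eq by auto.
  unfold Cmod. simpl. replace (cos t * (cos t * 1) + sin t * (sin t * 1)) with 1.
  rewrite sqrt_1. ring. generalize (sin2_cos2 t). unfold Rsqr. lra.
Qed.

Lemma hasdR_circ : forall a r t, hasdR (circ a r) t (Ci * (circ a r t - a))%C.
Proof.
  intros a r t.
  replace (Ci * (circ a r t - a))%C with (((- sin t)%R, cos t) * RtoC r)%C.
  apply (hasd_comp_R (fun z => a + RtoC r * z)%C (fun t => (cos t, sin t))).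
  - eapply hasd_eq. apply hasd_plus. apply hasd_const. apply hasd_scal. apply hasd_id. ring.
  - apply hasdR_pair; auto_derive; auto; ring.
  - unfold circ. apply injective_projections; simpl; ring.
Qed.

Lemma contR_circ : forall a r t, contR (circ a r) t.
Proof. intros. eapply hasdR_cont. apply hasdR_circ. Qed.

Definition cont_circ (f : C -> C) (a : C) (r : R) : Prop := forall z, Cmod (z - a) = r -> contC f z.

Lemma contR_f_circ : forall f a r t, 0 <= r -> cont_circ f a r -> contR (fun t => f (circ a r t)) t.
Proof.
  intros f a r t Hr H. apply (clim_comp (circ a r) f (circ a r t)).
  apply contR_circ. apply H. apply circ_mod; auto.
Qed.

(** Contour integrals over circles are written as averages: the integral of [f z dz] is
    [2 pi i] times the average of [(z - a) * f z]. *)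
Definition mean (f : C -> C) (a : C) (r : R) : C :=
  (/ RtoC (2 * PI) * CI (fun t => f (circ a r t)) 0 (2 * PI))%C.

Lemma PI2_nz : RtoC (2 * PI) <> 0%C.
Proof. intros E. apply RtoC_inj in E. generalize PI_RGT_0. lra. Qed.

Lemma mean_is : forall f a r, 0 <= r -> cont_circ f a r ->
  is_CI (fun t => f (circ a r t)) 0 (2 * PI) (RtoC (2 * PI) * mean f a r)%C.
Proof.
  intros f a r Hr H. unfold mean. rewrite Cmult_assoc, Cinv_r, Cmult_1_l by apply PI2_nz.
  apply CI_correct. intros t _. apply contR_f_circ; auto.
Qed.

Lemma mean_unique : forall f a r l,
  is_CI (fun t => f (circ a r t)) 0 (2 * PI) (RtoC (2 * PI) * l)%C -> mean f a r = l.
Proof.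
  intros f a r l H. apply is_CI_unique in H. unfold mean. rewrite H.
  rewrite Cmult_assoc, Cinv_l, Cmult_1_l by apply PI2_nz. reflexivity.
Qed.

Lemma mean_norm : forall f a r M, 0 <= r -> cont_circ f a r ->
  (forall t, 0 <= t <= 2 * PI -> Cmod (f (circ a r t)) <= M) -> Cmod (mean f a r) <= M.
Proof.
  intros f a r M Hr H HM.
  assert (HP := PI_RGT_0).
  assert (Hn : Cmod (RtoC (2 * PI) * mean f a r) <= Rabs (2 * PI - 0) * M).
  { eapply is_CI_norm. apply mean_is; auto. intros t Ht. rewrite Rmin_left, Rmax_right in Ht by lra. apply HM; auto. }
  rewrite Cmod_mult, Cmod_R, !Rabs_pos_eq in Hn by lra.
  apply Rmult_le_reg_l with (2 * PI); lra.
Qed.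

Lemma mean_plus : forall f g a r, 0 <= r -> cont_circ f a r -> cont_circ g a r ->
  mean (fun z => f z + g z)%C a r = (mean f a r + mean g a r)%C.
Proof.
  intros. apply mean_unique. replace (RtoC (2 * PI) * (mean f a r + mean g a r))%C
    with (RtoC (2 * PI) * mean f a r + RtoC (2 * PI) * mean g a r)%C by ring.
  apply is_CI_plus; apply mean_is; auto.
Qed.

Lemma mean_scal : forall c f a r, 0 <= r -> cont_circ f a r ->
  mean (fun z => c * f z)%C a r = (c * mean f a r)%C.
Proof.
  intros. apply mean_unique. replace (RtoC (2 * PI) * (c * mean f a r))%C
    with (c * (RtoC (2 * PI) * mean f a r))%C by ring.
  apply is_CI_scal; apply mean_is; auto.
Qed.

Lemma mean_ext : forall f g a r, 0 <= r -> cont_circ f a r ->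
  (forall z, Cmod (z - a) = r -> f z = g z) -> mean g a r = mean f a r.
Proof.
  intros f g a r Hr Hf H. apply mean_unique. eapply is_CI_ext; [|apply mean_is; eassumption].
  intros t _. simpl. apply H, circ_mod; auto.
Qed.

(** Up to the factor [Ci], the integrand is the derivative of [F] along the circle. *)
Lemma mean_primitive : forall F f a r, 0 <= r ->
  (forall z, Cmod (z - a) = r -> hasd F z (f z)) -> cont_circ f a r ->
  mean (fun z => (z - a) * f z)%C a r = 0%C.
Proof.
  intros F f a r Hr H Hf. apply mean_unique.
  assert (E : CI (fun t => Ci * (circ a r t - a) * f (circ a r t))%C 0 (2 * PI) = 0%C).
  { rewrite (CI_derive (fun t => F (circ a r t))). rewrite circ_period. ring.
    - intros t _. apply hasd_comp_R. apply H, circ_mod; auto. apply hasdR_circ.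
    - intros t _. apply clim_mult. apply clim_mult. apply clim_const.
      apply clim_minus. apply contR_circ. apply clim_const. apply contR_f_circ; auto. }
  apply is_CI_ext with (fun t => - Ci * (Ci * (circ a r t - a) * f (circ a r t)))%C.
  - intros t _.
    transitivity ((- Ci * Ci) * ((circ a r t - a) * f (circ a r t)))%C. ring.
    replace (- Ci * Ci)%C with (RtoC 1). ring. apply injective_projections; simpl; ring.
  - replace (RtoC (2 * PI) * 0)%C with (- Ci * 0)%C by ring.
    rewrite <- E. apply is_CI_scal. apply CI_correct.
    intros t _. apply clim_mult. apply clim_mult. apply clim_const.
      apply clim_minus. apply contR_circ. apply clim_const. apply contR_f_circ; auto.
Qed.

(** Continuous across [w] by the choice of its value there, the difference quotient satisfies
    the hypotheses of [primitive_exists] with [w] as exceptional point. *)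
Lemma difference_quotient : forall f a r w q, holo a r f -> contC q w ->
  (forall z, f z = (f w + (z - w) * q z)%C) ->
  (forall z, disc a r z -> contC q z) /\ (forall z, disc a r z -> hasd (prim_hv q a) z (q z)).
Proof.
  intros f a r w q Hf Q1 Q3.
  assert (Hq : forall z, disc a r z -> z <> w -> exists l, hasd q z l).
  { intros z Hz Hzw. destruct (Hf z Hz) as [m Hm]. eexists.
    apply (hasd_ext_loc (fun z => (f z - f w) / (z - w))%C).
    - assert (Hp : 0 < Cmod (z - w)) by (apply Cmod_gt_0, Cminus_eq_contra; auto).
      apply locally_Cmod. exists (Cmod (z - w)). split; auto.
      intros y Hy. rewrite (Q3 y). field. apply Cminus_eq_contra. intros ->.
      rewrite Cmod_sub_sym in Hy. lra.
    - apply hasd_div. apply hasd_minus. exact Hm. apply hasd_const. apply hasd_shift.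
      apply Cminus_eq_contra; auto. }
  assert (Cq : forall z, disc a r z -> contC q z).
  { intros z Hz. destruct (classic (z = w)) as [->|N]; auto.
    destruct (Hq z Hz N) as [m Hm]. eapply hasd_cont, Hm. }
  split; auto. apply (primitive_exists q w); auto.
Qed.

Lemma cauchy_quotient : forall f a r0 r w, 0 <= r -> r < r0 -> holo a r0 f -> Cmod (w - a) < r ->
  mean (fun z => (z - a) * ((f z - f w) / (z - w)))%C a r = 0%C.
Proof.
  intros f a r0 r w Hr Hrr Hf Hw.
  destruct (Hf w) as [l Hl]. unfold disc; lra.
  destruct (proj1 (hasd_caratheodory _ _ _) Hl) as [q [Q0 [Q1 Q2]]]. rewrite <- Q1 in Q0.
  destruct (difference_quotient f a r0 w q Hf Q0 Q2) as [Q3 Q4].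
  assert (Hdz : forall z, Cmod (z - a) = r -> disc a r0 z) by (intros z Hz; unfold disc; lra).
  assert (Cc : cont_circ q a r) by (intros z Hz; apply Q3; auto).
  rewrite (mean_ext (fun z => (z - a) * q z)%C); auto.
  - apply mean_primitive with (prim_hv q a); auto.
  - intros z Hz. apply clim_mult. apply clim_shift. auto.
  - intros z Hz. rewrite (Q2 z). field. apply Cminus_eq_contra. intros ->. lra.
Qed.

Definition cser (c : nat -> C) (l : C) : Prop :=
  is_series (K := C_AbsRing) (V := C_NormedModule) c l.

Definition csum (c : nat -> C) (n : nat) : C := sum_n (G := C_AbelianMonoid) c n.

Lemma cser_clim : forall c l, cser c l <-> clim eventually (csum c) l.
Proof.
  intros c l. unfold cser, is_series. symmetry.
  apply (clim_filterlim eventually (csum c) l).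
Qed.

Lemma csum_S : forall c n, csum c (S n) = (csum c n + c (S n))%C.
Proof. intros. unfold csum. rewrite sum_Sn. reflexivity. Qed.

Lemma csum_0 : forall c, csum c 0 = c 0%nat.
Proof. intros. unfold csum. rewrite sum_O. reflexivity. Qed.

Lemma geom_cv : forall q K e, 0 <= q < 1 -> 0 < e -> exists N, forall n, (N <= n)%nat -> K * q ^ n < e.
Proof.
  intros q K e Hq He.
  destruct (pow_lt_1_zero q) with (y := e / (Rabs K + 1)) as [N HN].
  rewrite Rabs_pos_eq; lra. apply Rdiv_lt_0_compat; auto. generalize (Rabs_pos K); lra.
  exists N. intros n Hn. specialize (HN n Hn).
  assert (Hp : 0 <= q ^ n) by (apply pow_le; lra).
  rewrite Rabs_pos_eq in HN by auto.
  assert (HK := Rabs_pos K). assert (HK' := Rle_abs K).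
  assert (q ^ n * (Rabs K + 1) < e).
  { apply Rmult_lt_reg_r with (/ (Rabs K + 1)). apply Rinv_0_lt_compat; lra.
    rewrite Rmult_assoc, Rinv_r, Rmult_1_r by lra. exact HN. }
  nra.
Qed.

(** The kernel is expanded as a finite geometric sum with a remainder bounded uniformly on the
    circle, so that no limit has to be exchanged with an integral. *)
Lemma cauchy_transform_series : forall f a r w M, 0 < r -> cont_circ f a r ->
  (forall t, 0 <= t <= 2 * PI -> Cmod (f (circ a r t)) <= M) -> Cmod (w - a) < r ->
  cser (fun n => mean (fun z => f z / (z - a) ^ n)%C a r * (w - a) ^ n)%C
    (mean (fun z => f z * ((z - a) / (z - w)))%C a r).
Proof.
  intros f a r w M Hr Hf HM Hw.
  assert (Hw0 := Cmod_ge_0 (w - a)).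
  assert (HM0 : 0 <= M).
  { eapply Rle_trans; [apply Cmod_ge_0|]. apply (HM 0). generalize PI_RGT_0; lra. }
  assert (Hza : forall z, Cmod (z - a) = r -> (z - a)%C <> 0%C).
  { intros z Hz. apply Cmod_gt_0. lra. }
  assert (Hzw : forall z, Cmod (z - a) = r -> (z - w)%C <> 0%C).
  { intros z Hz. apply Cmod_gt_0. generalize (Cmod_tri_inv (z - a) (w - a)).
    replace (z - a - (w - a))%C with (z - w)%C by ring. lra. }
  assert (Cshift : forall b z, contC (fun z => z - b)%C z).
  { intros. apply clim_shift. }
  assert (Cn : forall n, cont_circ (fun z => f z / (z - a) ^ n)%C a r).
  { intros n z Hz. apply clim_mult. auto. apply clim_inv. apply clim_pow. apply Cshift.
    apply Cpow_nz. auto. }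
  assert (Ck : cont_circ (fun z => (z - a) / (z - w))%C a r).
  { intros z Hz. apply clim_mult. apply Cshift. apply clim_inv. apply Cshift. auto. }
  assert (Ct : forall n, cont_circ (fun z => f z * (((w - a) / (z - a)) ^ n * ((z - a) / (z - w))))%C a r).
  { intros n z Hz. apply clim_mult. auto. apply clim_mult. apply clim_pow. apply clim_mult.
    apply clim_const. apply clim_inv. apply Cshift. auto. apply Ck; auto. }
  assert (E : forall n, mean (fun z => f z * ((z - a) / (z - w)))%C a r =
    (csum (fun n => mean (fun z => f z / (z - a) ^ n)%C a r * (w - a) ^ n)%C n +
     mean (fun z => f z * (((w - a) / (z - a)) ^ (S n) * ((z - a) / (z - w))))%C a r)%C).
  { assert (S0 : forall n, mean (fun z => f z * (((w - a) / (z - a)) ^ n * ((z - a) / (z - w))))%C a r =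
      (mean (fun z => f z / (z - a) ^ n)%C a r * (w - a) ^ n +
       mean (fun z => f z * (((w - a) / (z - a)) ^ (S n) * ((z - a) / (z - w))))%C a r)%C).
    { intros n. assert (Cn' : cont_circ (fun z => (w - a) ^ n * (f z / (z - a) ^ n))%C a r).
      { intros z Hz. apply clim_mult; [apply clim_const | apply Cn; auto]. }
      rewrite (Cmult_comm _ ((w - a) ^ n)).
      rewrite <- mean_scal; [|lra|apply Cn]. rewrite <- mean_plus; [|lra|exact Cn'|apply (Ct (S n))].
      apply mean_ext; try lra.
      - intros z Hz. apply clim_plus. apply Cn'; auto. apply (Ct (S n)); auto.
      - intros z Hz. rewrite Cpow_S. unfold Cdiv. rewrite Cpow_mult_l, Cpow_inv by auto.
        field. repeat split; auto using Cpow_nz. }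
    intros n. induction n.
    - rewrite csum_0, <- S0. apply mean_ext; try lra; auto. intros z Hz. ring.
    - rewrite IHn, S0, csum_S. ring. }
  apply cser_clim. intros e He.
  set (q := Cmod (w - a) / r).
  assert (Hq : 0 <= q < 1).
  { unfold q. split. apply Rle_div_r; lra. apply Rlt_div_l; lra. }
  destruct (geom_cv q (M * (r / (r - Cmod (w - a)))) e Hq He) as [N HN].
  exists N. intros n Hn. rewrite (E n).
  match goal with |- Cmod (?X - (?X + ?Y)) < _ => replace (X - (X + Y))%C with (- Y)%C by ring end.
  rewrite Cmod_opp. eapply Rle_lt_trans; [|apply (HN (S n)); lia].
  apply mean_norm; try lra; auto.
  intros t Ht. specialize (HM t Ht). assert (Hz := circ_mod a r t (Rlt_le _ _ Hr)).
  set (z := circ a r t) in *. rewrite !Cmod_mult, Cmod_pow, !Cmod_div by auto. rewrite Hz.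
  fold q. replace (M * (r / (r - Cmod (w - a))) * q ^ S n) with (M * (q ^ S n * (r / (r - Cmod (w - a))))) by ring.
  apply Rmult_le_compat; auto using Cmod_ge_0.
  { apply Rmult_le_pos. apply pow_le; lra. apply Rle_div_r. apply Cmod_gt_0; auto. lra. }
  apply Rmult_le_compat_l. apply pow_le; lra.
  apply Rmult_le_compat_l. lra. apply Rinv_le_contravar. lra.
  generalize (Cmod_tri_inv (z - a) (w - a)).
  replace (z - a - (w - a))%C with (z - w)%C by ring. lra.
Qed.

Lemma mean_const : forall c a r, mean (fun _ => c) a r = c.
Proof.
  intros. apply mean_unique. replace (2 * PI) with (2 * PI - 0) at 2 by ring. apply is_CI_const.
Qed.

Lemma mean_inv_pow : forall a r n, 0 < r -> mean (fun z => 1 / (z - a) ^ S n)%C a r = 0%C.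
Proof.
  intros a r n Hr.
  assert (Hza : forall z, Cmod (z - a) = r -> (z - a)%C <> 0%C).
  { intros z Hz. apply Cmod_gt_0. lra. }
  assert (Hn : RtoC (INR (S n)) <> 0%C).
  { intros E. apply RtoC_inj in E. generalize (pos_INR n). rewrite S_INR in E. lra. }
  assert (Cf : cont_circ (fun z => 1 / (z - a) ^ S (S n))%C a r).
  { intros z Hz. apply clim_mult. apply clim_const. apply clim_inv. apply clim_pow.
    apply clim_shift. apply Cpow_nz; auto. }
  rewrite (mean_ext (fun z => (z - a) * (1 / (z - a) ^ S (S n)))%C); try lra.
  - apply mean_primitive with (fun z => - / RtoC (INR (S n)) * / (z - a) ^ S n)%C; try lra; auto.
    intros z Hz. eapply hasd_eq. apply hasd_scal. apply hasd_inv.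
    apply (hasd_comp (fun z => z ^ S n)%C (fun z => z - a)%C). apply hasd_pow. apply hasd_shift.
    apply Cpow_nz; auto.
    change (Init.Nat.pred (S n)) with n. rewrite !(Cpow_S (z - a)). cbv beta.
    field. repeat split; auto using Cpow_nz.
  - intros z Hz. apply clim_mult. apply clim_shift. apply Cf; auto.
  - intros z Hz. rewrite !Cpow_S. field. split; auto using Cpow_nz.
Qed.

(** The [n]-th Taylor coefficient at [a] as an average over a circle. *)
Definition coef (f : C -> C) (a : C) (r : R) (n : nat) : C :=
  mean (fun z => f z / (z - a) ^ n)%C a r.

Lemma holo_cont_circ : forall f a r0 r, holo a r0 f -> r < r0 -> cont_circ f a r.
Proof.
  intros f a r0 r H Hr z Hz. destruct (H z) as [l Hl]. unfold disc; lra. eapply hasd_cont, Hl.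
Qed.

Lemma circ_bounded : forall f a r, 0 <= r -> cont_circ f a r ->
  exists M, 0 <= M /\ forall t, 0 <= t <= 2 * PI -> Cmod (f (circ a r t)) <= M.
Proof.
  intros f a r Hr H. generalize PI_RGT_0; intros HP.
  destruct (continuity_ab_maj (fun t => Cmod (f (circ a r t))) 0 (2 * PI)) as [t [Ht _]].
  - lra.
  - intros t _. apply continuity_pt_filterlim. intros P [e He].
    unfold filtermap. apply (filter_imp (F := Rnbhs t)) with (2 := contR_f_circ f a r t Hr H e (cond_pos e)).
    intros x Hx. apply He. unfold ball; simpl. unfold AbsRing_ball, abs, minus, plus, opp; simpl.
    eapply Rle_lt_trans; [|exact Hx]. apply Rabs_le.
    generalize (Cmod_tri_inv (f (circ a r x)) (f (circ a r t))).
    generalize (Cmod_tri_inv (f (circ a r t)) (f (circ a r x))).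
    rewrite (Cmod_sub_sym (f (circ a r t))). unfold Rminus. lra.
  - exists (Cmod (f (circ a r t))). split. apply Cmod_ge_0. exact Ht.
Qed.

(** The mean of the difference quotient vanishes, which reduces the formula to the constant
    function 1; the expansion of its Cauchy transform has a single nonzero term. *)
Theorem cauchy_formula : forall f a r0 r w, 0 < r -> r < r0 -> holo a r0 f -> Cmod (w - a) < r ->
  mean (fun z => f z * ((z - a) / (z - w)))%C a r = f w.
Proof.
  intros f a r0 r w Hr Hrr Hf Hw.
  assert (Hzw : forall z, Cmod (z - a) = r -> (z - w)%C <> 0%C).
  { intros z Hz. apply Cmod_gt_0. generalize (Cmod_tri_inv (z - a) (w - a)).
    replace (z - a - (w - a))%C with (z - w)%C by ring. lra. }
  assert (Cf := holo_cont_circ f a r0 r Hf Hrr).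
  assert (Ck : cont_circ (fun z => (z - a) / (z - w))%C a r).
  { intros z Hz. apply clim_mult. apply clim_shift.
    apply clim_inv. apply clim_shift. auto. }
  (* The constant function 1 gives the normalisation. *)
  assert (K1 : mean (fun z => (z - a) / (z - w))%C a r = 1%C).
  { assert (S1 : cser (fun n => mean (fun z => 1 / (z - a) ^ n)%C a r * (w - a) ^ n)%C
      (mean (fun z => 1 * ((z - a) / (z - w)))%C a r)).
    { apply (cauchy_transform_series (fun _ => 1%C) a r w 1); auto. intros z _; apply clim_const.
      intros t _. rewrite Cmod_1; lra. }
    rewrite (mean_ext (fun z => 1 * ((z - a) / (z - w)))%C); try lra.
    - apply cser_clim in S1. apply (clim_unique eventually _ _ _ S1).
      apply (clim_ext_loc (fun _ => 1%C)); [|apply clim_const]. apply filter_forall. intros n.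
      induction n. rewrite csum_0. simpl. rewrite Cmult_1_r. symmetry.
      rewrite (mean_ext (fun _ => 1%C)). apply mean_const. lra. intros z _; apply clim_const.
      intros; field; exact C1_nz. rewrite csum_S, <- IHn, mean_inv_pow; auto. ring.
    - intros z Hz. apply clim_mult. apply clim_const. apply Ck; auto.
    - intros z Hz. ring. }
  rewrite (mean_ext (fun z => (z - a) * ((f z - f w) / (z - w)) + f w * ((z - a) / (z - w)))%C); try lra.
  - rewrite mean_plus; try lra.
    + rewrite (cauchy_quotient f a r0); auto; try lra. rewrite mean_scal; auto; try lra.
      rewrite K1. ring.
    + intros z Hz. apply clim_mult. apply clim_shift.
      apply clim_mult. apply clim_minus. apply Cf; auto. apply clim_const.
      apply clim_inv. apply clim_shift. auto.
    + intros z Hz. apply clim_mult. apply clim_const. apply Ck; auto.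
  - intros z Hz. apply clim_plus. apply clim_mult. apply clim_shift.
      apply clim_mult. apply clim_minus. apply Cf; auto. apply clim_const.
      apply clim_inv. apply clim_shift. auto.
      apply clim_mult. apply clim_const. apply Ck; auto.
  - intros z Hz. field. auto.
Qed.

Theorem taylor : forall f a r0 r w, 0 < r -> r < r0 -> holo a r0 f -> Cmod (w - a) < r ->
  cser (fun n => coef f a r n * (w - a) ^ n)%C (f w).
Proof.
  intros f a r0 r w Hr Hrr Hf Hw.
  assert (Cf := holo_cont_circ f a r0 r Hf Hrr).
  destruct (circ_bounded f a r) as [M [_ HM]]; auto; try lra.
  rewrite <- (cauchy_formula f a r0 r w); auto. apply cauchy_transform_series with M; auto.
Qed.

Lemma cauchy_estimate_circ : forall f a r0 r n M, 0 < r -> r < r0 -> holo a r0 f ->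
  (forall t, 0 <= t <= 2 * PI -> Cmod (f (circ a r t)) <= M) -> Cmod (coef f a r n) <= M / r ^ n.
Proof.
  intros f a r0 r n M Hr Hrr Hf HM.
  assert (Cf := holo_cont_circ f a r0 r Hf Hrr).
  unfold coef. apply mean_norm; try lra.
  - intros z Hz. apply clim_mult. auto. apply clim_inv. apply clim_pow.
    apply clim_shift. apply Cpow_nz. apply Cmod_gt_0. lra.
  - intros t Ht. assert (Hz := circ_mod a r t (Rlt_le _ _ Hr)). specialize (HM t Ht).
    set (z := circ a r t) in *. rewrite Cmod_div, Cmod_pow, Hz.
    apply Rmult_le_compat_r; auto. left. apply Rinv_0_lt_compat, pow_lt; auto.
    apply Cpow_nz, Cmod_gt_0. lra.
Qed.

Lemma cauchy_estimate : forall f a r0 r n M, 0 < r -> r < r0 -> holo a r0 f ->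
  (forall z, Cmod (z - a) = r -> Cmod (f z) <= M) -> Cmod (coef f a r n) <= M / r ^ n.
Proof.
  intros f a r0 r n M Hr Hrr Hf HM. apply cauchy_estimate_circ with r0; auto.
  intros t _. apply HM, circ_mod; lra.
Qed.

Lemma coef_0 : forall f a r0 r, 0 < r -> r < r0 -> holo a r0 f -> coef f a r 0 = f a.
Proof.
  intros f a r0 r Hr Hrr Hf.
  assert (Cf := holo_cont_circ f a r0 r Hf Hrr).
  rewrite <- (cauchy_formula f a r0 r a); auto.
  - unfold coef. apply mean_ext; try lra.
    + intros z Hz. apply clim_mult. auto. 
      apply (clim_ext_loc (fun _ => 1%C)).
      * apply locally_Cmod. exists r; split; auto. intros y Hy. symmetry.
        unfold Cdiv. apply Cinv_r. apply Cmod_gt_0.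
        generalize (Cmod_tri_inv (z - a) (z - y)).
        replace (z - a - (z - y))%C with (y - a)%C by ring. rewrite (Cmod_sub_sym z y). lra.
      * replace ((z - a) / (z - a))%C with (RtoC 1). apply clim_const.
        symmetry. unfold Cdiv. apply Cinv_r. apply Cmod_gt_0. lra.
    + intros z Hz. simpl. field. apply Cmod_gt_0; lra.
  - rewrite Cmod_self. auto.
Qed.

(** Integration by parts along the circle. *)
Lemma coef_derive : forall f f' a r0 r n, 0 < r -> r < r0 ->
  (forall z, disc a r0 z -> hasd f z (f' z)) -> cont_circ f' a r ->
  coef f' a r n = (RtoC (INR (S n)) * coef f a r (S n))%C.
Proof.
  intros f f' a r0 r n Hr Hrr Hf Cf'.
  assert (Cf : cont_circ f a r).
  { intros z Hz. eapply hasd_cont. apply Hf. unfold disc; lra. }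
  assert (Hza : forall z, Cmod (z - a) = r -> (z - a)%C <> 0%C).
  { intros z Hz. apply Cmod_gt_0. lra. }
  assert (Ci : forall m, cont_circ (fun z => / (z - a) ^ m)%C a r).
  { intros m z Hz. apply clim_inv. apply clim_pow.
    apply clim_shift. apply Cpow_nz; auto. }
  assert (Cp : cont_circ (fun z => z - a)%C a r).
  { intros z Hz. apply clim_shift. }
  assert (Cg : cont_circ (fun z => f' z * / (z - a) ^ S n + f z * (- RtoC (INR (S n)) * / (z - a) ^ S (S n)))%C a r).
  { intros z Hz. apply clim_plus; apply clim_mult; auto. apply Ci; auto. apply clim_mult.
    apply clim_const. apply (Ci (S (S n))); auto. }
  assert (E : mean (fun z => (z - a) * (f' z * / (z - a) ^ S n + f z * (- RtoC (INR (S n)) * / (z - a) ^ S (S n))))%C a r = 0%C).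
  { apply mean_primitive with (fun z => f z * / (z - a) ^ S n)%C; auto; try lra.
    intros z Hz. eapply hasd_eq. apply hasd_mult. apply Hf; unfold disc; lra. apply hasd_inv.
    apply (hasd_comp (fun z => z ^ S n)%C (fun z => z - a)%C). apply hasd_pow. apply hasd_shift.
    apply Cpow_nz; auto.
    change (Init.Nat.pred (S n)) with n. rewrite !(Cpow_S (z - a)). cbv beta.
    field. repeat split; auto using Cpow_nz. }
  assert (E2 : mean (fun z => (z - a) * (f' z * / (z - a) ^ S n + f z * (- RtoC (INR (S n)) * / (z - a) ^ S (S n))))%C a r
     = (coef f' a r n + - RtoC (INR (S n)) * coef f a r (S n))%C).
  { assert (C1 : cont_circ (fun z => f' z / (z - a) ^ n)%C a r).
    { intros z Hz. apply clim_mult. auto. apply Ci; auto. }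
    assert (C2 : cont_circ (fun z => f z / (z - a) ^ S n)%C a r).
    { intros z Hz. apply clim_mult. auto. apply (Ci (S n)); auto. }
    assert (C3 : cont_circ (fun z => - RtoC (INR (S n)) * (f z / (z - a) ^ S n))%C a r).
    { intros z Hz. apply clim_mult. apply clim_const. apply C2; auto. }
    unfold coef. rewrite <- mean_scal; try lra; auto. rewrite <- mean_plus; try lra; auto.
    apply mean_ext; try lra.
    - intros z Hz. apply clim_plus. apply C1; auto. apply C3; auto.
    - intros z Hz. rewrite !Cpow_S. field. repeat split; auto using Cpow_nz. }
  rewrite E in E2. 
  replace (coef f' a r n) with ((coef f' a r n + - RtoC (INR (S n)) * coef f a r (S n)) + RtoC (INR (S n)) * coef f a r (S n))%C by ring.
  rewrite <- E2. ring.
Qed.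

(** * Consequences of Cauchy's formula *)

(** A quadratic remainder that is uniform on the circle is inherited by the mean. *)
Lemma hasd_mean_param : forall (g : C -> C) (k : C -> C -> C) (k1 : C -> C) a r w d K,
  0 < r -> 0 < d -> 0 <= K -> cont_circ g a r ->
  (forall w', Cmod (w' - w) <= d -> cont_circ (fun z => g z * k w' z)%C a r) ->
  cont_circ (fun z => g z * k1 z)%C a r ->
  (forall w' z, Cmod (w' - w) <= d -> Cmod (z - a) = r ->
     Cmod (k w' z - k w z - (w' - w) * k1 z) <= K * (Cmod (w' - w) * Cmod (w' - w))) ->
  hasd (fun w => mean (fun z => g z * k w z)%C a r) w (mean (fun z => g z * k1 z)%C a r).
Proof.
  intros g k k1 a r w d K Hr Hd HK Cg Ck Ck1 H.
  destruct (circ_bounded g a r) as [M [HM0 HM]]; auto; try lra.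
  apply hasd_quad with d (M * K); auto. apply Rmult_le_pos; auto. intros w' H1.
  assert (A2 := Ck w ltac:(rewrite Cmod_self; lra)). assert (A1 := Ck w' H1).
  assert (A3 : cont_circ (fun z => (-1) * (g z * k w z))%C a r).
  { intros z Hz. apply clim_mult. apply clim_const. apply A2; auto. }
  assert (A4 : cont_circ (fun z => (- (w' - w)) * (g z * k1 z))%C a r).
  { intros z Hz. apply clim_mult. apply clim_const. apply Ck1; auto. }
  assert (A5 : cont_circ (fun z => (-1) * (g z * k w z) + (- (w' - w)) * (g z * k1 z))%C a r).
  { intros z Hz. apply clim_plus; auto. }
  assert (E : (mean (fun z => g z * k w' z) a r - mean (fun z => g z * k w z) a r
      - (w' - w) * mean (fun z => g z * k1 z) a r)%C
      = mean (fun z => g z * k w' z + ((-1) * (g z * k w z) + (- (w' - w)) * (g z * k1 z)))%C a r).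
  { rewrite !mean_plus; auto; try lra. rewrite !mean_scal; auto; try lra. ring. }
  rewrite E. apply mean_norm; try lra.
  - intros z Hz. apply clim_plus; auto.
  - intros t Ht. specialize (HM t Ht). assert (Hz := circ_mod a r t (Rlt_le _ _ Hr)).
    generalize dependent (circ a r t). intros z Mz Hz.
    replace (g z * k w' z + ((-1) * (g z * k w z) + (- (w' - w)) * (g z * k1 z)))%C
      with (g z * (k w' z - k w z - (w' - w) * k1 z))%C by ring.
    rewrite Cmod_mult, Rmult_assoc. apply Rmult_le_compat; try apply Cmod_ge_0. exact Mz. exact (H w' z H1 Hz).
Qed.

Lemma circ_dist : forall a r w z, Cmod (z - a) = r -> r - Cmod (w - a) <= Cmod (z - w).
Proof.
  intros a r w z Hz. generalize (Cmod_tri_inv (z - a) (w - a)).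
  replace (z - a - (w - a))%C with (z - w)%C by ring. lra.
Qed.

Lemma kernel_estimate_1 : forall (D h : C) m, 0 < m -> m <= Cmod D -> m <= Cmod (D - h) ->
  Cmod (/ (D - h) - / D - h * / (D * D)) <= / (m * m * m) * (Cmod h * Cmod h).
Proof.
  intros D h m Hm H1 H2.
  assert (N1 : D <> 0%C) by (apply Cmod_gt_0; lra). assert (N2 : (D - h)%C <> 0%C) by (apply Cmod_gt_0; lra).
  replace (/ (D - h) - / D - h * / (D * D))%C with (h * h * / (D * D * (D - h)))%C by (field; auto).
  rewrite !Cmod_mult, Cmod_inv by (repeat apply Cmult_neq_0; auto). rewrite !Cmod_mult, Rmult_comm.
  apply Rmult_le_compat_r. apply Rle_0_sqr.
  assert (A : m * m <= Cmod D * Cmod D) by (apply Rmult_le_compat; lra).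
  assert (P : 0 < m * m) by (apply Rmult_lt_0_compat; lra).
  apply Rinv_le_contravar. apply Rmult_lt_0_compat; lra.
  apply Rmult_le_compat; lra.
Qed.

Lemma kernel_estimate_2 : forall (D h : C) m, 0 < m -> m <= Cmod D -> m <= Cmod (D - h) ->
  Cmod (/ ((D - h) * (D - h)) - / (D * D) - h * (2 * / (D * D * D))) <= 3 * / (m * m * (m * m)) * (Cmod h * Cmod h).
Proof.
  intros D h m Hm H1 H2.
  assert (N1 : D <> 0%C) by (apply Cmod_gt_0; lra). assert (N2 : (D - h)%C <> 0%C) by (apply Cmod_gt_0; lra).
  replace (/ ((D - h) * (D - h)) - / (D * D) - h * (2 * / (D * D * D)))%C
    with ((h * h) * (/ (D * D * ((D - h) * (D - h))) + 2 * / (D * D * (D * (D - h)))))%C by (field; auto).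
  rewrite Cmod_mult, Rmult_comm, (Cmod_mult h h). apply Rmult_le_compat_r. apply Rle_0_sqr.
  eapply Rle_trans. apply Cmod_triangle. rewrite (Cmod_mult 2), !Cmod_inv by (repeat apply Cmult_neq_0; auto).
  rewrite !Cmod_mult, Cmod_R, Rabs_pos_eq by lra.
  assert (A0 : m * m <= Cmod D * Cmod D) by (apply Rmult_le_compat; lra).
  assert (B0 : m * m <= Cmod (D - h) * Cmod (D - h)) by (apply Rmult_le_compat; lra).
  assert (C0 : m * m <= Cmod D * Cmod (D - h)) by (apply Rmult_le_compat; lra).
  assert (P : 0 < m * m) by (apply Rmult_lt_0_compat; lra).
  assert (P2 : 0 < m * m * (m * m)) by (apply Rmult_lt_0_compat; lra).
  assert (A : / (Cmod D * Cmod D * (Cmod (D - h) * Cmod (D - h))) <= / (m * m * (m * m))).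
  { apply Rinv_le_contravar. lra. apply Rmult_le_compat; lra. }
  assert (B : / (Cmod D * Cmod D * (Cmod D * Cmod (D - h))) <= / (m * m * (m * m))).
  { apply Rinv_le_contravar. lra. apply Rmult_le_compat; lra. }
  lra.
Qed.

Lemma cauchy_int_derive : forall g a r w, 0 < r -> cont_circ g a r -> Cmod (w - a) < r ->
  hasd (fun w => mean (fun z => g z * / (z - w))%C a r) w (mean (fun z => g z * / ((z - w) * (z - w)))%C a r)
  /\ exists l, hasd (fun w => mean (fun z => g z * / ((z - w) * (z - w)))%C a r) w l.
Proof.
  intros g a r w Hr Cg Hw.
  assert (Hm : exists m, 0 < m /\ forall w' z, Cmod (w' - w) <= m -> Cmod (z - a) = r -> m <= Cmod (z - w')).
  { exists ((r - Cmod (w - a)) / 2). split. lra. intros w' z H Hz. generalize (circ_dist a r w' z Hz).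
    assert (T := Cmod_triangle (w' - w) (w - a)). replace (w' - w + (w - a))%C with (w' - a)%C in T by ring. lra. }
  destruct Hm as [m [Hm Hmm]].
  assert (Hnz : forall w' z, Cmod (w' - w) <= m -> Cmod (z - a) = r -> (z - w')%C <> 0%C).
  { intros w' z H Hz. apply Cmod_gt_0. generalize (Hmm w' z H Hz). lra. }
  assert (Hw0 : Cmod (w - w) <= m) by (rewrite Cmod_self; lra).
  assert (C2 : forall w', Cmod (w' - w) <= m -> cont_circ (fun z => g z * / ((z - w') * (z - w')))%C a r).
  { intros w' H z Hz. apply clim_mult. apply Cg; auto. apply clim_inv. apply clim_mult; apply clim_shift.
    apply Cmult_neq_0; apply Hnz; auto. }
  assert (P3 : 0 < m * m * m) by (repeat apply Rmult_lt_0_compat; auto).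
  split; [|eexists].
  - apply (hasd_mean_param g (fun w z => / (z - w))%C (fun z => / ((z - w) * (z - w)))%C a r w m (/ (m * m * m))); auto.
    + left. apply Rinv_0_lt_compat; auto.
    + intros w' H z Hz. apply clim_mult. apply Cg; auto. apply clim_inv. apply clim_shift. apply Hnz; auto.
    + intros w' z H Hz. replace (z - w')%C with ((z - w) - (w' - w))%C by ring.
      apply kernel_estimate_1; auto. replace (z - w - (w' - w))%C with (z - w')%C by ring. auto.
  - apply (hasd_mean_param g (fun w z => / ((z - w) * (z - w)))%C
      (fun z => 2 * / ((z - w) * (z - w) * (z - w)))%C a r w m (3 * / (m * m * (m * m)))); auto.
    + assert (0 < / (m * m * (m * m))) by (apply Rinv_0_lt_compat; rewrite <- Rmult_assoc; apply Rmult_lt_0_compat; auto). lra.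
    + intros z Hz. apply clim_mult. apply Cg; auto. apply clim_mult. apply clim_const.
      apply clim_inv. apply clim_mult; [apply clim_mult|]; apply clim_shift.
      repeat apply Cmult_neq_0; apply Hnz; auto.
    + intros w' z H Hz. replace (z - w')%C with ((z - w) - (w' - w))%C by ring.
      apply kernel_estimate_2; auto. replace (z - w - (w' - w))%C with (z - w')%C by ring. auto.
Qed.

Lemma disc_sub : forall a r z r' y, r' <= r - Cmod (z - a) -> disc z r' y -> disc a r y.
Proof.
  intros a r z r' y H Hy. unfold disc in *. replace (y - a)%C with ((y - z) + (z - a))%C by ring.
  eapply Rle_lt_trans. apply Cmod_triangle. lra.
Qed.

(** Near [z] the function is a Cauchy integral, whose kernel can be differentiated twice. *)
Theorem derive_holo : forall f a r0, holo a r0 f -> holo a r0 (C_derive f).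
Proof.
  intros f a r0 Hf z Hz.
  set (R0 := r0 - Cmod (z - a)). assert (HR : 0 < R0) by (unfold disc in Hz; unfold R0; lra).
  assert (Hfz : holo z R0 f).
  { intros y Hy. apply Hf. eapply disc_sub; [|exact Hy]. unfold R0; lra. }
  set (r := R0 / 2). assert (Hr : 0 < r < R0) by (unfold r; lra).
  set (g := fun y => (f y * (y - z))%C).
  assert (Cg : cont_circ g z r).
  { intros y Hy. apply clim_mult. apply (holo_cont_circ f z R0 r); auto; lra.
    apply clim_shift. }
  assert (Hd : forall w, Cmod (w - z) < r -> hasd f w (mean (fun y => g y * / ((y - w) * (y - w)))%C z r)).
  { intros w Hw. apply (hasd_ext_loc (fun w => mean (fun y => g y * / (y - w))%C z r)).
    - apply locally_Cmod. exists (r - Cmod (w - z)). split. lra.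
      intros y Hy. assert (Hyz : Cmod (y - z) < r) by (apply (disc_sub z r w (r - Cmod (w - z))); auto; lra).
      rewrite <- (cauchy_formula f z R0 r y); auto; try lra.
      symmetry. apply mean_ext; try lra. 
      + intros x Hx. apply clim_mult. apply Cg; auto. apply clim_inv. apply clim_shift.
        apply Cmod_gt_0. generalize (circ_dist z r y x Hx). lra.
      + intros x Hx. unfold g. unfold Cdiv. ring.
    - apply cauchy_int_derive; auto; lra. }
  destruct (cauchy_int_derive g z r z) as [_ [l Hl]]; auto; try lra.
  { rewrite Cmod_self. exact (proj1 Hr). }
  exists l. eapply hasd_ext_loc; [|exact Hl].
  apply locally_Cmod. exists r. split. lra. intros y Hy. symmetry. apply C_derive_eq, Hd, Hy.
Qed.

Lemma clim_norm_le : forall (x : nat -> C) l b K, clim eventually x l ->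
  eventually (fun n => Cmod (x n - b) <= K) -> Cmod (l - b) <= K.
Proof.
  intros x l b K H HK. apply Rnot_lt_le. intros N.
  assert (P : 0 < Cmod (l - b) - K) by lra.
  destruct (filter_ex _ (filter_and _ _ (H _ P) HK)) as [n [H1 H2]].
  generalize (Cmod_triangle (l - x n) (x n - b)). replace (l - x n + (x n - b))%C with (l - b)%C by ring.
  rewrite (Cmod_sub_sym l (x n)). lra.
Qed.

Lemma cser_tail : forall t l M q, cser t l -> 0 <= q < 1 -> (forall n, Cmod (t n) <= M * q ^ n) ->
  forall N, Cmod (l - csum t N) <= M * q ^ (S N) / (1 - q).
Proof.
  intros t l M q H Hq Ht N.
  assert (HM : 0 <= M).
  { specialize (Ht 0%nat). simpl in Ht. generalize (Cmod_ge_0 (t 0%nat)). lra. }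
  assert (B : forall k, Cmod (csum t (N + k) - csum t N) <= M * (q ^ (S N) - q ^ (S (N + k))) / (1 - q)).
  { induction k.
    - rewrite Nat.add_0_r. replace (csum t N - csum t N)%C with (RtoC 0) by ring. rewrite Cmod_0.
      right. field. lra.
    - rewrite Nat.add_succ_r, csum_S.
      replace (csum t (N + k) + t (S (N + k)) - csum t N)%C with ((csum t (N + k) - csum t N) + t (S (N + k)))%C by ring.
      eapply Rle_trans. apply Cmod_triangle. eapply Rle_trans. apply Rplus_le_compat. exact IHk. apply Ht.
      right. simpl. field. lra. }
  apply clim_norm_le with (csum t). apply cser_clim; auto.
  exists N. intros m Hm. replace m with (N + (m - N))%nat by lia.
  eapply Rle_trans. apply B. apply Rmult_le_compat_r. left. apply Rinv_0_lt_compat; lra.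
  apply Rmult_le_compat_l; auto.
  assert (0 <= q ^ S (N + (m - N))) by (apply pow_le; lra). lra.
Qed.

Lemma cser_unique : forall t l m, cser t l -> cser t m -> l = m.
Proof.
  intros t l m H1 H2. apply cser_clim in H1, H2. eapply clim_unique with (F := eventually); eauto.
  apply eventually_filter.
Qed.

Lemma cser_zero : forall (t : nat -> C) (l : C), (forall n, t n = 0%C) -> cser t l -> l = 0%C.
Proof.
  intros t l Ht H. apply (cser_unique _ _ _ H). apply cser_clim.
  apply (clim_ext_loc (fun _ => 0%C)); [|apply clim_const]. apply filter_forall. intros n.
  induction n. rewrite csum_0, Ht; auto. rewrite csum_S, <- IHn, Ht; ring.
Qed.

Lemma holo_C_derive : forall f a r z, holo a r f -> disc a r z -> hasd f z (C_derive f z).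
Proof. intros f a r z H Hz. apply hasd_C_derive, H, Hz. Qed.

Lemma coef_1 : forall f a r0 r, 0 < r -> r < r0 -> holo a r0 f -> coef f a r 1 = C_derive f a.
Proof.
  intros f a r0 r Hr Hrr Hf. assert (Hf' := derive_holo f a r0 Hf).
  rewrite <- (coef_0 (C_derive f) a r0 r); auto.
  rewrite (coef_derive f (C_derive f) a r0 r 0); auto. simpl. ring.
  intros z Hz. eapply holo_C_derive; eauto. eapply holo_cont_circ; eauto.
Qed.

Section Estimates.
Variables (f : C -> C) (a : C) (r0 r M : R).
Hypothesis (Hr : 0 < r) (Hrr : r < r0) (Hf : holo a r0 f)
  (HM : forall z, Cmod (z - a) = r -> Cmod (f z) <= M).

Lemma est_0 : Cmod (f a) <= M.
Proof.
  generalize (cauchy_estimate f a r0 r 0 M Hr Hrr Hf HM). rewrite (coef_0 f a r0 r) by auto.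
  simpl. unfold Rdiv. rewrite Rinv_1. lra.
Qed.

Lemma est_1 : Cmod (C_derive f a) <= M / r.
Proof.
  generalize (cauchy_estimate f a r0 r 1 M Hr Hrr Hf HM). rewrite (coef_1 f a r0 r) by auto.
  simpl. rewrite Rmult_1_r. auto.
Qed.

Lemma est_term : forall y n, Cmod (coef f a r n * (y - a) ^ n) <= M * (Cmod (y - a) / r) ^ n.
Proof.
  intros y n. rewrite Cmod_mult, Cmod_pow. unfold Rdiv. rewrite Rpow_mult_distr, pow_inv.
  replace (M * (Cmod (y - a) ^ n * / r ^ n)) with (M / r ^ n * Cmod (y - a) ^ n) by (unfold Rdiv; ring).
  apply Rmult_le_compat_r. apply pow_le, Cmod_ge_0. apply cauchy_estimate with r0; auto.
Qed.

Lemma est_tail : forall y N, Cmod (y - a) <= r / 2 ->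
  Cmod (f y - csum (fun n => coef f a r n * (y - a) ^ n)%C N) <= 2 * M * (Cmod (y - a) / r) ^ (S N).
Proof.
  intros y N Hy. assert (Hy0 := Cmod_ge_0 (y - a)).
  assert (HM0 : 0 <= M) by (generalize est_0 (Cmod_ge_0 (f a)); lra).
  assert (Hq : 0 <= Cmod (y - a) / r <= / 2).
  { split. apply Rle_div_r; lra. apply Rle_div_l; lra. }
  set (q := Cmod (y - a) / r) in *.
  eapply Rle_trans. apply cser_tail with (q := q) (M := M).
  - apply taylor with r0; auto. lra.
  - lra.
  - apply est_term.
  - replace (2 * M * q ^ S N) with (M * q ^ S N * 2) by ring.
    apply Rmult_le_compat_l. apply Rmult_le_pos; auto. apply pow_le; lra.
    replace 2 with (/ / 2) by field. apply Rinv_le_contravar; lra.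
Qed.

Lemma est_diff : forall y, Cmod (y - a) <= r / 2 -> Cmod (f y - f a) <= 2 * M * (Cmod (y - a) / r).
Proof.
  intros y Hy. generalize (est_tail y 0 Hy). rewrite csum_0, (coef_0 f a r0 r) by auto.
  simpl. rewrite Cmult_1_r, Rmult_1_r. auto.
Qed.

Lemma est_taylor : forall y, Cmod (y - a) <= r / 2 ->
  Cmod (f y - f a - (y - a) * C_derive f a) <= 2 * M * (Cmod (y - a) / r) ^ 2.
Proof.
  intros y Hy. generalize (est_tail y 1 Hy). rewrite csum_S, csum_0, (coef_0 f a r0 r), (coef_1 f a r0 r) by auto.
  replace (f y - (f a * (y - a) ^ 0 + C_derive f a * (y - a) ^ 1))%C with
    (f y - f a - (y - a) * C_derive f a)%C by (simpl; ring). auto.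
Qed.
End Estimates.

(** The first nonzero Taylor coefficient would dominate the rest of the series close to [a], where
    there are zeros; so all coefficients vanish. *)
Theorem identity_local : forall f a r0, 0 < r0 -> holo a r0 f ->
  (forall d, 0 < d -> exists z, z <> a /\ Cmod (z - a) < d /\ f z = 0%C) ->
  forall z, Cmod (z - a) < r0 / 2 -> f z = 0%C.
Proof.
  intros f a r0 Hr0 Hf Hz.
  set (r := r0 / 2). assert (Hr : 0 < r < r0) by (unfold r; lra).
  assert (Cf := holo_cont_circ f a r0 r Hf (proj2 Hr)).
  destruct (circ_bounded f a r) as [M [HM0 HM]]; auto; try lra.
  assert (Hc : forall n, coef f a r n = 0%C).
  { intros n. induction n as [n IH] using (well_founded_induction Wf_nat.lt_wf).
    apply Cmod_eq_0. apply Rle_antisym; [|apply Cmod_ge_0]. apply Rnot_lt_le. intros N.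
    set (X := Cmod (coef f a r n)) in *.
    set (K := 2 * M / r ^ (S n)).
    assert (HK : 0 <= K) by (apply Rmult_le_pos; [lra|left; apply Rinv_0_lt_compat, pow_lt; lra]).
    destruct (Hz (Rmin (r / 2) (X / (K + 1)))) as [z [Hza [Hzd Hfz]]].
    { apply Rmin_pos. lra. apply Rdiv_lt_0_compat; lra. }
    destruct (Rmin_Rgt_l _ _ _ Hzd) as [H1 H2].
    assert (Hza' : 0 < Cmod (z - a)) by (apply Cmod_gt_0, Cminus_eq_contra; auto).
    set (h := Cmod (z - a)) in *.
    assert (T : Cmod (f z - csum (fun n => coef f a r n * (z - a) ^ n)%C n) <= M * (h / r) ^ S n / (1 - h / r)).
    { apply cser_tail.
      - apply taylor with r0; auto; try lra. unfold h in *; lra.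
      - split. apply Rle_div_r; lra. apply Rlt_div_l; lra.
      - intros k. rewrite Cmod_mult, Cmod_pow. fold h. unfold Rdiv. rewrite Rpow_mult_distr, pow_inv.
        replace (M * (h ^ k * / r ^ k)) with (M / r ^ k * h ^ k) by (unfold Rdiv; ring).
        apply Rmult_le_compat_r. apply pow_le; lra. apply cauchy_estimate_circ with r0; auto; lra. }
    assert (S0 : forall m, (m < n)%nat -> csum (fun n => coef f a r n * (z - a) ^ n)%C m = 0%C).
    { induction m; intros Hm. rewrite csum_0, IH; auto; ring. rewrite csum_S, IHm, IH; auto; try lia. ring. }
    assert (S1 : csum (fun n => coef f a r n * (z - a) ^ n)%C n = (coef f a r n * (z - a) ^ n)%C).
    { destruct n. rewrite csum_0; auto. rewrite csum_S, S0; auto. ring. }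
    rewrite S1, Hfz in T. replace (0 - coef f a r n * (z - a) ^ n)%C with (- (coef f a r n * (z - a) ^ n))%C in T by ring.
    rewrite Cmod_opp, Cmod_mult, Cmod_pow in T. fold X h in T.
    assert (Hq : h / r < / 2) by (apply Rlt_div_l; lra).
    assert (Hp : 0 < h ^ n) by (apply pow_lt; lra).
    assert (Hrp : 0 < r ^ S n) by (apply pow_lt; lra).
    assert (T2 : M * (h / r) ^ S n / (1 - h / r) <= K * h * h ^ n).
    { replace (K * h * h ^ n) with (M * (h / r) ^ S n * 2).
      - apply Rmult_le_compat_l. apply Rmult_le_pos; auto. apply pow_le. apply Rle_div_r; lra.
        replace 2 with (/ / 2) by field. apply Rinv_le_contravar; lra.
      - unfold K, Rdiv. rewrite Rpow_mult_distr, pow_inv. simpl (h ^ S n). ring. }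
    assert (T3 : X <= K * h).
    { apply Rmult_le_reg_r with (h ^ n); auto. lra. }
    assert (h * (K + 1) < X).
    { apply Rmult_lt_reg_r with (/ (K + 1)). apply Rinv_0_lt_compat; lra.
      rewrite Rmult_assoc, Rinv_r, Rmult_1_r by lra. exact H2. }
    nra. }
  intros z Hzr. refine (cser_zero _ _ _ (taylor f a r0 r z (proj1 Hr) (proj2 Hr) Hf Hzr)).
  intros n. rewrite Hc. ring.
Qed.

(** * Entire functions *)

Definition ent (f : C -> C) : Prop := forall z, exists l, hasd f z l.

Lemma ent_entire : forall f, ent f <-> entire f.
Proof.
  intros f; split.
  - intros H z _. destruct (H z) as [l Hl]. exists l. apply hasd_is_derive, Hl.
  - intros H z. destruct (H z I) as [l Hl]. exists l. apply hasd_is_derive, Hl.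
Qed.

Lemma ent_holo : forall f a r, ent f -> holo a r f.
Proof. intros f a r H z _. apply H. Qed.

Lemma ent_derive : forall f, ent f -> ent (C_derive f).
Proof.
  intros f H z. apply (derive_holo f z 1). apply ent_holo; auto.
  unfold disc. rewrite Cmod_self; lra.
Qed.

Lemma ent_hasd : forall f z, ent f -> hasd f z (C_derive f z).
Proof. intros. apply hasd_C_derive; auto. Qed.

Lemma ent_cont : forall f z, ent f -> contC f z.
Proof. intros. eapply hasd_cont, ent_hasd; auto. Qed.

Definition Dn (n : nat) (f : C -> C) : C -> C := Nat.iter n C_derive f.

Lemma ent_Dn : forall n f, ent f -> ent (Dn n f).
Proof. induction n; intros; simpl; auto. apply ent_derive. apply IHn; auto. Qed.

Lemma Dn_S : forall n f, Dn (S n) f = Dn n (C_derive f).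
Proof. induction n; intros; auto. simpl. f_equal. apply IHn. Qed.

Lemma coef_Dn : forall n f a r, 0 < r -> ent f -> coef f a r n = (Dn n f a / RtoC (INR (fact n)))%C.
Proof.
  induction n; intros f a r Hr Hf.
  - rewrite (coef_0 f a (r + 1) r); try lra; auto using ent_holo. simpl. field.
  - assert (E : coef (C_derive f) a r n = (RtoC (INR (S n)) * coef f a r (S n))%C).
    { apply coef_derive with (r + 1); try lra. intros; apply ent_hasd; auto.
      intros z _. apply ent_cont, ent_derive; auto. }
    assert (N1 : RtoC (INR (S n)) <> 0%C).
    { intros N. apply RtoC_inj in N. generalize (pos_INR n). rewrite S_INR in N. lra. }
    assert (N2 : RtoC (INR (fact n)) <> 0%C).
    { intros N. apply RtoC_inj in N. generalize (INR_fact_neq_0 n). auto. }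
    replace (coef f a r (S n)) with (/ RtoC (INR (S n)) * (RtoC (INR (S n)) * coef f a r (S n)))%C by (field; auto).
    rewrite <- E, IHn, Dn_S by auto using ent_derive.
    replace (fact (S n)) with (S n * fact n)%nat by reflexivity. rewrite mult_INR, RtoC_mult. field; auto.
Qed.

Theorem taylor_ent : forall f a w, ent f ->
  cser (fun n => Dn n f a / RtoC (INR (fact n)) * (w - a) ^ n)%C (f w).
Proof.
  intros f a w Hf. set (r := Cmod (w - a) + 1). assert (Hr := Cmod_ge_0 (w - a)).
  assert (T : cser (fun n => coef f a r n * (w - a) ^ n)%C (f w)).
  { apply taylor with (r + 1); unfold r; try lra. apply ent_holo; auto. }
  revert T. apply is_series_ext. intros n. rewrite coef_Dn; auto. unfold r; lra.
Qed.

Lemma cauchy_Dn : forall f a r n M, 0 < r -> ent f -> (forall z, Cmod (z - a) = r -> Cmod (f z) <= M) ->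
  Cmod (Dn n f a) <= INR (fact n) * (M / r ^ n).
Proof.
  intros f a r n M Hr Hf HM.
  generalize (cauchy_estimate f a (r + 1) r n M Hr ltac:(lra) (ent_holo f a (r + 1) Hf) HM).
  rewrite coef_Dn by auto.
  assert (N2 : RtoC (INR (fact n)) <> 0%C).
  { intros N. apply RtoC_inj in N. generalize (INR_fact_neq_0 n). auto. }
  rewrite Cmod_div, Cmod_R, Rabs_pos_eq by (auto; apply pos_INR).
  intros H. assert (Hp : 0 < INR (fact n)) by (apply lt_0_INR, lt_O_fact).
  replace (Cmod (Dn n f a)) with (INR (fact n) * (Cmod (Dn n f a) / INR (fact n))) by (field; lra).
  apply Rmult_le_compat_l; lra.
Qed.

(** The completed difference quotient is the derivative of its primitive, an entire function. *)
Theorem ent_quotient : forall f w, ent f -> f w = 0%C ->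
  exists q, ent q /\ q w = C_derive f w /\ forall z, f z = ((z - w) * q z)%C.
Proof.
  intros f w Hf Hw.
  destruct (proj1 (hasd_caratheodory _ _ _) (ent_hasd f w Hf)) as [q [Q1 [Q2 Q3]]].
  rewrite <- Q2 in Q1.
  assert (HQ : forall z, hasd (prim_hv q w) z (q z)).
  { intros z. apply (difference_quotient f w (Cmod (z - w) + 1) w q); auto. apply ent_holo; auto. unfold disc; lra. }
  exists q. split; [|split; auto].
  - intros z. destruct (ent_derive (prim_hv q w)) with z as [l Hl].
    + intros y. exists (q y). apply HQ.
    + exists l. apply (hasd_ext (C_derive (prim_hv q w))); auto. intros y. apply C_derive_eq, HQ.
  - intros z. rewrite (Q3 z), Hw. ring.
Qed.

(** * Functions of two complex variables *)

Definition locbd (G : C -> C -> C) : Prop := forall t0 z0, exists e M, 0 < e /\ 0 <= M /\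
  forall t z, Cmod (t - t0) <= e -> Cmod (z - z0) <= e -> Cmod (G t z) <= M.

Definition ent_z (G : C -> C -> C) : Prop := forall t, ent (G t).

Definition derive_t (G H : C -> C -> C) : Prop := forall t z, hasd (fun s => G s z) t (H t z).

Lemma derive_t_ent : forall G H z, derive_t G H -> ent (fun t => G t z).
Proof. intros G H z HG t. exists (H t z). apply HG. Qed.

Lemma derive_t_eq : forall G H t z, derive_t G H -> C_derive (fun s => G s z) t = H t z.
Proof. intros. apply C_derive_eq, H0. Qed.

Lemma locbd_derive : forall G, locbd G -> ent_z G -> locbd (fun t => C_derive (G t)).
Proof.
  intros G HG HE t0 z0. destruct (HG t0 z0) as [e [M [He [HM H]]]].
  exists (e / 2), (M / (e / 2)). split. lra. split. apply Rle_div_r; lra.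
  intros t z Ht Hz. apply est_1 with e; try lra. apply ent_holo, HE.
  intros y Hy. apply H. lra.
  replace (y - z0)%C with ((y - z) + (z - z0))%C by ring. eapply Rle_trans. apply Cmod_triangle. lra.
Qed.

(** The remainder of the expansion in [t] is entire in [z] and of second order,
    uniformly for [z] in a disc; Cauchy's estimate bounds its [z]-derivative alike. *)
Theorem derive_exchange : forall G H, locbd G -> ent_z G -> derive_t G H -> ent_z H ->
  derive_t (fun t => C_derive (G t)) (fun t => C_derive (H t)).
Proof.
  intros G H HG HE HT HH t0 z0. destruct (HG t0 z0) as [e [M [He [HM B]]]].
  apply hasd_quad with (e / 2) (2 * M / (e * e * e)). lra.
  { apply Rmult_le_pos. lra. left. apply Rinv_0_lt_compat. repeat apply Rmult_lt_0_compat; auto. }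
  intros t Ht.
  set (E := fun z => (G t z - G t0 z - (t - t0) * H t0 z)%C).
  assert (HEd : forall z, hasd E z (C_derive (G t) z - C_derive (G t0) z - (t - t0) * C_derive (H t0) z)%C).
  { intros z. apply hasd_minus. apply hasd_minus; apply ent_hasd, HE. apply hasd_scal, ent_hasd, HH. }
  rewrite <- (C_derive_eq _ _ _ (HEd z0)).
  replace (2 * M / (e * e * e) * (Cmod (t - t0) * Cmod (t - t0))) with (2 * M * (Cmod (t - t0) / e) ^ 2 / e) by (field; lra).
  apply est_1 with (e + 1); try lra.
  - intros z _. eexists. apply HEd.
  - intros z Hz. unfold E. rewrite <- (derive_t_eq G H t0 z HT).
    apply (est_taylor (fun s => G s z) t0 (e + 1)); auto; try lra.
    + apply ent_holo. eapply derive_t_ent, HT.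
    + intros s Hs. apply B; lra.
Qed.

(** The expansion in [z] is taken at time [t] and the expansion in [t] at [z0]. Replacing the
    [z]-derivative at time [t] by the one at [t0] costs, by Cauchy's estimate for [G t - G t0], a
    term of second order. *)
Theorem joint_remainder : forall G H, locbd G -> ent_z G -> derive_t G H -> forall t0 z0,
  exists e K, 0 < e /\ 0 <= K /\ forall t z, Cmod (t - t0) <= e -> Cmod (z - z0) <= e ->
    Cmod (G t z - G t0 z0 - (t - t0) * H t0 z0 - (z - z0) * C_derive (G t0) z0)
      <= K * ((Cmod (t - t0) + Cmod (z - z0)) * (Cmod (t - t0) + Cmod (z - z0))).
Proof.
  intros G H HG HE HT t0 z0. destruct (HG t0 z0) as [e [M [He [HM B]]]].
  exists (e / 2), (2 * M / (e * e)). split. lra. split.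
  { apply Rmult_le_pos. lra. left. apply Rinv_0_lt_compat. repeat apply Rmult_lt_0_compat; auto. }
  intros t z Ht Hz.
  set (h := Cmod (t - t0)) in *. set (k := Cmod (z - z0)) in *.
  assert (Hh : 0 <= h) by apply Cmod_ge_0. assert (Hk : 0 <= k) by apply Cmod_ge_0.
  assert (A1 : Cmod (G t z - G t z0 - (z - z0) * C_derive (G t) z0) <= 2 * M * (k / e) ^ 2).
  { apply est_taylor with (e + 1); try lra. apply ent_holo, HE. intros y Hy. apply B; fold h; lra.
    fold k; lra. }
  assert (A2 : Cmod (G t z0 - G t0 z0 - (t - t0) * H t0 z0) <= 2 * M * (h / e) ^ 2).
  { rewrite <- (derive_t_eq G H t0 z0 HT). apply (est_taylor (fun s => G s z0) t0 (e + 1)); try lra.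
    apply ent_holo. eapply derive_t_ent, HT.
    intros y Hy. apply B. lra. rewrite Cmod_self; lra. fold h; lra. }
  assert (A3 : Cmod (C_derive (G t) z0 - C_derive (G t0) z0) <= 2 * M * (h / e) / e).
  { assert (HD : hasd (fun y => G t y - G t0 y)%C z0 (C_derive (G t) z0 - C_derive (G t0) z0)%C).
    { apply hasd_minus; apply ent_hasd, HE. }
    rewrite <- (C_derive_eq _ _ _ HD). apply est_1 with (e + 1); try lra.
    - intros y _. eexists. apply hasd_minus; apply ent_hasd, HE.
    - intros y Hy. apply (est_diff (fun s => G s y) t0 (e + 1)); try lra.
      apply ent_holo. eapply derive_t_ent, HT. intros s Hs. apply B; lra. fold h; lra. }
  replace (G t z - G t0 z0 - (t - t0) * H t0 z0 - (z - z0) * C_derive (G t0) z0)%C with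
    ((G t z - G t z0 - (z - z0) * C_derive (G t) z0) + (G t z0 - G t0 z0 - (t - t0) * H t0 z0)
     + (z - z0) * (C_derive (G t) z0 - C_derive (G t0) z0))%C by ring.
  eapply Rle_trans. apply Cmod_triangle. eapply Rle_trans. apply Rplus_le_compat_r. apply Cmod_triangle.
  rewrite Cmod_mult. fold k.
  assert (A4 : k * Cmod (C_derive (G t) z0 - C_derive (G t0) z0) <= k * (2 * M * (h / e) / e)).
  { apply Rmult_le_compat_l; auto. }
  apply Rle_trans with (2 * M * (k / e) ^ 2 + 2 * M * (h / e) ^ 2 + k * (2 * M * (h / e) / e)). lra.
  replace (2 * M * (k / e) ^ 2 + 2 * M * (h / e) ^ 2 + k * (2 * M * (h / e) / e))
    with (2 * M / (e * e) * (k * k + h * h + k * h)) by (field; lra).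
  apply Rmult_le_compat_l.
  { apply Rmult_le_pos. lra. left. apply Rinv_0_lt_compat. repeat apply Rmult_lt_0_compat; auto. }
  nra.
Qed.

(** The chain rule along [t -> (t, m t)]. *)
Lemma hasd_curve : forall G H m t0 dm, locbd G -> ent_z G -> derive_t G H -> hasd m t0 dm ->
  hasd (fun t => G t (m t)) t0 (H t0 (m t0) + dm * C_derive (G t0) (m t0))%C.
Proof.
  intros G H m t0 dm HG HE HT Hm.
  destruct (joint_remainder G H HG HE HT t0 (m t0)) as [e [K [He [HK B]]]].
  assert (Cm := hasd_cont _ _ _ Hm e He). apply locally_Cmod in Cm. destruct Cm as [d1 [Hd1 C1]].
  set (b := C_derive (G t0) (m t0)) in *. set (L := Cmod dm + 2).
  assert (HL : 2 <= L) by (unfold L; generalize (Cmod_ge_0 dm); lra).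
  intros eps Heps.
  set (e2 := Rmin 1 (eps / (2 * (Cmod b + 1)))).
  assert (Hb := Cmod_ge_0 b).
  assert (He2 : 0 < e2). { apply Rmin_pos. lra. apply Rdiv_lt_0_compat; lra. }
  destruct (Hm e2 He2) as [d2 [Hd2 C2]].
  set (d3 := eps / (2 * (K * (L * L) + 1))).
  assert (HKL : 0 <= K * (L * L)) by (apply Rmult_le_pos; nra).
  assert (Hd3 : 0 < d3) by (apply Rdiv_lt_0_compat; lra).
  exists (Rmin (Rmin d1 d2) (Rmin d3 e)). split. repeat apply Rmin_pos; auto.
  intros t Ht. destruct (Rmin_Rgt_l _ _ _ Ht) as [T12 T34].
  destruct (Rmin_Rgt_l _ _ _ T12) as [T1 T2].
  destruct (Rmin_Rgt_l _ _ _ T34) as [T3 T4].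
  specialize (C1 t T1). specialize (C2 t T2).
  set (h := Cmod (t - t0)) in *. assert (Hh : 0 <= h) by apply Cmod_ge_0.
  specialize (B t (m t) ltac:(fold h; lra) ltac:(lra)). fold h in B.
  assert (Hk : Cmod (m t - m t0) <= (Cmod dm + 1) * h).
  { replace (m t - m t0)%C with ((m t - m t0 - (t - t0) * dm) + (t - t0) * dm)%C by ring.
    eapply Rle_trans. apply Cmod_triangle. rewrite Cmod_mult. fold h.
    assert (e2 <= 1) by apply Rmin_l. nra. }
  replace (G t (m t) - G t0 (m t0) - (t - t0) * (H t0 (m t0) + dm * b))%C with
    ((G t (m t) - G t0 (m t0) - (t - t0) * H t0 (m t0) - (m t - m t0) * b)
     + (m t - m t0 - (t - t0) * dm) * b)%C by ring.
  eapply Rle_trans. apply Cmod_triangle. rewrite Cmod_mult.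
  assert (Q1 : K * ((h + Cmod (m t - m t0)) * (h + Cmod (m t - m t0))) <= K * (L * L) * h * h).
  { replace (K * (L * L) * h * h) with (K * ((L * h) * (L * h))) by ring.
    apply Rmult_le_compat_l; auto. assert (h + Cmod (m t - m t0) <= L * h) by (unfold L; lra).
    generalize (Cmod_ge_0 (m t - m t0)). intros. apply Rmult_le_compat; lra. }
  assert (Q2 : K * (L * L) * h <= eps / 2).
  { assert (d3 * (K * (L * L) + 1) = eps / 2) by (unfold d3; field; lra). nra. }
  assert (Q3 : e2 * Cmod b <= eps / 2).
  { assert (e2 <= eps / (2 * (Cmod b + 1))) by apply Rmin_r.
    assert (e2 * (Cmod b + 1) <= eps / 2).
    { apply Rle_trans with (eps / (2 * (Cmod b + 1)) * (Cmod b + 1)). apply Rmult_le_compat_r; lra.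
      right; field; lra. }
    nra. }
  assert (Q4 : Cmod (m t - m t0 - (t - t0) * dm) * Cmod b <= e2 * h * Cmod b).
  { apply Rmult_le_compat_r; auto. }
  assert (Q5 : K * (L * L) * h * h <= eps / 2 * h) by (apply Rmult_le_compat_r; auto).
  assert (Q6 : e2 * h * Cmod b <= eps / 2 * h).
  { replace (e2 * h * Cmod b) with (e2 * Cmod b * h) by ring. apply Rmult_le_compat_r; auto. }
  lra.
Qed.

Notation CC := (prod_NormedModule C_AbsRing C_NormedModule C_NormedModule).

Lemma norm_CC : forall p : C * C, Cmod (fst p) <= norm (V := CC) p /\ Cmod (snd p) <= norm (V := CC) p.
Proof.
  intros [x y].
  change (Cmod x <= sqrt (Cmod x ^ 2 + Cmod y ^ 2) /\ Cmod y <= sqrt (Cmod x ^ 2 + Cmod y ^ 2)).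
  generalize (Cmod_ge_0 x) (Cmod_ge_0 y). intros Hx Hy. split.
  - rewrite <- (sqrt_Rsqr (Cmod x)) at 1 by auto. apply sqrt_le_1_alt. unfold Rsqr. nra.
  - rewrite <- (sqrt_Rsqr (Cmod y)) at 1 by auto. apply sqrt_le_1_alt. unfold Rsqr. nra.
Qed.

Theorem separately_entire2 : forall G H, locbd G -> ent_z G -> derive_t G H -> entire2 G.
Proof.
  intros G H HG HE HT [t0 z0].
  destruct (joint_remainder G H HG HE HT t0 z0) as [e [K [He [HK B]]]].
  set (A := H t0 z0) in *. set (D := C_derive (G t0) z0) in *.
  exists (fun p : CC => (fst p * A + snd p * D)%C). split.
  - split.
    + intros [a b] [a' b']. simpl. change (((a + a') * A + (b + b') * D)%C = ((a * A + b * D) + (a' * A + b' * D))%C). ring.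
    + intros k [a b]. change (((k * a) * A + (k * b) * D)%C = (k * (a * A + b * D))%C). ring.
    + exists (Cmod A + Cmod D + 1). split. generalize (Cmod_ge_0 A) (Cmod_ge_0 D). lra.
      intros p. destruct (norm_CC p) as [N1 N2]. change (Cmod (fst p * A + snd p * D) <= (Cmod A + Cmod D + 1) * norm (V := CC) p).
      eapply Rle_trans. apply Cmod_triangle. rewrite !Cmod_mult.
      generalize (Cmod_ge_0 A) (Cmod_ge_0 D) (Cmod_ge_0 (fst p)). intros P1 P2 P3.
      apply (Rmult_le_compat_r (Cmod A)) in N1; auto. apply (Rmult_le_compat_r (Cmod D)) in N2; auto.
      destruct (norm_CC p) as [N3 _].
      set (n := norm (V := CC) p) in *. assert (Hn : 0 <= n) by exact (Rle_trans _ _ _ P3 N3).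
      apply Rle_trans with (n * Cmod A + n * Cmod D). exact (Rplus_le_compat _ _ _ _ N1 N2). lra.
  - intros x Hx. apply (is_filter_lim_locally_unique (V := CC)) in Hx. subst x.
    intros eps.
    set (d := Rmin e (eps / (4 * (K + 1)))).
    assert (Hp : 0 < eps / (4 * (K + 1))) by (apply Rdiv_lt_0_compat; [apply cond_pos|lra]).
    assert (Hd : 0 < d) by (apply Rmin_pos; auto).
    apply (locally_le_locally_norm (V := CC)).
    exists (mkposreal d Hd). intros [t z] Hy. unfold ball_norm in Hy.
    set (n := norm (V := CC) (minus (G := CC) (t, z) (t0, z0))) in *.
    destruct (norm_CC (minus (G := CC) (t, z) (t0, z0))) as [N1 N2]. fold n in N1, N2.
    simpl in Hy. destruct (Rmin_Rgt_l _ _ _ Hy) as [Hy1 Hy2].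
    change (Cmod (t - t0) <= n) in N1. change (Cmod (z - z0) <= n) in N2.
    change (Cmod (G t z - G t0 z0 - ((t - t0) * A + (z - z0) * D)) <= eps * n).
    replace (G t z - G t0 z0 - ((t - t0) * A + (z - z0) * D))%C with (G t z - G t0 z0 - (t - t0) * A - (z - z0) * D)%C by ring.
    eapply Rle_trans. apply B; lra.
    assert (Hn : 0 <= n) by (generalize (Cmod_ge_0 (t - t0)); lra).
    apply Rle_trans with (K * (2 * n * (2 * n))).
    + apply Rmult_le_compat_l; auto. generalize (Cmod_ge_0 (t - t0)) (Cmod_ge_0 (z - z0)). intros. nra.
    + assert (n * (4 * (K + 1)) <= eps).
      { apply Rle_trans with (eps / (4 * (K + 1)) * (4 * (K + 1))). apply Rmult_le_compat_r; lra. right; field; lra. }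
      nra.
Qed.

Lemma entire2_locbd : forall G, entire2 G -> locbd G.
Proof.
  intros G HG t0 z0. destruct (HG (t0, z0)) as [l Hl].
  assert (Hc : continuous (T := CC) (U := C_NormedModule) (fun q => G (fst q) (snd q)) (t0, z0)).
  { apply (filterdiff_continuous (K := C_AbsRing) (U := CC) (V := C_NormedModule)). exists l. exact Hl. }
  assert (Hl1 : locally (T := C_UniformSpace) (G t0 z0) (fun y => Cmod (y - G t0 z0) < 1)).
  { apply locally_Cmod. exists 1. split; auto. lra. }
  specialize (Hc _ Hl1). destruct Hc as [e He].
  exists (e / 2), (Cmod (G t0 z0) + 1). assert (Hp := cond_pos e). split. lra. split.
  generalize (Cmod_ge_0 (G t0 z0)); lra.
  intros t z Ht Hz.
  assert (Hb : forall x y : C, Cmod (x - y) <= e / 2 -> ball (M := C_UniformSpace) y e x).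
  { intros x y Hxy. apply C_NormedModule_mixin_compat1. change (Cmod (x - y) < e). lra. }
  assert (Cmod (G t z - G t0 z0) < 1).
  { apply (He (t, z)). split; apply Hb; auto. }
  generalize (Cmod_tri_inv (G t z) (G t0 z0)). lra.
Qed.

(** * The heat equation *)

Section Heat.
Variable F : C -> C -> C.
Hypotheses (Fbd : locbd F) (Fz : ent_z F) (Fheat : derive_t F (fun t => Dn 2 (F t))).

Lemma heat_Dn_aux : forall k, locbd (fun t => Dn k (F t)) /\
  derive_t (fun t => Dn k (F t)) (fun t => Dn (S (S k)) (F t)).
Proof.
  induction k as [|k [IH1 IH2]].
  - split. exact Fbd. exact Fheat.
  - split.
    + apply (locbd_derive (fun t => Dn k (F t))); auto. intros t. apply ent_Dn, Fz.
    + apply (derive_exchange (fun t => Dn k (F t)) (fun t => Dn (S (S k)) (F t))); auto.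
      intros t. apply ent_Dn, Fz. intros t. apply (ent_Dn (S (S k))), Fz.
Qed.

Lemma heat_Dn : forall n t z, Dn n (fun s => F s z) t = Dn (2 * n) (F t) z.
Proof.
  induction n; intros t z. reflexivity.
  simpl Dn at 1. apply C_derive_eq.
  apply (hasd_ext (fun s => Dn (2 * n) (F s) z)). intros y. symmetry. apply IHn.
  replace (2 * S n)%nat with (S (S (2 * n))) by lia. apply heat_Dn_aux.
Qed.

(** The time derivatives of a solution are its space derivatives of even order, so the expansion
    in time involves a single instant. *)
Theorem heat_taylor : forall t0 t z,
  cser (fun n => Dn (2 * n) (F t0) z / RtoC (INR (fact n)) * (t - t0) ^ n)%C (F t z).
Proof.
  intros t0 t z. assert (T := taylor_ent (fun s => F s z) t0 t (derive_t_ent F _ z Fheat)).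
  revert T. apply is_series_ext. intros n. rewrite heat_Dn. reflexivity.
Qed.

Lemma Dn_opp : forall n f, ent f -> (forall z, f (- z)%C = (- f z)%C) ->
  forall z, Dn n f (- z)%C = ((- 1) ^ (S n) * Dn n f z)%C.
Proof.
  induction n; intros f Hf Ho z.
  - simpl. rewrite Ho. ring.
  - simpl Dn.
    assert (H1 : hasd (fun y => Dn n f (- y)%C) z ((- 1) * C_derive (Dn n f) (- z))%C).
    { apply (hasd_comp (Dn n f) (fun y => - y)%C). apply ent_hasd, ent_Dn; auto.
      eapply hasd_eq. apply hasd_opp, hasd_id. ring. }
    assert (H2 : hasd (fun y => Dn n f (- y)%C) z ((- 1) ^ (S n) * C_derive (Dn n f) z)%C).
    { apply (hasd_ext (fun y => (- 1) ^ (S n) * Dn n f y)%C).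
      intros y. symmetry. apply IHn; auto. apply hasd_scal, ent_hasd, ent_Dn; auto. }
    assert (E := hasd_unique _ _ _ _ H1 H2).
    rewrite (Cpow_S (- 1) (S n)), <- Cmult_assoc, <- E. ring.
Qed.

Theorem heat_odd : (forall z, F 0 (- z)%C = (- F 0 z)%C) -> forall t z, F t (- z)%C = (- F t z)%C.
Proof.
  intros Ho t z.
  assert (T1 := heat_taylor 0 t (- z)%C). assert (T2 := heat_taylor 0 t z).
  apply cser_unique with (1 := T1).
  apply is_series_opp in T2. revert T2. apply is_series_ext. intros n.
  rewrite (Dn_opp (2 * n) (F 0)); auto.
  replace ((- 1) ^ S (2 * n))%C with (- (1))%C.
  change (opp ?x) with (Copp x).
  match goal with |- ?u = ?v => change (@eq C u v) end.
  change (@opp _ ?x) with (Copp x). unfold Cdiv. ring.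
  rewrite Cpow_S, Cpow_mult_r. replace ((- 1) ^ 2)%C with (RtoC 1) by (simpl; ring). rewrite Cpow_1_l. ring.
Qed.

Theorem heat_zero : forall t0, (forall z, F t0 z = 0%C) -> forall t z, F t z = 0%C.
Proof.
  intros t0 H t z.
  assert (HD : forall n z, Dn n (F t0) z = 0%C).
  { induction n; intros y. apply H. simpl. apply C_derive_eq. apply (hasd_ext (fun _ => 0%C)).
    intros; symmetry; auto. apply hasd_const. }
  apply cser_zero with (2 := heat_taylor t0 t z). intros n. rewrite HD. unfold Cdiv; ring.
Qed.

End Heat.

(** * Growth *)

Lemma cser_bound : forall t l M q, cser t l -> 0 <= q < 1 -> (forall n, Cmod (t n) <= M * q ^ n) ->
  Cmod l <= M / (1 - q).
Proof.
  intros t l M q H Hq Ht. generalize (cser_tail t l M q H Hq Ht 0). rewrite csum_0. intros H1.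
  assert (H0 := Ht 0%nat). simpl in H0, H1.
  replace l with ((l - t 0%nat) + t 0%nat)%C by ring. eapply Rle_trans. apply Cmod_triangle.
  replace (M / (1 - q)) with (M * (q * 1) / (1 - q) + M * 1) by (field; lra). lra.
Qed.

Lemma ent_bounded : forall f r, 0 <= r -> ent f -> exists M, 0 <= M /\ forall z, Cmod z <= r -> Cmod (f z) <= M.
Proof.
  intros f r Hr Hf. set (r1 := 2 * r + 1).
  assert (Hh := ent_holo f 0 (r1 + 1) Hf).
  destruct (circ_bounded f 0 r1) as [M [HM0 HM]]. unfold r1; lra. intros z _. apply ent_cont; auto.
  exists (M / (1 - / 2)). split. apply Rle_div_r; lra.
  intros z Hz.
  apply cser_bound with (fun n => coef f 0 r1 n * (z - 0) ^ n)%C.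
  - apply taylor with (r1 + 1); auto; try (unfold r1; lra).
    replace (z - 0)%C with z by ring. unfold r1; lra.
  - lra.
  - intros n. rewrite Cmod_mult, Cmod_pow. replace (z - 0)%C with z by ring.
    apply Rle_trans with (M / r1 ^ n * Cmod z ^ n).
    { apply Rmult_le_compat_r. apply pow_le, Cmod_ge_0.
      apply cauchy_estimate_circ with (r1 + 1); auto; unfold r1; lra. }
    replace (M / r1 ^ n * Cmod z ^ n) with (M * (Cmod z / r1) ^ n).
    2:{ unfold Rdiv. rewrite Rpow_mult_distr, pow_inv. ring. }
    apply Rmult_le_compat_l; auto. apply pow_incr. split. apply Rle_div_r. unfold r1; lra.
    rewrite Rmult_0_l. apply Cmod_ge_0. apply Rle_div_l; unfold r1; lra.
Qed.

Lemma max_modulus_ge : forall g z, ent g -> Cmod (g z) <= max_modulus g (Cmod z).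
Proof.
  intros g z Hg. unfold max_modulus.
  set (S := fun x => exists y : C, Cmod y = Cmod z /\ x = Cmod (g y)).
  destruct (ent_bounded g (Cmod z) (Cmod_ge_0 z) Hg) as [M [HM0 HM]].
  destruct (Lub_Rbar_correct S) as [H1 H2].
  assert (Hz : Rbar_le (Cmod (g z)) (Lub_Rbar S)) by (apply H1; exists z; auto).
  assert (HB : Rbar_le (Lub_Rbar S) M).
  { apply H2. intros x [y [Hy ->]]. simpl. apply HM. lra. }
  destruct (Lub_Rbar S); simpl in *; auto; contradiction.
Qed.

(** The base [1 + Cmod z] keeps [Rpower] away from 0, and [K] absorbs the small values of [z]. *)
Lemma growth_order_bound : forall g, ent g -> Rbar_lt (growth_order g) (Finite 2) ->
  exists s K, 1 <= s < 2 /\ 0 <= K /\ forall z, Cmod (g z) <= K * exp (Rpower (1 + Cmod z) s).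
Proof.
  intros g Hg Ho. unfold growth_order, limsup_infty in Ho.
  set (u := fun r => ln (ln (max_modulus g r)) / ln r) in Ho.
  set (E := fun l => exists a : R, l = Lub_Rbar (fun y => exists r : R, a < r /\ y = u r)) in Ho.
  assert (H1 : exists l, E l /\ Rbar_lt l (Finite 2)).
  { apply NNPP. intros N. destruct (proj2_sig (Rbar_ex_glb E)) as [_ H].
    apply (Rbar_lt_not_le _ _ Ho). apply H. intros l Hl. apply Rbar_not_lt_le. intros L. apply N. exists l; auto. }
  destruct H1 as [l [[a Ha] Hl]].
  assert (H2 : exists s, 1 <= s < 2 /\ forall r, a < r -> u r <= s).
  { destruct (Lub_Rbar_correct (fun y => exists r : R, a < r /\ y = u r)) as [H _].
    rewrite <- Ha in H.
    destruct l as [l| |]; simpl in Hl; try contradiction.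
    - exists (Rmax 1 l). split. split. apply Rmax_l. apply Rmax_lub_lt; lra.
      intros r Hr. apply Rle_trans with l. apply (H (u r)). exists r; auto. apply Rmax_r.
    - exists 1. split. lra. intros r Hr. exfalso. apply (H (u r)). exists r; auto. }
  destruct H2 as [s [Hs H2]].
  set (r1 := Rmax a 1 + 1).
  assert (Hr1 : a < r1 /\ 2 <= r1). { unfold r1. generalize (Rmax_l a 1) (Rmax_r a 1). lra. }
  destruct (ent_bounded g r1) as [M [HM0 HM]]; auto; try lra.
  exists s, (M + 1). split; auto. split. lra.
  intros z.
  assert (Hz := Cmod_ge_0 z).
  assert (P0 : 0 < Rpower (1 + Cmod z) s) by apply exp_pos.
  assert (P1 : 1 < exp (Rpower (1 + Cmod z) s)). { generalize (exp_increasing 0 _ P0). rewrite exp_0. auto. }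
  destruct (Rle_lt_dec (Cmod z) r1) as [Hle|Hlt].
  - specialize (HM z Hle). nra.
  - assert (H3 := H2 (Cmod z) ltac:(lra)). unfold u in H3.
    assert (Hln : 0 < ln (Cmod z)). { generalize (ln_increasing 1 (Cmod z)). rewrite ln_1. intros L; apply L; lra. }
    assert (H4 : ln (ln (max_modulus g (Cmod z))) <= s * ln (Cmod z)).
    { apply Rmult_le_reg_r with (/ ln (Cmod z)). apply Rinv_0_lt_compat; auto.
      rewrite Rmult_assoc, Rinv_r, Rmult_1_r by lra. exact H3. }
    assert (H5 : max_modulus g (Cmod z) <= exp (Rpower (1 + Cmod z) s)).
    { set (m := max_modulus g (Cmod z)) in *.
      destruct (Rle_lt_dec m 1) as [Hm|Hm]. lra.
      assert (Hlm : 0 < ln m). { generalize (ln_increasing 1 m). rewrite ln_1. intros L; apply L; lra. }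
      rewrite <- (exp_ln m) by lra.
      assert (ln m <= Rpower (1 + Cmod z) s).
      { apply Rle_trans with (Rpower (Cmod z) s).
        - unfold Rpower. rewrite <- (exp_ln (ln m)) by auto.
          destruct H4 as [H4|H4]. left. apply exp_increasing; auto. rewrite H4. lra.
        - apply Rle_Rpower_l; lra. }
      destruct H as [H|H]. left; apply exp_increasing; auto. rewrite H; lra. }
    generalize (max_modulus_ge g z Hg). nra.
Qed.

Lemma Rpower_young : forall s e, 0 <= s < 2 -> 0 < e -> exists K, 0 <= K /\
  forall y, 0 < y -> Rpower y s <= e * (y * y) + K.
Proof.
  intros s e Hs He.
  set (Y := Rpower (/ e) (/ (2 - s))).
  assert (HY : 0 < Y) by apply exp_pos.
  exists (Rpower Y s). split. left; apply exp_pos.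
  intros y Hy. assert (Hp : 0 < Rpower Y s) by apply exp_pos.
  destruct (Rle_lt_dec Y y) as [H|H].
  - assert (E1 : Rpower y s * Rpower y (2 - s) = y * y).
    { rewrite <- Rpower_plus. replace (s + (2 - s)) with (INR 2) by (simpl; ring).
      rewrite Rpower_pow by auto. simpl; ring. }
    assert (E2 : / e <= Rpower y (2 - s)).
    { apply Rle_trans with (Rpower Y (2 - s)).
      - unfold Y. rewrite Rpower_mult. replace (/ (2 - s) * (2 - s)) with 1 by (field; lra).
        rewrite Rpower_1. lra. apply Rinv_0_lt_compat; auto.
      - apply Rle_Rpower_l; lra. }
    assert (Hq : 0 < Rpower y s) by apply exp_pos.
    assert (Rpower y s <= e * (y * y)).
    { rewrite <- E1. apply Rle_trans with (e * (Rpower y s * / e)).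
      right; field; lra. apply Rmult_le_compat_l; try lra. apply Rmult_le_compat_l; lra. }
    lra.
  - assert (Rpower y s <= Rpower Y s) by (apply Rle_Rpower_l; lra). nra.
Qed.

Lemma Rpower_add_le : forall x y s, 0 < x -> 0 < y -> 0 <= s <= 2 ->
  Rpower (x + y) s <= 4 * Rpower x s + 4 * Rpower y s.
Proof.
  intros x y s Hx Hy Hs.
  assert (H2 : Rpower 2 s <= 4).
  { replace 4 with (Rpower 2 2). apply Rle_Rpower; lra.
    replace 2 with (INR 2) at 2 by (simpl; ring). rewrite Rpower_pow by lra. simpl; ring. }
  assert (Px : 0 < Rpower x s) by apply exp_pos. assert (Py : 0 < Rpower y s) by apply exp_pos.
  assert (P2 : 0 < Rpower 2 s) by apply exp_pos.
  destruct (Rle_lt_dec x y).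
  - apply Rle_trans with (Rpower (2 * y) s). apply Rle_Rpower_l; lra.
    rewrite <- Rpower_mult_distr by lra. nra.
  - apply Rle_trans with (Rpower (2 * x) s). apply Rle_Rpower_l; lra.
    rewrite <- Rpower_mult_distr by lra. nra.
Qed.

Lemma fact_le_pow : forall n k, INR (fact (n + k)) <= INR (n + k) ^ k * INR (fact n).
Proof.
  intros n k. induction k.
  - rewrite Nat.add_0_r. simpl. lra.
  - replace (n + S k)%nat with (S (n + k)) by lia.
    change (fact (S (n + k))) with (S (n + k) * fact (n + k))%nat. rewrite mult_INR.
    rewrite <- tech_pow_Rmult.
    rewrite Rmult_assoc. apply Rmult_le_compat_l. apply pos_INR.
    eapply Rle_trans. exact IHk. apply Rmult_le_compat_r. apply pos_INR.
    apply pow_incr. split. apply pos_INR. rewrite S_INR. lra.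
Qed.

Lemma exp_le : forall x y, x <= y -> exp x <= exp y.
Proof. intros x y [H|H]. left; apply exp_increasing; auto. subst; lra. Qed.

(** In the [n]-th term of the expansion in time Cauchy's estimate is used on a circle of radius
    of the order of [sqrt n]. There a growth of order below 2 costs only a factor [exp (o n)],
    so that a large multiple of [sqrt n] makes the series geometric. *)
Theorem heat_growth : forall F s K, locbd F -> ent_z F -> derive_t F (fun t => Dn 2 (F t)) ->
  1 <= s < 2 -> 0 <= K -> (forall z, Cmod (F 0 z) <= K * exp (Rpower (1 + Cmod z) s)) ->
  forall T, 0 < T -> exists B, 0 <= B /\
    forall t z, Cmod t <= T -> Cmod (F t z) <= B * exp (4 * Rpower (1 + Cmod z) s).
Proof.
  intros F s K HF1 HF2 HF3 Hs HK Hf T HT.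
  destruct (Rpower_young s (/ (4 * (8 * T)))) as [Y [HY HYy]]. lra.
  { apply Rinv_0_lt_compat; lra. }
  set (B := K * exp (4 * Y)).
  assert (HB : 0 <= B). { apply Rmult_le_pos; auto. left; apply exp_pos. }
  exists (B / (1 - 3 / 4)). split. apply Rle_div_r; lra.
  intros t z Ht.
  set (X := Rpower (1 + Cmod z) s).
  assert (Hz := Cmod_ge_0 z). assert (HX : 0 < X) by apply exp_pos.
  replace (B / (1 - 3 / 4) * exp (4 * X)) with ((B * exp (4 * X)) / (1 - 3 / 4)) by (field).
  eapply cser_bound. apply (heat_taylor F HF1 HF2 HF3 0 t z). lra.
  intros n. replace (t - 0)%C with t by ring.
  assert (N2 : RtoC (INR (fact n)) <> 0%C).
  { intros N. apply RtoC_inj in N. generalize (INR_fact_neq_0 n). auto. }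
  assert (Hfp : 0 < INR (fact n)) by (apply lt_0_INR, lt_O_fact).
  destruct n as [|n].
  - simpl. replace (F 0 z / 1 * 1)%C with (F 0 z) by field. rewrite Rmult_1_r.
    eapply Rle_trans. apply Hf. unfold B. rewrite Rmult_assoc. apply Rmult_le_compat_l; auto.
    rewrite <- exp_plus. fold X. apply exp_le. lra.
  - set (m := S n) in *. assert (Hm : 1 <= INR m). { unfold m. rewrite S_INR. generalize (pos_INR n). lra. }
    (* With this radius [T ^ m * (2 m)! / (m! * r ^ (2 m))] is at most [(1 / 4) ^ m], while the
       choice of [Y] bounds the cost of the growth on the circle by a multiple of [3 ^ m]. *)
    set (r := sqrt (8 * T * INR m)).
    assert (H8 : 0 < 8 * T * INR m) by (apply Rmult_lt_0_compat; lra).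
    assert (Hr : 0 < r) by (apply sqrt_lt_R0; auto).
    assert (Hrr : r * r = 8 * T * INR m) by (apply sqrt_sqrt; lra).
    assert (HD : Cmod (Dn (2 * m) (F 0) z) <= INR (fact (2 * m)) * (K * exp (Rpower (1 + Cmod z + r) s) / r ^ (2 * m))).
    { apply cauchy_Dn; auto. intros y Hy. eapply Rle_trans. apply Hf.
      apply Rmult_le_compat_l; auto. apply exp_le. apply Rle_Rpower_l. lra.
      split. generalize (Cmod_ge_0 y); lra.
      replace y with ((y - z) + z)%C by ring. generalize (Cmod_triangle (y - z) z). lra. }
    assert (HE : exp (Rpower (1 + Cmod z + r) s) <= exp (4 * X) * (exp (4 * Y) * 3 ^ m)).
    { apply Rle_trans with (exp (4 * X + (4 * Y + INR m))).
      - apply exp_le. eapply Rle_trans. apply Rpower_add_le; lra. fold X.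
        specialize (HYy r Hr). rewrite Hrr in HYy.
        replace (/ (4 * (8 * T)) * (8 * T * INR m)) with (INR m / 4) in HYy by (field; lra). lra.
      - rewrite !exp_plus. apply Rmult_le_compat_l. left; apply exp_pos.
        apply Rmult_le_compat_l. left; apply exp_pos.
        rewrite <- (Rmult_1_r (INR m)), Rmult_comm.
        replace (exp (1 * INR m)) with (exp 1 ^ m).
        + apply pow_incr. split. left; apply exp_pos. apply exp_le_3.
        + rewrite <- Rpower_pow by apply exp_pos. unfold Rpower. rewrite ln_exp. f_equal. ring. }
    assert (Hrp : r ^ (2 * m) = (8 * T) ^ m * INR m ^ m).
    { rewrite pow_mult. replace (r ^ 2) with (r * r) by ring. rewrite Hrr. apply Rpow_mult_distr. }
    assert (Hfa : INR (fact (2 * m)) <= (2 ^ m * INR m ^ m) * INR (fact m)).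
    { replace (2 * m)%nat with (m + m)%nat by lia. eapply Rle_trans. apply fact_le_pow.
      right. rewrite <- Rpow_mult_distr, plus_INR. replace (INR m + INR m) with (2 * INR m) by ring. ring. }
    assert (P1 : 0 < INR m ^ m) by (apply pow_lt; lra). assert (P2 : 0 < (8 * T) ^ m) by (apply pow_lt; lra).
    assert (P3 : 0 < r ^ (2 * m)) by (apply pow_lt; lra).
    assert (P4 : 0 <= Cmod t ^ m <= T ^ m). { split. apply pow_le, Cmod_ge_0. apply pow_incr. split; auto. apply Cmod_ge_0. }
    assert (P5 : 0 < T ^ m) by (apply pow_lt; lra).
    rewrite Cmod_mult, Cmod_pow, Cmod_div by auto. rewrite Cmod_R, Rabs_pos_eq by lra.
    set (E := exp (4 * X) * (exp (4 * Y) * 3 ^ m)) in *.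
    assert (P6 : 0 <= E). { eapply Rle_trans; [|exact HE]. left; apply exp_pos. }
    apply Rle_trans with ((2 ^ m * INR m ^ m * INR (fact m)) * (K * E / r ^ (2 * m)) / INR (fact m) * T ^ m).
    + apply Rmult_le_compat; try lra.
      * apply Rle_div_r; auto. rewrite Rmult_0_l. apply Cmod_ge_0.
      * apply Rmult_le_compat_r. left; apply Rinv_0_lt_compat; auto.
        eapply Rle_trans. exact HD. apply Rmult_le_compat; [apply pos_INR| |exact Hfa|].
        { apply Rle_div_r; auto. rewrite Rmult_0_l. apply Rmult_le_pos; auto. left; apply exp_pos. }
        apply Rmult_le_compat_r. left; apply Rinv_0_lt_compat; auto. apply Rmult_le_compat_l; auto.
    + right. rewrite Hrp. unfold E, B.
      replace ((3 / 4) ^ m) with (2 ^ m * T ^ m * 3 ^ m / (8 * T) ^ m).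
      * field. repeat split; lra.
      * unfold Rdiv. rewrite <- pow_inv, <- !Rpow_mult_distr. f_equal. field. lra.
Qed.

(** * The substitution [mu = z ^ 2] *)

Lemma Csqrt_exists : forall w : C, exists z : C, (z * z)%C = w.
Proof.
  intros [x y]. set (r := Cmod (x, y)).
  assert (Hr : r * r = x * x + y * y).
  { unfold r, Cmod. simpl. rewrite sqrt_sqrt by nra. ring. }
  assert (Hx := Cmod_ge_fst (x, y)). fold r in Hx. simpl in Hx.
  assert (H1 : - r <= x <= r) by (apply Rabs_le_between; auto).
  set (p := sqrt ((r + x) / 2)). set (q := sqrt ((r - x) / 2)).
  assert (Hp : p * p = (r + x) / 2) by (apply sqrt_sqrt; lra).
  assert (Hq : q * q = (r - x) / 2) by (apply sqrt_sqrt; lra).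
  assert (Pp : 0 <= p) by apply sqrt_pos. assert (Pq : 0 <= q) by apply sqrt_pos.
  assert (Hpq : (2 * p * q) * (2 * p * q) = y * y).
  { replace ((2 * p * q) * (2 * p * q)) with (4 * (p * p) * (q * q)) by ring. rewrite Hp, Hq. nra. }
  destruct (Rle_lt_dec 0 y) as [Hy|Hy].
  - exists (p, q). apply injective_projections; simpl. nra.
    assert (2 * p * q = y); [|lra]. apply Rsqr_inj; auto. nra.
  - exists (p, - q). apply injective_projections; simpl. nra.
    assert (2 * p * q = - y); [|lra]. apply Rsqr_inj; try nra. unfold Rsqr. lra.
Qed.

Lemma Cmult_integral : forall a b : C, (a * b)%C = 0%C -> a = 0%C \/ b = 0%C.
Proof.
  intros a b H. destruct (classic (a = 0%C)); auto. destruct (classic (b = 0%C)); auto.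
  exfalso. apply (Cmult_neq_0 a b); auto.
Qed.

Lemma Csquare_eq : forall a b : C, (a * a)%C = (b * b)%C -> a = b \/ a = (- b)%C.
Proof.
  intros a b H. destruct (Cmult_integral (a - b) (a + b)).
  - replace ((a - b) * (a + b))%C with (a * a - b * b)%C by ring. rewrite H. ring.
  - left. apply Ceq_minus; auto.
  - right. replace a with ((a + b) - b)%C by ring. rewrite H0. ring.
Qed.

(** Away from the origin a branch of the square root is differentiable; at the origin the linear
    Taylor coefficient vanishes by parity. *)
Lemma even_ent_square : forall O, ent O -> (forall z, O (- z)%C = O z) ->
  exists P, ent P /\ forall z, O z = P (z * z)%C.
Proof.
  intros O HO Hev.
  destruct (choice (fun w z => (z * z)%C = w) Csqrt_exists) as [sq Hsq].
  exists (fun w => O (sq w)). split.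
  2:{ intros z. destruct (Csquare_eq _ _ (Hsq (z * z)%C)) as [E|E]; rewrite E; auto. }
  intros w0. destruct (classic (w0 = 0%C)) as [->|Hw0].
  - (* At the origin the even function is a constant plus [z ^ 2] times a continuous one. *)
    assert (H0 : sq 0%C = 0%C) by (destruct (Cmult_integral _ _ (Hsq 0%C)); auto).
    assert (D0 : C_derive O 0%C = 0%C).
    { assert (HH : hasd (fun z => O (- z)%C) 0%C ((- 1) * C_derive O (- 0)%C)%C).
      { apply (hasd_comp O (fun z => - z)%C). apply ent_hasd; auto. eapply hasd_eq. apply hasd_opp, hasd_id. ring. }
      replace (- 0)%C with (RtoC 0) in HH by ring.
      assert (E : ((- 1) * C_derive O 0)%C = C_derive O 0%C).
      { apply (hasd_unique O 0%C). apply (hasd_ext (fun z => O (- z)%C)); auto. apply ent_hasd; auto. }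
      apply Cmod_eq_0. assert (E2 : (2 * C_derive O 0)%C = 0%C).
      { replace (2 * C_derive O 0)%C with (C_derive O 0 - (- 1) * C_derive O 0)%C by ring. rewrite E. ring. }
      destruct (Cmult_integral _ _ E2) as [K|K]. apply RtoC_inj in K. lra. rewrite K. apply Cmod_0. }
    destruct (ent_quotient (fun z => O z - O 0)%C 0%C) as [q1 [Q1 [Q2 Q3]]].
    { intros z. eexists. apply hasd_minus. apply ent_hasd; auto. apply hasd_const. } { ring. }
    assert (Q4 : q1 0%C = 0%C).
    { rewrite Q2. apply C_derive_eq. eapply hasd_eq. apply hasd_minus. apply ent_hasd; auto.
      apply hasd_const. rewrite D0. ring. }
    destruct (ent_quotient q1 0%C Q1 Q4) as [q2 [R1 [_ R3]]].
    exists (q2 0%C). apply hasd_caratheodory. exists (fun w => q2 (sq w)).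
    assert (Csq : clim (Cnbhs (RtoC 0)) sq 0%C).
    { intros e He. apply locally_Cmod. exists (e * e). split. nra. intros y Hy.
      replace (y - 0)%C with y in Hy by ring. replace (sq y - 0)%C with (sq y) by ring.
      rewrite <- (Hsq y), Cmod_mult in Hy. generalize (Cmod_ge_0 (sq y)). nra. }
    split; [|split].
    + apply (clim_comp sq q2 (RtoC 0)); auto. apply (ent_cont q2 (RtoC 0) R1).
    + rewrite H0; auto.
    + intros y. rewrite H0. replace (O (sq y)) with ((O (sq y) - O 0) + O 0)%C by ring.
      rewrite Q3, R3. rewrite <- (Hsq y) at 4. ring.
  - set (z0 := sq w0). assert (Ez0 : (z0 * z0)%C = w0) by apply Hsq.
    assert (Hz0 : z0 <> 0%C). { intros E. rewrite E in Ez0. apply Hw0. rewrite <- Ez0. ring. }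
    assert (Hz0' : 0 < Cmod z0) by (apply Cmod_gt_0; auto).
    (* The branch of the square root closest to [z0]. *)
    set (sg := fun w => if Rle_dec (Cmod (sq w - z0)) (Cmod (sq w + z0)) then sq w else (- sq w)%C).
    assert (S1 : forall w, (sg w * sg w)%C = w).
    { intros w. unfold sg. destruct Rle_dec. apply Hsq. rewrite <- (Hsq w) at 3. ring. }
    assert (S2 : forall w, O (sq w) = O (sg w)).
    { intros w. unfold sg. destruct Rle_dec; auto. }
    assert (S3 : forall w, Cmod (sg w - z0) <= Cmod (sg w + z0)).
    { intros w. unfold sg. destruct Rle_dec as [L|L]; auto.
      replace (- sq w - z0)%C with (- (sq w + z0))%C by ring. replace (- sq w + z0)%C with (- (sq w - z0))%C by ring.
      rewrite !Cmod_opp. lra. }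
    assert (S4 : forall w, Cmod z0 <= Cmod (sg w + z0)).
    { intros w. specialize (S3 w). generalize (Cmod_tri3 (sg w + z0) (sg w - z0)).
      replace (sg w + z0 - (sg w - z0))%C with (2 * z0)%C by ring. rewrite Cmod_mult, Cmod_R, Rabs_pos_eq by lra. lra. }
    assert (S5 : forall w, (sg w + z0)%C <> 0%C). { intros w. apply Cmod_gt_0. specialize (S4 w); lra. }
    assert (S6 : sg w0 = z0).
    { unfold sg. fold z0. destruct Rle_dec as [L|L]; auto. exfalso. apply L.
      rewrite Cmod_self. apply Cmod_ge_0. }
    assert (S7 : clim (Cnbhs w0) sg z0).
    { intros e He. apply locally_Cmod. exists (e * Cmod z0). split. nra. intros y Hy.
      apply Rmult_lt_reg_r with (Cmod z0); auto. eapply Rle_lt_trans; [|exact Hy].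
      replace (y - w0)%C with ((sg y - z0) * (sg y + z0))%C.
      rewrite Cmod_mult. apply Rmult_le_compat_l. apply Cmod_ge_0. apply S4.
      rewrite <- (S1 y) at 3. rewrite <- Ez0. ring. }
    destruct (proj1 (hasd_caratheodory _ _ _) (ent_hasd O z0 HO)) as [f [F1 [F2 F3]]].
    exists (C_derive O z0 * / (z0 + z0))%C. apply hasd_caratheodory.
    exists (fun w => f (sg w) * / (sg w + z0))%C. split; [|split].
    + apply clim_mult. apply (clim_comp sg f z0); auto.
      apply clim_inv. apply clim_plus; auto. apply clim_const. rewrite <- S6 at 1. apply S5.
    + rewrite S6, F2. auto.
    + intros y. rewrite !S2, S6, (F3 (sg y)).
      replace (y - w0)%C with ((sg y - z0) * (sg y + z0))%C. field; auto.
      rewrite <- (S1 y) at 3. rewrite <- Ez0. ring.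
Qed.

Section Psi.
Variables (F : C -> C -> C) (s : R).
Hypotheses (Fbd : locbd F) (Fz : ent_z F) (Fheat : derive_t F (fun t => Dn 2 (F t)))
  (Fodd : forall t z, F t (- z)%C = (- F t z)%C)
  (Hs : 1 <= s < 2)
  (Fgr : forall T, 0 < T -> exists B, 0 <= B /\
    forall t z, Cmod t <= T -> Cmod (F t z) <= B * exp (4 * Rpower (1 + Cmod z) s)).

Lemma Psi_exists : exists Psi, ent_z Psi /\ forall t z, F t z = (z * Psi t (z * z))%C.
Proof.
  assert (H : forall t, exists P, ent P /\ forall z, F t z = (z * P (z * z))%C).
  { intros t.
    assert (H0 : F t 0%C = 0%C).
    { assert (E := Fodd t 0%C). replace (- 0)%C with (RtoC 0) in E by ring.
      assert (E2 : (2 * F t 0)%C = 0%C).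
      { replace (2 * F t 0)%C with (F t 0 - - F t 0)%C by ring. rewrite <- E. ring. }
      destruct (Cmult_integral _ _ E2) as [K|K]; auto. apply RtoC_inj in K. lra. }
    destruct (ent_quotient (F t) 0%C (Fz t) H0) as [O [O1 [O2 O3]]].
    destruct (even_ent_square O) as [P [P1 P2]]; auto.
    - intros z. destruct (classic (z = 0%C)) as [->|N]. f_equal; ring.
      assert (E := Fodd t z). rewrite !O3 in E.
      assert (E2 : (z * (O (- z) - O z))%C = 0%C).
      { replace (z * (O (- z) - O z))%C with (- ((- z - 0) * O (- z)) - (z - 0) * O z)%C by ring. rewrite E. ring. }
      destruct (Cmult_integral _ _ E2); [contradiction|]. apply Ceq_minus; auto.
    - exists P. split; auto. intros z. rewrite O3, P2. ring. }
  destruct (choice _ H) as [Psi HP]. exists Psi. split; intros t; apply HP.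
Qed.

Variable Psi : C -> C -> C.
Hypotheses (Pz : ent_z Psi) (PF : forall t z, F t z = (z * Psi t (z * z))%C).

(** The second [z]-derivative of [z * Psi t (z ^ 2)], divided by [z], at [w = z ^ 2]. *)
Definition PsiX (t w : C) : C := (6 * Dn 1 (Psi t) w + 4 * w * Dn 2 (Psi t) w)%C.

Lemma hasd_sq : forall z : C, hasd (fun z => z * z)%C z (2 * z)%C.
Proof. intros z. eapply hasd_eq. apply hasd_mult; apply hasd_id. cring. Qed.

Lemma F_zz : forall t z, Dn 2 (F t) z = (z * PsiX t (z * z))%C.
Proof.
  intros t z.
  assert (HP : forall k y, hasd (fun z => Dn k (Psi t) (z * z))%C y (2 * y * Dn (S k) (Psi t) (y * y))%C).
  { intros k y. apply (hasd_comp (Dn k (Psi t)) (fun z => z * z)%C). apply ent_hasd, ent_Dn, Pz. apply hasd_sq. }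
  assert (H1 : forall y, C_derive (F t) y = (Psi t (y * y) + 2 * (y * y) * Dn 1 (Psi t) (y * y))%C).
  { intros y. apply C_derive_eq. apply (hasd_ext (fun z => z * Psi t (z * z))%C). intros; symmetry; apply PF.
    eapply hasd_eq. apply hasd_mult. apply hasd_id. apply (HP 0%nat). cbv beta. ring. }
  simpl Dn. apply C_derive_eq.
  apply (hasd_ext (fun y => Psi t (y * y) + 2 * (y * y) * Dn 1 (Psi t) (y * y))%C). intros; symmetry; apply H1.
  eapply hasd_eq. apply hasd_plus. apply (HP 0%nat). apply hasd_mult. apply hasd_scal. apply hasd_sq. apply (HP 1%nat).
  unfold PsiX. cbv beta. ring.
Qed.

Lemma ent_const : forall c, ent (fun _ => c).
Proof. intros c z. exists 0%C. apply hasd_const. Qed.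
Lemma ent_id : ent (fun z => z).
Proof. intros z. exists 1%C. apply hasd_id. Qed.
Lemma ent_plus : forall f g, ent f -> ent g -> ent (fun z => f z + g z)%C.
Proof. intros f g Hf Hg z. eexists. apply hasd_plus; apply ent_hasd; auto. Qed.
Lemma ent_mult : forall f g, ent f -> ent g -> ent (fun z => f z * g z)%C.
Proof. intros f g Hf Hg z. eexists. apply hasd_mult; apply ent_hasd; auto. Qed.

Lemma ent_PsiX : ent_z PsiX.
Proof.
  intros t. unfold PsiX. apply ent_plus; apply ent_mult; try apply ent_Dn, Pz. apply ent_const.
  apply ent_mult. apply ent_const. apply ent_id.
Qed.

(** Away from the origin [Psi] is controlled by [F]; averaging over a circle of
    radius 2 transfers the bound to small [w]. *)
Lemma Psi_growth : forall T, 0 < T -> exists B, 0 <= B /\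
  forall t w, Cmod t <= T -> Cmod (Psi t w) <= B * exp (16 * Rpower (3 + Cmod w) (s / 2)).
Proof.
  intros T HT. destruct (Fgr T HT) as [B [HB H]]. exists B. split; auto.
  intros t w Ht.
  assert (Big : forall y, 1 <= Cmod y -> Cmod (Psi t y) <= B * exp (16 * Rpower (1 + Cmod y) (s / 2))).
  { intros y Hy. destruct (Csqrt_exists y) as [z Hz].
    assert (Hzy : Cmod z * Cmod z = Cmod y) by (rewrite <- Cmod_mult, Hz; auto).
    assert (Hz1 : 1 <= Cmod z) by (generalize (Cmod_ge_0 z); nra).
    assert (HP : Cmod (Psi t y) <= Cmod (F t z)).
    { rewrite PF, Hz, Cmod_mult. generalize (Cmod_ge_0 (Psi t y)). nra. }
    eapply Rle_trans. exact HP. eapply Rle_trans. apply H; auto. apply Rmult_le_compat_l; auto. apply exp_le.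
    assert (E : Rpower (1 + Cmod z) s = Rpower ((1 + Cmod z) * (1 + Cmod z)) (s / 2)).
    { rewrite <- Rpower_mult_distr by lra. rewrite <- Rpower_plus. f_equal. field. }
    rewrite E.
    assert (E2 : Rpower ((1 + Cmod z) * (1 + Cmod z)) (s / 2) <= Rpower (4 * (1 + Cmod y)) (s / 2)).
    { apply Rle_Rpower_l. lra. split. nra. nra. }
    rewrite <- (Rpower_mult_distr 4) in E2 by lra.
    assert (E3 : Rpower 4 (s / 2) <= 4). { apply Rle_trans with (Rpower 4 1). apply Rle_Rpower; lra. rewrite Rpower_1; lra. }
    assert (0 < Rpower (1 + Cmod y) (s / 2)) by apply exp_pos.
    assert (Rpower 4 (s / 2) * Rpower (1 + Cmod y) (s / 2) <= 4 * Rpower (1 + Cmod y) (s / 2)).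
    { apply Rmult_le_compat_r; lra. }
    lra. }
  assert (Hw := Cmod_ge_0 w).
  destruct (Rle_lt_dec 1 (Cmod w)) as [L|L].
  - eapply Rle_trans. apply Big; auto. apply Rmult_le_compat_l; auto. apply exp_le.
    apply Rmult_le_compat_l. lra. apply Rle_Rpower_l; lra.
  - apply est_0 with 3 2; try lra. apply ent_holo, Pz. intros y Hy.
    assert (H1 := Cmod_tri_inv (y - w) (- w)). replace (y - w - - w)%C with y in H1 by ring. rewrite Cmod_opp in H1.
    assert (H2 := Cmod_triangle (y - w) w). replace (y - w + w)%C with y in H2 by ring.
    eapply Rle_trans. apply Big; lra. apply Rmult_le_compat_l; auto. apply exp_le.
    apply Rmult_le_compat_l. lra. apply Rle_Rpower_l; lra.
Qed.

Lemma Psi_locbd : locbd Psi.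
Proof.
  intros t0 w0. destruct (Psi_growth (Cmod t0 + 1)) as [B [HB H]]. generalize (Cmod_ge_0 t0); lra.
  exists 1, (B * exp (16 * Rpower (3 + (Cmod w0 + 1)) (s / 2))). split. lra. split.
  apply Rmult_le_pos; auto. left; apply exp_pos.
  intros t w Ht Hw.
  assert (Hw' : Cmod w <= Cmod w0 + 1).
  { replace w with ((w - w0) + w0)%C by ring. eapply Rle_trans. apply Cmod_triangle. lra. }
  eapply Rle_trans. apply H.
  - replace t with ((t - t0) + t0)%C by ring. eapply Rle_trans. apply Cmod_triangle. lra.
  - apply Rmult_le_compat_l; auto. apply exp_le. apply Rmult_le_compat_l. lra.
    generalize (Cmod_ge_0 w). intros. apply Rle_Rpower_l; lra.
Qed.

(** The second-order remainder in [t] is entire in [w], so the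
    bound known from [F] on a circle staying away from the origin holds at the centre. *)
Theorem Psi_heat : derive_t Psi PsiX.
Proof.
  intros t0 w0.
  destruct (Fgr (Cmod t0 + 1)) as [B [HB H]]. generalize (Cmod_ge_0 t0); lra.
  assert (Hw0 := Cmod_ge_0 w0). set (R0 := 2 * Cmod w0 + 1).
  set (M := B * exp (4 * Rpower (1 + R0) s)).
  assert (HM : 0 <= M). { apply Rmult_le_pos; auto. left; apply exp_pos. }
  apply hasd_quad with (/ 2) (2 * M); try lra.
  intros t Ht.
  set (E := fun w => (Psi t w - Psi t0 w - (t - t0) * PsiX t0 w)%C).
  change (Cmod (E w0) <= 2 * M * (Cmod (t - t0) * Cmod (t - t0))).
  apply est_0 with (Cmod w0 + 2) (Cmod w0 + 1); try lra.
  - intros w _. eexists. apply hasd_minus. apply hasd_minus; apply ent_hasd, Pz. apply hasd_scal, ent_hasd, ent_PsiX.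
  - intros w Hw. destruct (Csqrt_exists w) as [z Hz].
    assert (Hzw : Cmod z * Cmod z = Cmod w) by (rewrite <- Cmod_mult, Hz; auto).
    assert (Hw1 : 1 <= Cmod w <= R0).
    { assert (H1 := Cmod_tri_inv (w - w0) (- w0)). replace (w - w0 - - w0)%C with w in H1 by ring. rewrite Cmod_opp in H1.
      assert (H2 := Cmod_triangle (w - w0) w0). replace (w - w0 + w0)%C with w in H2 by ring. unfold R0. lra. }
    assert (Hz1 : 1 <= Cmod z <= R0) by (generalize (Cmod_ge_0 z); nra).
    apply Rle_trans with (Cmod (z * E w)).
    { rewrite Cmod_mult. generalize (Cmod_ge_0 (E w)). nra. }
    replace (z * E w)%C with (F t z - F t0 z - (t - t0) * Dn 2 (F t0) z)%C.
    2:{ rewrite F_zz, !PF, Hz. unfold E. ring. }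
    rewrite <- (derive_t_eq F _ t0 z Fheat).
    replace (2 * M * (Cmod (t - t0) * Cmod (t - t0))) with (2 * M * (Cmod (t - t0) / 1) ^ 2) by field.
    apply (est_taylor (fun u => F u z) t0 2 1); try lra.
    + apply ent_holo. eapply derive_t_ent, Fheat.
    + intros u Hu. eapply Rle_trans. apply H.
      replace u with ((u - t0) + t0)%C by ring. eapply Rle_trans. apply Cmod_triangle. lra.
      apply Rmult_le_compat_l; auto. apply exp_le. apply Rmult_le_compat_l. lra. apply Rle_Rpower_l; lra.
Qed.

(** Each differentiation of [4 w Psi''] in [w] adds 4 to the coefficient of the first-order term. *)
Lemma Psi_Dn : forall k,
  locbd (fun t => Dn k (Psi t)) /\
  derive_t (fun t => Dn k (Psi t))
    (fun t w => (6 + 4 * RtoC (INR k)) * Dn (S k) (Psi t) w + 4 * w * Dn (S (S k)) (Psi t) w)%C.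
Proof.
  induction k as [|k [IH1 IH2]].
  - split. exact Psi_locbd. intros t w. eapply hasd_eq. apply Psi_heat. unfold PsiX. simpl INR. simpl. ring.
  - split.
    + apply (locbd_derive (fun t => Dn k (Psi t))); auto. intros t. apply ent_Dn, Pz.
    + intros t w. eapply hasd_eq. apply (derive_exchange (fun t => Dn k (Psi t)) (fun t w =>
          (6 + 4 * RtoC (INR k)) * Dn (S k) (Psi t) w + 4 * w * Dn (S (S k)) (Psi t) w)%C IH1).
      * intros u. apply ent_Dn, Pz.
      * exact IH2.
      * intros u. apply ent_plus; apply ent_mult.
        apply ent_const. exact (ent_Dn (S k) _ (Pz u)).
        apply ent_mult. apply ent_const. apply ent_id. exact (ent_Dn (S (S k)) _ (Pz u)).
      * apply C_derive_eq. eapply hasd_eq. apply hasd_plus. apply hasd_scal. exact (ent_hasd _ _ (ent_Dn (S k) _ (Pz t))).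
        apply hasd_mult. apply hasd_scal, hasd_id. exact (ent_hasd _ _ (ent_Dn (S (S k)) _ (Pz t))).
        rewrite S_INR, RtoC_plus. cbv beta. simpl Dn. ring.
Qed.

End Psi.

(** * Logarithmic derivatives of functions without zeros *)

Lemma hasdR_parts : forall f x l, hasdR f x l ->
  is_derive (fun t => fst (f t)) x (fst l) /\ is_derive (fun t => snd (f t)) x (snd l).
Proof.
  assert (Main : forall (p : C -> R) f x l, (forall c, Rabs (p c) <= Cmod c) ->
    (forall a b h c, p (a - b - RtoC h * c)%C = p a - p b - h * p c) -> hasdR f x l ->
    is_derive (fun t => p (f t)) x (p l)).
  { intros p f x l Hp Hlin H. apply is_derive_Reals. intros e He.
    rewrite hasdR_eps in H. destruct (H (e / 2)) as [d [Hd H']]. lra.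
    exists (mkposreal d Hd). intros h Hh0 Hh. simpl in Hh.
    specialize (H' (x + h)). replace (x + h - x) with h in H' by ring. specialize (H' Hh).
    assert (H2 := Rle_trans _ _ _ (Hp _) H'). rewrite Hlin in H2.
    replace ((p (f (x + h)) - p (f x)) / h - p l) with ((p (f (x + h)) - p (f x) - h * p l) / h) by (field; auto).
    assert (0 < Rabs h) by (apply Rabs_pos_lt; auto).
    rewrite Rabs_div by auto. apply Rmult_lt_reg_r with (Rabs h); auto. unfold Rdiv.
    rewrite Rmult_assoc, Rinv_l, Rmult_1_r by lra. nra. }
  intros f x l H. split.
  - apply (Main fst); auto. apply Cmod_ge_fst. intros; simpl; ring.
  - apply (Main snd); auto. apply Cmod_ge_snd. intros; simpl; ring.
Qed.

Lemma Cmod_sqr : forall z : C, Cmod z * Cmod z = fst z * fst z + snd z * snd z.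
Proof. intros [x y]. unfold Cmod. simpl. rewrite sqrt_sqrt by nra. ring. Qed.

Lemma is_derive_congr : forall (f : R -> R) (t a b : R), is_derive f t a -> a = b -> is_derive f t b.
Proof. intros; subst; auto. Qed.

Lemma is_derive_normsq_exp : forall (u v l : R -> R) t x1 x2 y,
  is_derive u t x1 -> is_derive v t x2 -> is_derive l t y ->
  is_derive (fun t => (u t * u t + v t * v t) * exp (- 2 * l t)) t
    ((2 * (u t * x1 + v t * x2) - 2 * (u t * u t + v t * v t) * y) * exp (- 2 * l t)).
Proof.
  intros u v l t x1 x2 y Hu Hv Hl. auto_derive.
  - repeat split; eexists; eassumption.
  - replace (Derive (fun x => u x) t) with x1 by (symmetry; apply is_derive_unique, Hu).
    replace (Derive (fun x => v x) t) with x2 by (symmetry; apply is_derive_unique, Hv).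
    replace (Derive (fun x => l x) t) with y by (symmetry; apply is_derive_unique, Hl).
    ring.
Qed.

(** The squared modulus of [q] times [exp (- 2 Re L)] is constant along segments from the centre.
    Working with moduli avoids the complex exponential. *)
Lemma log_modulus : forall q L w R0, ent q -> (forall z, disc w R0 z -> q z <> 0%C) ->
  (forall z, disc w R0 z -> hasd L z (C_derive q z / q z)%C) -> L w = 0%C ->
  forall z, disc w R0 z -> Cmod (q z) * Cmod (q z) = Cmod (q w) * Cmod (q w) * exp (2 * fst (L z)).
Proof.
  intros q L w R0 Hq Hnz HL HLw z Hz.
  set (ga := fun t : R => (w + RtoC t * (z - w))%C).
  assert (Hga : forall t, 0 <= t <= 1 -> disc w R0 (ga t)).
  { intros t Ht. unfold disc, ga. replace (w + RtoC t * (z - w) - w)%C with (RtoC t * (z - w))%C by ring.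
    rewrite Cmod_mult, Cmod_R, Rabs_pos_eq by lra. unfold disc in Hz. generalize (Cmod_ge_0 (z - w)). nra. }
  assert (Dga : forall t, hasdR ga t (z - w)%C).
  { intros t. replace (z - w)%C with (1 * (z - w))%C by ring.
    apply (hasd_comp_R (fun u => w + u * (z - w))%C (fun t => (t, 0))).
    - eapply hasd_eq. apply hasd_plus. apply hasd_const. apply hasd_mult. apply hasd_id. apply hasd_const. cring.
    - apply hasdR_hline. }
  set (Ph := fun t => Cmod (q (ga t)) * Cmod (q (ga t)) * exp (- 2 * fst (L (ga t)))).
  assert (DPh : forall t, 0 <= t <= 1 -> is_derive Ph t 0).
  { intros t Ht. assert (Hin := Hga t Ht).
    assert (D1 := hasd_comp_R q ga t _ _ (ent_hasd q (ga t) Hq) (Dga t)).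
    assert (D2 := hasd_comp_R L ga t _ _ (HL _ Hin) (Dga t)).
    destruct (hasdR_parts _ _ _ D1) as [A1 A2]. destruct (hasdR_parts _ _ _ D2) as [A3 _].
    apply (is_derive_ext (fun t => (fst (q (ga t)) * fst (q (ga t)) + snd (q (ga t)) * snd (q (ga t))) * exp (- 2 * fst (L (ga t))))).
    { intros u. unfold Ph. rewrite Cmod_sqr. reflexivity. }
    assert (Hq2 : fst (q (ga t)) * fst (q (ga t)) + snd (q (ga t)) * snd (q (ga t)) <> 0).
    { rewrite <- Cmod_sqr. assert (0 < Cmod (q (ga t))) by (apply Cmod_gt_0, Hnz, Hin). nra. }
    set (Q := q (ga t)) in *. set (D := C_derive q (ga t)) in *.
    assert (E3 : fst ((z - w) * (D / Q))%C =
       (fst Q * fst ((z - w) * D)%C + snd Q * snd ((z - w) * D)%C) / (fst Q * fst Q + snd Q * snd Q)).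
    { destruct Q as [a b]. destruct D as [c d]. destruct z as [z1 z2]. destruct w as [w1 w2].
      simpl in *. field. intros E. apply Hq2. rewrite <- E. ring. }
    rewrite E3 in A3. clear E3.
    set (x1 := fst ((z - w) * D)%C) in *. set (x2 := snd ((z - w) * D)%C) in *.
    assert (DD := is_derive_normsq_exp (fun t => fst (q (ga t))) (fun t => snd (q (ga t)))
      (fun t => fst (L (ga t))) t _ _ _ A1 A2 A3).
    apply (is_derive_congr _ _ _ _ DD). cbv beta. fold Q. field. exact Hq2. }
  assert (E : Ph 1 = Ph 0).
  { destruct (MVT_gen Ph 0 1 (fun _ => 0)) as [c [_ Hc]].
    - intros x Hx. rewrite Rmin_left, Rmax_right in Hx by lra. apply DPh; lra.
    - intros x Hx. rewrite Rmin_left, Rmax_right in Hx by lra.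
      apply continuity_pt_filterlim. apply (ex_derive_continuous Ph). exists 0. apply DPh; lra.
    - lra. }
  unfold Ph in E.
  assert (G1 : ga 1 = z) by (unfold ga; ring). assert (G0 : ga 0 = w) by (unfold ga; ring).
  rewrite G1, G0, HLw in E. simpl fst in E. rewrite Rmult_0_r, exp_0, Rmult_1_r in E.
  rewrite <- E, Rmult_assoc, <- exp_plus. replace (-2 * fst (L z) + 2 * fst (L z)) with 0 by ring.
  rewrite exp_0. ring.
Qed.

(** A form of the Borel-Caratheodory inequality: a logarithm [L] with [L w = 0] and real part below [A]
    is mapped into the unit disc by [L / (2 A - L)]. *)
Lemma log_derive_bound : forall q w R0 A, 0 < R0 -> 0 < A -> ent q -> (forall z, disc w R0 z -> q z <> 0%C) ->
  (forall z, disc w R0 z -> Cmod (q z) <= Cmod (q w) * exp A) ->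
  Cmod (C_derive q w / q w) <= 4 * A / R0.
Proof.
  intros q w R0 A HR HA Hq Hnz HB.
  assert (Hw : disc w R0 w).
  { unfold disc. rewrite Cmod_self; auto. }
  set (f := fun z => (C_derive q z / q z)%C).
  assert (Hf : forall z, disc w R0 z -> exists l, hasd f z l).
  { intros z Hz. eexists. apply hasd_div. apply ent_hasd, ent_derive, Hq. apply ent_hasd, Hq. auto. }
  set (L := prim_hv f w).
  assert (HL : forall z, disc w R0 z -> hasd L z (f z)).
  { apply (primitive_exists f w w R0); auto. intros z Hz. destruct (Hf z Hz) as [l Hl]. eapply hasd_cont, Hl. }
  assert (HLw : L w = 0%C).
  { unfold L, prim_hv, hseg, vseg.
    assert (Z : forall h a, CI h a a = 0%C).
    { intros h a. apply is_CI_unique. apply (is_RInt_point (V := C_R_NormedModule)). }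
    rewrite !Z. ring. }
  assert (Hre : forall z, disc w R0 z -> fst (L z) <= A).
  { intros z Hz. assert (E := log_modulus q L w R0 Hq Hnz HL HLw z Hz).
    assert (P : 0 < Cmod (q w)) by (apply Cmod_gt_0; auto). assert (P2 := Cmod_ge_0 (q z)).
    specialize (HB z Hz).
    assert (H1 : exp (2 * fst (L z)) <= exp A * exp A).
    { apply Rmult_le_reg_l with (Cmod (q w) * Cmod (q w)). nra. rewrite <- E.
      replace (Cmod (q w) * Cmod (q w) * (exp A * exp A)) with ((Cmod (q w) * exp A) * (Cmod (q w) * exp A)) by ring.
      apply Rmult_le_compat; auto. }
    rewrite <- exp_plus in H1. apply Rnot_lt_le. intros N. apply (Rle_not_lt _ _ H1). apply exp_increasing. lra. }
  assert (Hden : forall z, disc w R0 z -> (RtoC (2 * A) - L z)%C <> 0%C).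
  { intros z Hz E. assert (E1 : 2 * A - fst (L z) = 0) by exact (f_equal fst E). specialize (Hre z Hz). lra. }
  set (ph := fun z => (L z / (RtoC (2 * A) - L z))%C).
  assert (Hph : forall z, disc w R0 z -> exists l, hasd ph z l).
  { intros z Hz. eexists. apply hasd_div. apply HL; auto. apply hasd_minus. apply hasd_const. apply HL; auto.
    apply Hden; auto. }
  assert (Dph : C_derive ph w = (f w / RtoC (2 * A))%C).
  { apply C_derive_eq. eapply hasd_eq. apply hasd_div. apply HL; auto. apply hasd_minus. apply hasd_const. apply HL; auto.
    apply Hden; auto. cbv beta. rewrite HLw. field. intros E. apply RtoC_inj in E. lra. }
  assert (Hb : Cmod (C_derive ph w) <= 1 / (R0 / 2)).
  { apply est_1 with R0; try lra. exact Hph. intros z Hz.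
    assert (Hzd : disc w R0 z) by (unfold disc; lra).
    unfold ph. rewrite Cmod_div by auto.
    assert (P : 0 < Cmod (RtoC (2 * A) - L z)) by (apply Cmod_gt_0; auto).
    apply Rle_div_l; auto. rewrite Rmult_1_l. apply Rsqr_incr_0_var; [|lra]. unfold Rsqr.
    rewrite !Cmod_sqr. specialize (Hre z Hzd). clear - Hre HA. destruct (L z) as [x y].
    change (x * x + y * y <= (2 * A + - x) * (2 * A + - x) + (0 + - y) * (0 + - y)). simpl in Hre. nra. }
  rewrite Dph, Cmod_div in Hb.
  2:{ intros E. apply RtoC_inj in E. lra. }
  rewrite Cmod_R, Rabs_pos_eq in Hb by lra.
  change (Cmod (f w) <= 4 * A / R0).
  assert (P2A : 2 * A > 0) by lra. apply (proj1 (Rle_div_l _ _ _ P2A)) in Hb. replace (4 * A / R0) with (1 / (R0 / 2) * (2 * A)) by (field; lra). exact Hb.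
Qed.

(** * Dividing out zeros *)

Lemma cancel_at : forall A B w m, contC A w -> contC B w ->
  (forall z, ((z - w) ^ m * A z)%C = ((z - w) ^ m * B z)%C) -> A w = B w.
Proof.
  intros A B w m HA HB H.
  assert (HD : contC (fun z => A z - B z)%C w) by (apply clim_minus; auto).
  apply Ceq_minus. apply NNPP. intros N. apply Cmod_gt_0 in N.
  specialize (HD _ N). apply locally_Cmod in HD. destruct HD as [d [Hd HD]].
  set (z := (w + RtoC (d / 2))%C).
  assert (Ez : (z - w)%C = RtoC (d / 2)) by (unfold z; ring).
  assert (Ez' : (z - w)%C <> 0%C). { rewrite Ez. intros E. apply RtoC_inj in E. lra. }
  assert (AB : A z = B z).
  { apply Ceq_minus. destruct (Cmult_integral ((z - w) ^ m) (A z - B z)); auto.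
    - replace ((z - w) ^ m * (A z - B z))%C with ((z - w) ^ m * A z - (z - w) ^ m * B z)%C by ring. rewrite H. ring.
    - exfalso. apply (Cpow_nz (z - w) m); auto. }
  specialize (HD z). rewrite Ez, Cmod_R, Rabs_pos_eq in HD by lra. specialize (HD ltac:(lra)).
  rewrite AB in HD. replace (B z - B z - (A w - B w))%C with (- (A w - B w))%C in HD by ring.
  rewrite Cmod_opp in HD. lra.
Qed.

Section Zeros.
Variables (g : C -> C) (s : nat -> option C).
Hypotheses (Hg : ent g) (Hs : lists_zeros g s).

(** The zero with index [j]; only meaningful for the indices in use. *)
Definition val (j : nat) : C := match s j with Some v => v | None => 0%C end.
Definition used (j : nat) : Prop := s j = Some (val j).

Definition at_zero (u : C) (j : nat) : bool := if Ceq_dec (val j) u then true else false.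

Definition prodl (l : list nat) (z : C) : C := fold_right (fun j p => (z - val j) * p)%C 1%C l.

Lemma ent_prodl : forall l, ent (prodl l).
Proof.
  induction l as [|j l IH]. apply ent_const.
  simpl. apply ent_mult; auto. intros z. eexists. apply hasd_shift.
Qed.

Lemma prodl_split : forall l u z, prodl l z =
  ((z - u) ^ length (filter (at_zero u) l) * prodl (filter (fun j => negb (at_zero u j)) l) z)%C.
Proof.
  induction l as [|j l IH]; intros u z; simpl. ring.
  rewrite (IH u z). destruct (at_zero u j) eqn:E; simpl.
  - unfold at_zero in E. destruct (Ceq_dec (val j) u) as [->|]; [|discriminate]. ring.
  - ring.
Qed.

Lemma prodl_nz : forall l z, (forall j, In j l -> val j <> z) -> prodl l z <> 0%C.
Proof.
  induction l as [|j l IH]; intros z H; simpl. exact C1_nz.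
  apply Cmult_neq_0. apply Cminus_eq_contra. intros E. apply (H j); simpl; auto. apply IH. intros i Hi; apply H; simpl; auto.
Qed.

Lemma prodl_rest_nz : forall l u, prodl (filter (fun j => negb (at_zero u j)) l) u <> 0%C.
Proof.
  intros l u. apply prodl_nz. intros j Hj. apply filter_In in Hj. destruct Hj as [_ Hj].
  unfold at_zero in Hj. destruct (Ceq_dec (val j) u); auto; discriminate.
Qed.

Lemma zero_order_list : forall u, exists m H lu, ent H /\ H u <> 0%C /\ (forall z, g z = ((z - u) ^ m * H z)%C) /\
  NoDup lu /\ length lu = m /\ forall j, In j lu <-> s j = Some u.
Proof.
  intros u. destruct (Hs u) as [m [[H [H1 [H2 H3]]] [lu [L1 [L2 L3]]]]].
  exists m, H, lu. split. apply ent_entire; auto. repeat split; auto; apply L3.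
Qed.

Lemma filter_incl_zero : forall l u lu, (forall j, In j l -> used j) -> (forall j, In j lu <-> s j = Some u) ->
  incl (filter (at_zero u) l) lu.
Proof.
  intros l u lu Hl Hlu j Hj. apply filter_In in Hj. destruct Hj as [Hj1 Hj2]. apply Hlu. rewrite (Hl j Hj1).
  unfold at_zero in Hj2. destruct (Ceq_dec (val j) u); [congruence|discriminate].
Qed.

(** A zero [u] occurs in the listing as often as its order. As long as a copy of it is not in [l],
    the quotient by the factors of [l] therefore still vanishes at [u]. *)
Theorem divide_zeros : forall l, NoDup l -> (forall j, In j l -> used j) ->
  exists q, ent q /\ forall z, g z = (prodl l z * q z)%C.
Proof.
  induction l as [|j l IH]; intros Hnd Hu.
  - exists g. split; auto. intros z. simpl. ring.
  - inversion Hnd as [|? ? Hj Hnd']; subst.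
    destruct IH as [q [Q1 Q2]]; auto. { intros i Hi; apply Hu; simpl; auto. }
    set (u := val j). destruct (zero_order_list u) as [m [H [lu [H1 [H2 [H3 [L1 [L2 L3]]]]]]]].
    set (c := length (filter (at_zero u) l)).
    assert (Hc : (S c <= m)%nat).
    { rewrite <- L2. change (S c) with (length (j :: filter (at_zero u) l)).
      apply NoDup_incl_length.
      - constructor. intros K. apply filter_In in K. tauto. apply NoDup_filter; auto.
      - intros i [<-|Hi]. apply L3. apply (Hu j). simpl; auto.
        apply (filter_incl_zero l u lu); auto. intros i' Hi'; apply Hu; simpl; auto. }
    assert (Qu : q u = 0%C).
    { set (rest := prodl (filter (fun j => negb (at_zero u j)) l)).
      assert (E : (rest u * q u)%C = ((u - u) ^ (m - c) * H u)%C).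
      { apply (cancel_at (fun z => rest z * q z)%C (fun z => (z - u) ^ (m - c) * H z)%C u c).
        - apply (ent_cont (fun z => rest z * q z)%C). apply ent_mult; auto. apply ent_prodl.
        - apply clim_mult. apply clim_pow. apply clim_shift. apply ent_cont; auto.
        - intros z. rewrite !Cmult_assoc, <- Cpow_add_r. replace (c + (m - c))%nat with m by lia.
          rewrite <- H3, (Q2 z), (prodl_split l u z). reflexivity. }
      destruct (Cmult_integral (rest u) (q u)); auto.
      - rewrite E. replace (m - c)%nat with (S (m - c - 1)) by lia. simpl. ring.
      - exfalso. apply (prodl_rest_nz l u); auto. }
    destruct (ent_quotient q u Q1 Qu) as [q' [R1 [_ R2]]].
    exists q'. split; auto. intros z. rewrite Q2, R2. simpl. fold u. ring.
Qed.

(** If all the copies of [u] are in [l], the factors at [u] have the full order of the zero, and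
    cancelling them leaves a nonzero value. *)
Theorem quotient_nonzero : forall l q u, NoDup l -> (forall j, In j l -> used j) -> ent q ->
  (forall z, g z = (prodl l z * q z)%C) -> (forall j, s j = Some u -> In j l) -> q u <> 0%C.
Proof.
  intros l q u Hnd Hu Q1 Q2 Hall Hq.
  destruct (zero_order_list u) as [m [H [lu [H1 [H2 [H3 [L1 [L2 L3]]]]]]]].
  assert (Hc : length (filter (at_zero u) l) = m).
  { apply Nat.le_antisymm; rewrite <- L2; apply NoDup_incl_length; auto.
    - apply NoDup_filter; auto.
    - apply (filter_incl_zero l u lu); auto.
    - intros j Hj. apply L3 in Hj. apply filter_In. split; auto.
      unfold at_zero, val. rewrite Hj. destruct (Ceq_dec u u); auto. }
  set (rest := prodl (filter (fun j => negb (at_zero u j)) l)).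
  apply H2. transitivity (rest u * q u)%C.
  - apply (cancel_at H (fun z => rest z * q z)%C u m).
    + apply ent_cont; auto.
    + apply (ent_cont (fun z => rest z * q z)%C). apply ent_mult; auto. apply ent_prodl.
    + intros z. rewrite <- H3, Q2, (prodl_split l u z), Hc. fold rest. ring.
  - rewrite Hq. ring.
Qed.

Lemma used_zero : forall j, used j -> g (val j) = 0%C.
Proof.
  intros j Hj. destruct (zero_order_list (val j)) as [m [H [lu [H1 [H2 [H3 [L1 [L2 L3]]]]]]]].
  assert (Hin : In j lu) by (apply L3; exact Hj).
  rewrite H3. destruct m. destruct lu; [contradiction|discriminate]. simpl. ring.
Qed.

End Zeros.

(** * The logarithmic derivative as a sum over the zeros *)

(** The function [g] has order below 1; this is used on dyadic circles only, where [th] stands for 2 to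
    the power of the order. *)
Section Hadamard.
Variables (g : C -> C) (s : nat -> option C) (k : nat) (w : C) (Cg th : R).
Hypotheses (Hg : ent g) (Hs : lists_zeros g s) (Hk : s k = Some w)
  (Hk' : forall j, j <> k -> s j <> Some w) (Hd : C_derive g w <> 0%C)
  (HCg : 0 <= Cg) (Hth : 1 <= th < 2)
  (Hgr : forall n z, Cmod (z - w) <= 4 * 2 ^ n -> Cmod (g z) <= Cmod (C_derive g w) * exp (Cg * th ^ n)).

(** Finite lists of indices of zeros other than [w]. *)
Definition other (l : list nat) : Prop := NoDup l /\ forall j, In j l -> used s j /\ j <> k.

Definition dist (j : nat) : R := Cmod (val s j - w).

Lemma val_k : val s k = w.
Proof. unfold val. rewrite Hk. reflexivity. Qed.

Lemma other_nz : forall l j, other l -> In j l -> val s j <> w.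
Proof.
  intros l j [_ H] Hj E. destruct (H j Hj) as [H1 H2]. apply (Hk' j H2). rewrite <- E. exact H1.
Qed.

Lemma other_cons : forall j l, other (j :: l) -> other l.
Proof. intros j l [H1 H2]. split. inversion H1; auto. intros i Hi; apply H2; simpl; auto. Qed.

Lemma other_filter : forall p l, other l -> other (filter p l).
Proof. intros p l [H1 H2]. split. apply NoDup_filter; auto. intros i Hi; apply H2. apply filter_In in Hi; tauto. Qed.

Lemma other_quotient : forall l, other l -> exists q, ent q /\
  (forall z, g z = ((z - w) * (prodl s l z * q z))%C) /\ C_derive g w = (prodl s l w * q w)%C.
Proof.
  intros l [H1 H2].
  destruct (divide_zeros g s Hg Hs (k :: l)) as [q [Q1 Q2]].
  - constructor; auto. intros K. apply (proj2 (H2 k K)); auto.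
  - intros j [<-|Hj]. unfold used. rewrite val_k. exact Hk. apply H2; auto.
  - assert (E : forall z, g z = ((z - w) * (prodl s l z * q z))%C).
    { intros z. rewrite Q2. simpl. rewrite val_k. ring. }
    exists q. split; auto. split; auto.
    apply C_derive_eq. apply (hasd_ext (fun z => (z - w) * (prodl s l z * q z))%C). intros; symmetry; apply E.
    eapply hasd_eq. apply hasd_mult. apply hasd_shift. apply ent_hasd. apply ent_mult; auto. apply ent_prodl.
    cring.
Qed.

Lemma prodl_nz_w : forall l, other l -> 0 < Cmod (prodl s l w).
Proof. intros l H. apply Cmod_gt_0, prodl_nz. intros j Hj. eapply other_nz; eauto. Qed.

Lemma prodl_lower : forall l z c, 0 <= c -> (forall j, In j l -> c * dist j <= Cmod (z - val s j)) ->
  c ^ length l * Cmod (prodl s l w) <= Cmod (prodl s l z).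
Proof.
  induction l as [|j l IH]; intros z c Hc H; simpl. lra.
  rewrite !Cmod_mult. rewrite (Cmod_sub_sym w). fold (dist j).
  replace (c * c ^ length l * (dist j * Cmod (prodl s l w))) with ((c * dist j) * (c ^ length l * Cmod (prodl s l w))) by ring.
  assert (0 <= dist j) by apply Cmod_ge_0.
  apply Rmult_le_compat.
  - nra.
  - apply Rmult_le_pos. apply pow_le; auto. apply Cmod_ge_0.
  - apply H; simpl; auto.
  - apply IH; auto. intros i Hi; apply H; simpl; auto.
Qed.

(** At a point [z] whose distance to each listed zero is at least [c] times that of [w], the
    product [prodl] exceeds its value at [w] by a factor of at least [c] for each zero. *)
Lemma quotient_bound : forall l q n z c, other l -> ent q ->
  (forall z, g z = ((z - w) * (prodl s l z * q z))%C) -> C_derive g w = (prodl s l w * q w)%C ->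
  0 < c -> 1 <= Cmod (z - w) -> Cmod (z - w) <= 4 * 2 ^ n ->
  (forall j, In j l -> c * dist j <= Cmod (z - val s j)) ->
  c ^ length l * Cmod (q z) <= Cmod (q w) * exp (Cg * th ^ n).
Proof.
  intros l q n z c Hl Hq E1 E2 Hc Hz1 Hz4 Hj.
  assert (P := prodl_nz_w l Hl).
  assert (P2 := prodl_lower l z c (Rlt_le _ _ Hc) Hj).
  assert (B := Hgr n z Hz4). rewrite E2, E1, !Cmod_mult in B.
  apply Rmult_le_reg_l with (Cmod (prodl s l w)); auto.
  assert (H0 := Cmod_ge_0 (q z)). assert (H1 := Cmod_ge_0 (prodl s l z)).
  apply Rle_trans with (Cmod (prodl s l z) * Cmod (q z)).
  - replace (Cmod (prodl s l w) * (c ^ length l * Cmod (q z))) with (c ^ length l * Cmod (prodl s l w) * Cmod (q z)) by ring.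
    apply Rmult_le_compat_r; auto.
  - rewrite <- Rmult_assoc. eapply Rle_trans; [|exact B].
    assert (0 <= Cmod (prodl s l z) * Cmod (q z)) by (apply Rmult_le_pos; auto). nra.
Qed.

Lemma pow2_ge_1 : forall n, 1 <= 2 ^ n.
Proof. intros. apply pow_R1_Rle. lra. Qed.

Lemma other_q_pos : forall l q, C_derive g w = (prodl s l w * q w)%C -> 0 < Cmod (q w).
Proof.
  intros l q E. apply Cmod_gt_0. intros K. apply Hd. rewrite E, K. ring.
Qed.

(** Few zeros near [w]: each zero in the disc of radius [2 ^ n] gains a factor 2
    between [w] and the circle of radius [3 * 2 ^ n]. *)
Lemma count_zeros : forall l n, other l -> (forall j, In j l -> dist j <= 2 ^ n) ->
  INR (length l) <= 2 * Cg * th ^ n.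
Proof.
  intros l n Hl Hn. destruct (other_quotient l Hl) as [q [Q1 [Q2 Q3]]].
  assert (P2 := pow2_ge_1 n). assert (Pq := other_q_pos l q Q3).
  assert (B : 2 ^ length l <= exp (Cg * th ^ n)).
  { assert (Hp : 0 < 2 ^ length l) by (apply pow_lt; lra).
    assert (B : Cmod (q w) <= Cmod (q w) * exp (Cg * th ^ n) / 2 ^ length l).
    { apply est_0 with (3 * 2 ^ n + 1) (3 * 2 ^ n); try lra. apply ent_holo; auto.
      intros z Hz. apply Rle_div_r; auto. rewrite Rmult_comm.
      apply quotient_bound; auto; try lra.
      intros j Hj. specialize (Hn j Hj).
      assert (T := Cmod_tri_inv (z - w) (val s j - w)). replace (z - w - (val s j - w))%C with (z - val s j)%C in T by ring.
      fold (dist j) in T. lra. }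
    apply Rle_div_r in B; auto. apply Rmult_le_reg_l with (Cmod (q w)); auto. }
  set (N := length l) in *.
  assert (E : exp (INR N) <= exp (2 * Cg * th ^ n)).
  { apply Rle_trans with (4 ^ N).
    - replace (exp (INR N)) with (exp 1 ^ N).
      + apply pow_incr. split. left; apply exp_pos. generalize exp_le_3; lra.
      + rewrite <- Rpower_pow by apply exp_pos. unfold Rpower. rewrite ln_exp. f_equal. ring.
    - replace 4 with (2 * 2) by ring. rewrite Rpow_mult_distr.
      replace (2 * Cg * th ^ n) with (Cg * th ^ n + Cg * th ^ n) by ring. rewrite exp_plus.
      assert (0 < 2 ^ N) by (apply pow_lt; lra). apply Rmult_le_compat; lra. }
  apply Rnot_lt_le. intros L. apply (Rle_not_lt _ _ E). apply exp_increasing; auto.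
Qed.

Definition inv_dist_sum (l : list nat) : R := fold_right (fun j a => / dist j + a) 0 l.

Lemma inv_dist_sum_filter : forall p l,
  inv_dist_sum l = inv_dist_sum (filter p l) + inv_dist_sum (filter (fun j => negb (p j)) l).
Proof. induction l as [|j l IH]; simpl. ring. rewrite IH. destruct (p j); simpl; ring. Qed.

Lemma inv_dist_sum_le : forall l c, 0 < c -> (forall j, In j l -> c <= dist j) ->
  inv_dist_sum l <= INR (length l) * / c.
Proof.
  induction l as [|j l IH]; intros c Hc H; simpl inv_dist_sum. simpl; lra.
  change (length (j :: l)) with (S (length l)). rewrite S_INR.
  assert (/ dist j <= / c). { apply Rinv_le_contravar; auto. apply H; simpl; auto. }
  assert (inv_dist_sum l <= INR (length l) * / c). { apply IH; auto. intros i Hi; apply H; simpl; auto. } lra.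
Qed.

Lemma zeros_isolated : exists de, 0 < de /\ forall l j, other l -> In j l -> de <= dist j.
Proof.
  destruct (other_quotient nil) as [q [Q1 [Q2 Q3]]].
  { split. constructor. intros j []. }
  assert (Pq := other_q_pos nil q Q3).
  destruct (proj1 (locally_Cmod _ _) (ent_cont q w Q1 _ Pq)) as [de [Hde B]].
  exists de. split; auto. intros l j Hl Hj. apply Rnot_lt_le. intros L.
  specialize (B (val s j) L).
  assert (Z : g (val s j) = 0%C). { apply (used_zero g s Hs). apply (proj2 Hl); auto. }
  rewrite Q2 in Z. simpl in Z. rewrite Cmult_1_l in Z.
  destruct (Cmult_integral _ _ Z) as [K|K].
  - apply (other_nz l j Hl Hj). apply Ceq_minus; auto.
  - rewrite K in B. replace (0 - q w)%C with (- q w)%C in B by ring. rewrite Cmod_opp in B. lra.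
Qed.

(** The shell between the radii [2 ^ n] and [2 ^ S n] contains a multiple of [th ^ n] zeros, each of
    which contributes at most [/ 2 ^ n]; as [th < 2], the shells form a geometric series. *)
Lemma inv_dist_bounded : exists S, 0 <= S /\ forall l, other l -> inv_dist_sum l <= S.
Proof.
  destruct zeros_isolated as [de [Hde Hiso]].
  set (D0 := 2 * Cg * / de). set (D1 := 2 * Cg * th).
  assert (Hi : 0 < / de) by (apply Rinv_0_lt_compat; auto).
  assert (HD0 : 0 <= D0) by (unfold D0; apply Rmult_le_pos; lra).
  assert (HD1 : 0 <= D1) by (unfold D1; apply Rmult_le_pos; lra).
  set (x := th / 2). assert (Hx : 0 < x < 1) by (unfold x; lra).
  assert (Main : forall n l, other l -> (forall j, In j l -> dist j <= 2 ^ n) ->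
     inv_dist_sum l <= D0 + D1 * ((1 - x ^ n) / (1 - x))).
  { induction n; intros l Hl Hn.
    - assert (Hc := count_zeros l 0 Hl Hn). simpl in Hc. rewrite Rmult_1_r in Hc.
      assert (H1 : inv_dist_sum l <= INR (length l) * / de).
      { apply inv_dist_sum_le; auto. intros j Hj. eapply Hiso; eauto. }
      assert (H2 : INR (length l) * / de <= D0) by (apply Rmult_le_compat_r; lra).
      simpl. unfold Rdiv. rewrite Rminus_diag. lra.
    - set (p := fun j => if Rle_dec (dist j) (2 ^ n) then true else false).
      rewrite (inv_dist_sum_filter p).
      assert (A1 : inv_dist_sum (filter p l) <= D0 + D1 * ((1 - x ^ n) / (1 - x))).
      { apply IHn. apply other_filter; auto. intros j Hj. apply filter_In in Hj. destruct Hj as [_ Hj].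
        unfold p in Hj. destruct (Rle_dec (dist j) (2 ^ n)); auto. discriminate. }
      assert (A2 : inv_dist_sum (filter (fun j => negb (p j)) l) <= D1 * x ^ n).
      { assert (P2 := pow2_ge_1 n).
        assert (B1 : inv_dist_sum (filter (fun j => negb (p j)) l) <= INR (length (filter (fun j => negb (p j)) l)) * / 2 ^ n).
        { apply inv_dist_sum_le. lra. intros j Hj. apply filter_In in Hj. destruct Hj as [_ Hj].
          unfold p in Hj. destruct (Rle_dec (dist j) (2 ^ n)). discriminate. lra. }
        assert (B2 : INR (length (filter (fun j => negb (p j)) l)) <= 2 * Cg * th ^ S n).
        { apply count_zeros. apply other_filter; auto. intros j Hj. apply Hn. apply filter_In in Hj; tauto. }
        eapply Rle_trans. exact B1. eapply Rle_trans. apply Rmult_le_compat_r. left; apply Rinv_0_lt_compat; lra. exact B2.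
        right. unfold D1, x, Rdiv. rewrite Rpow_mult_distr, pow_inv. simpl. ring. }
      replace (D0 + D1 * ((1 - x ^ S n) / (1 - x))) with (D0 + D1 * ((1 - x ^ n) / (1 - x)) + D1 * x ^ n).
      lra. simpl. field. lra. }
  exists (D0 + D1 * (1 / (1 - x))). split.
  { assert (0 <= 1 / (1 - x)) by (apply Rle_div_r; lra). assert (0 <= D1 * (1 / (1 - x))) by (apply Rmult_le_pos; auto). lra. }
  intros l Hl.
  assert (Hn : exists n, forall j, In j l -> dist j <= 2 ^ n).
  { clear Hl. induction l as [|j l [n IH]]. exists 0%nat. intros j [].
    destruct (Pow_x_infinity 2) with (b := dist j) as [m Hm]. rewrite Rabs_pos_eq; lra.
    specialize (Hm m (Nat.le_refl _)). rewrite Rabs_pos_eq in Hm by (apply pow_le; lra).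
    exists (n + m)%nat. intros i [<-|Hi'].
    - eapply Rle_trans. apply Rge_le, Hm. apply Rle_pow; [lra|lia].
    - eapply Rle_trans. apply IH; auto. apply Rle_pow; [lra|lia]. }
  destruct Hn as [n Hn]. eapply Rle_trans. apply (Main n); auto.
  apply Rplus_le_compat_l. apply Rmult_le_compat_l; auto. apply Rmult_le_compat_r.
  left; apply Rinv_0_lt_compat; lra. assert (0 < x ^ n) by (apply pow_lt; lra). lra.
Qed.

(** The terms of the series in [is_sum_others]. *)
Definition term (j : nat) : C :=
  match s j with
  | Some v => if Nat.eqb j k then RtoC 0 else (1 / (w - v))%C
  | None => RtoC 0
  end.

Definition term_sum (l : list nat) : C := fold_right (fun j a => term j + a)%C 0%C l.

Lemma term_other : forall j, used s j -> j <> k -> term j = (/ (w - val s j))%C.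
Proof.
  intros j Hj Hjk. unfold term, used in *. rewrite Hj. apply Nat.eqb_neq in Hjk. rewrite Hjk. unfold Cdiv; ring.
Qed.

Lemma hasd_prodl : forall l, other l -> hasd (prodl s l) w (prodl s l w * term_sum l)%C.
Proof.
  induction l as [|j l IH]; intros Hl.
  - eapply hasd_eq. apply hasd_const. simpl. ring.
  - assert (Hj : (w - val s j)%C <> 0%C). { apply Cminus_eq_contra. intros E. apply (other_nz (j :: l) j Hl); simpl; auto. }
    eapply hasd_eq. apply (hasd_mult (fun z => z - val s j)%C (prodl s l)). apply hasd_shift. apply IH. eapply other_cons; eauto.
    simpl. rewrite (term_other j); [field; auto| |]; apply (proj2 Hl); simpl; auto.
Qed.

(** The logarithmic derivative of [g z / (z - w)] at [w]. *)
Definition target : C := (Dn 2 g w / (2 * C_derive g w))%C.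

Lemma target_split : forall l q, other l -> ent q ->
  (forall z, g z = ((z - w) * (prodl s l z * q z))%C) -> C_derive g w = (prodl s l w * q w)%C ->
  target = (term_sum l + C_derive q w / q w)%C.
Proof.
  intros l q Hl Hq E1 E2.
  set (h := fun z => (prodl s l z * q z)%C).
  assert (Hh : ent h) by (apply ent_mult; auto; apply ent_prodl).
  assert (D1 : forall z, C_derive g z = (h z + (z - w) * C_derive h z)%C).
  { intros z. apply C_derive_eq. apply (hasd_ext (fun z => (z - w) * h z)%C). intros; symmetry; apply E1.
    eapply hasd_eq. apply hasd_mult. apply hasd_shift. apply ent_hasd; auto. cring. }
  assert (D2 : Dn 2 g w = (2 * C_derive h w)%C).
  { simpl Dn. apply C_derive_eq. apply (hasd_ext (fun z => h z + (z - w) * C_derive h z)%C). intros; symmetry; apply D1.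
    eapply hasd_eq. apply hasd_plus. apply ent_hasd; auto. apply hasd_mult. apply hasd_shift.
    apply ent_hasd, ent_derive; auto. cring. }
  assert (D3 : C_derive h w = (prodl s l w * term_sum l * q w + prodl s l w * C_derive q w)%C).
  { apply C_derive_eq. apply hasd_mult. apply hasd_prodl; auto. apply ent_hasd; auto. }
  assert (N1 := other_q_pos l q E2). assert (N2 := prodl_nz_w l Hl). apply Cmod_gt_0 in N1, N2.
  unfold target. rewrite D2, D3, E2. field. split; auto.
Qed.

(** If the list contains all the zeros in the disc of radius [2 ^ n], the remaining factor has no zeros
    there and its growth is still controlled, so that its logarithmic derivative is small. *)
Lemma target_approx : forall l n, other l -> (forall j, In j l -> dist j <= 2 ^ n) ->
  (forall j, used s j -> j <> k -> dist j <= 2 ^ n -> In j l) ->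
  Cmod (target - term_sum l) <= 4 * (Cg + 1) * (th / 2) ^ n.
Proof.
  intros l n Hl Hn Hall. destruct (other_quotient l Hl) as [q [Q1 [Q2 Q3]]].
  assert (P2 := pow2_ge_1 n).
  assert (Pth : 1 <= th ^ n) by (apply pow_R1_Rle; lra).
  rewrite (target_split l q Hl Q1 Q2 Q3). replace (term_sum l + C_derive q w / q w - term_sum l)%C with (C_derive q w / q w)%C by ring.
  eapply Rle_trans. apply (log_derive_bound q w (2 ^ n) ((Cg + 1) * th ^ n)).
  - lra.
  - apply Rmult_lt_0_compat; lra.
  - exact Q1.
  - intros z Hz. apply (quotient_nonzero g s Hs (k :: l) q z).
    + constructor. intros K. apply (proj2 (proj2 Hl k K)); auto. apply Hl.
    + intros j [<-|Hj]. unfold used. rewrite val_k. exact Hk. apply (proj2 Hl); auto.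
    + exact Q1.
    + intros y. rewrite Q2. simpl. rewrite val_k. ring.
    + intros j Hj. destruct (Nat.eq_dec j k) as [->|Hjk]. simpl; auto. right.
      assert (Hv : val s j = z) by (unfold val; rewrite Hj; auto).
      apply Hall; auto. unfold used; congruence. unfold dist. rewrite Hv. left; exact Hz.
  - intros z Hz. unfold disc in Hz.
    apply est_0 with (3 * 2 ^ n + 1) (3 * 2 ^ n); try lra. apply ent_holo; auto.
    intros y Hy.
    assert (T1 := Cmod_tri_inv (y - z) (w - z)). replace (y - z - (w - z))%C with (y - w)%C in T1 by ring.
    assert (T2 := Cmod_triangle (y - z) (z - w)). replace (y - z + (z - w))%C with (y - w)%C in T2 by ring.
    rewrite (Cmod_sub_sym w z) in T1.
    apply Rle_trans with (Cmod (q w) * exp (Cg * th ^ n)).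
    + rewrite <- (Rmult_1_l (Cmod (q y))), <- (pow1 (length l)). apply quotient_bound; auto; try lra.
      intros j Hj. specialize (Hn j Hj).
      assert (T := Cmod_tri_inv (y - w) (val s j - w)). replace (y - w - (val s j - w))%C with (y - val s j)%C in T by ring.
      fold (dist j) in T. lra.
    + apply Rmult_le_compat_l. apply Cmod_ge_0. apply exp_le. nra.
  - right. unfold Rdiv. rewrite Rpow_mult_distr, pow_inv. ring.
Qed.

Fixpoint fsum (a : nat -> C) (n : nat) : C :=
  match n with O => 0%C | S m => (fsum a m + a m)%C end.
Fixpoint rsum (a : nat -> R) (n : nat) : R :=
  match n with O => 0 | S m => rsum a m + a m end.

Lemma csum_fsum : forall a n, csum a n = fsum a (S n).
Proof.
  induction n. rewrite csum_0. simpl. ring. rewrite csum_S, IHn. reflexivity.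
Qed.

Definition in_other (j : nat) : bool :=
  match s j with Some _ => negb (Nat.eqb j k) | None => false end.

Lemma in_other_spec : forall j, in_other j = true <-> used s j /\ j <> k.
Proof.
  intros j. unfold in_other, used, val. destruct (s j) as [v|].
  - rewrite Bool.negb_true_iff, Nat.eqb_neq. tauto.
  - split. discriminate. intros [E _]. discriminate.
Qed.

Lemma other_seq : forall p n, other (filter (fun j => in_other j && p j)%bool (seq 0 n)).
Proof.
  intros p n. split. apply NoDup_filter, seq_NoDup.
  intros j Hj. apply filter_In in Hj. destruct Hj as [_ Hj]. apply andb_prop in Hj. apply in_other_spec. tauto.
Qed.

Lemma term_sum_app : forall l1 l2, term_sum (l1 ++ l2) = (term_sum l1 + term_sum l2)%C.
Proof. induction l1 as [|j l1 IH]; intros l2; simpl. ring. rewrite IH. ring. Qed.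

Lemma inv_dist_sum_app : forall l1 l2, inv_dist_sum (l1 ++ l2) = inv_dist_sum l1 + inv_dist_sum l2.
Proof. induction l1 as [|j l1 IH]; intros l2; simpl. ring. rewrite IH. ring. Qed.

Lemma term_sum_seq : forall p n, term_sum (filter p (seq 0 n)) = fsum (fun j => if p j then term j else 0%C) n.
Proof.
  intros p n. induction n; auto. rewrite seq_S, filter_app, term_sum_app, IHn. simpl.
  destruct (p n); simpl; ring.
Qed.

Lemma Cmod_term : forall j, Cmod (term j) = if in_other j then / dist j else 0.
Proof.
  intros j. destruct (in_other j) eqn:E.
  - apply in_other_spec in E. destruct E as [E1 E2]. rewrite term_other by auto. unfold dist.
    rewrite Cmod_inv, Cmod_sub_sym; auto. apply Cminus_eq_contra. intros K. apply (Hk' j E2). rewrite K. exact E1.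
  - unfold term, in_other in *. destruct (s j); [|apply Cmod_0]. destruct (Nat.eqb j k); [apply Cmod_0|discriminate].
Qed.

Lemma rsum_term : forall n, rsum (fun j => Cmod (term j)) n = inv_dist_sum (filter (fun j => in_other j && true)%bool (seq 0 n)).
Proof.
  induction n; auto. rewrite seq_S, filter_app, inv_dist_sum_app, <- IHn. simpl.
  rewrite Cmod_term. destruct (in_other n); simpl; ring.
Qed.

Lemma rsum_mono : forall a n m, (forall j, 0 <= a j) -> (n <= m)%nat -> rsum a n <= rsum a m.
Proof.
  intros a n m Ha H. induction H. lra. simpl. specialize (Ha m). lra.
Qed.

Lemma fsum_diff : forall p n n1, (n1 <= n)%nat ->
  (forall j, (j < n1)%nat -> in_other j = true -> p j = true) ->
  Cmod (fsum term n - fsum (fun j => if (in_other j && p j)%bool then term j else 0%C) n)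
    <= rsum (fun j => Cmod (term j)) n - rsum (fun j => Cmod (term j)) n1.
Proof.
  intros p n n1 H Hp.
  assert (Z : forall j, in_other j = false -> term j = 0%C).
  { intros j E. apply Cmod_eq_0. rewrite Cmod_term, E. reflexivity. }
  assert (E0 : forall m, (m <= n1)%nat -> fsum term m = fsum (fun j => if (in_other j && p j)%bool then term j else 0%C) m).
  { induction m; intros Hm. reflexivity. simpl. rewrite IHm by lia. f_equal.
    destruct (in_other m) eqn:E; simpl. rewrite Hp; auto. apply Z; auto. }
  induction H.
  - rewrite E0 by lia. match goal with |- Cmod (?x - ?x) <= _ => replace (x - x)%C with (RtoC 0) by ring end.
    rewrite Cmod_0. lra.
  - simpl. set (X := fsum term m) in *.
    set (Y := fsum (fun j => if (in_other j && p j)%bool then term j else 0%C) m) in *.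
    set (a := if (in_other m && p m)%bool then term m else 0%C).
    replace (X + term m - (Y + a))%C with ((X - Y) + (term m - a))%C by ring.
    eapply Rle_trans. apply Cmod_triangle.
    assert (Cmod (term m - a) <= Cmod (term m)).
    { unfold a. destruct (in_other m && p m)%bool.
      - replace (term m - term m)%C with (RtoC 0) by ring. rewrite Cmod_0. apply Cmod_ge_0.
      - replace (term m - 0)%C with (term m) by ring. lra. }
    lra.
Qed.

(** Far enough in the listing, a partial sum differs from the sum over the zeros in a large disc
    only by terms from the tail of the absolutely convergent series. *)
Theorem sum_over_zeros : is_sum_others s k w target.
Proof.
  change (cser term target). apply cser_clim. intros e He.
  destruct inv_dist_bounded as [S0 [HS0 HS]].
  set (b := rsum (fun j => Cmod (term j))).
  assert (Hbm : forall n m, (n <= m)%nat -> b n <= b m).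
  { intros. apply rsum_mono; auto. intros; apply Cmod_ge_0. }
  destruct (completeness (fun x => exists n, x = b n)) as [Sb [U1 U2]].
  { exists S0. intros x [n ->]. unfold b. rewrite rsum_term. apply HS, (other_seq (fun _ => true)). }
  { exists (b 0%nat). exists 0%nat; auto. }
  assert (HSb : forall d, 0 < d -> exists n, Sb - b n < d).
  { intros d Hdp. apply NNPP. intros N. assert (Sb <= Sb - d); [|lra].
    apply U2. intros x [n ->]. apply Rnot_lt_le. intros L. apply N. exists n. lra. }
  assert (Hb : forall n, b n <= Sb) by (intros n; apply U1; exists n; auto).
  destruct (HSb (e / 2)) as [n1 Hn1]. lra.
  assert (HR : exists R1, forall j, (j < n1)%nat -> dist j <= R1).
  { clear. induction n1 as [|n1 [R1 IH]]. exists 0. intros j Hj; lia.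
    exists (Rmax R1 (dist n1)). intros j Hj. destruct (Nat.eq_dec j n1) as [->|]. apply Rmax_r.
    eapply Rle_trans; [|apply Rmax_l]. apply IH. lia. }
  destruct HR as [R1 HR1].
  destruct (Pow_x_infinity 2) with (b := R1) as [m1 Hm1]. rewrite Rabs_pos_eq; lra.
  destruct (geom_cv (th / 2) (4 * (Cg + 1)) (e / 2)) as [m2 Hm2]; try lra.
  set (m := (m1 + m2)%nat).
  assert (A1 : R1 <= 2 ^ m).
  { specialize (Hm1 m ltac:(unfold m; lia)). rewrite Rabs_pos_eq in Hm1 by (apply pow_le; lra). lra. }
  assert (A2 : 4 * (Cg + 1) * (th / 2) ^ m < e / 2) by (apply Hm2; unfold m; lia).
  assert (P2 := pow2_ge_1 m).
  destruct (HSb (/ 2 ^ m)) as [n2 Hn2]. { apply Rinv_0_lt_compat; lra. }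
  exists (n1 + n2)%nat. intros n Hn. rewrite csum_fsum.
  set (p := fun j => if Rle_dec (dist j) (2 ^ m) then true else false).
  set (l := filter (fun j => in_other j && p j)%bool (seq 0 (S n))).
  assert (Hl : other l) by apply other_seq.
  assert (B1 : Cmod (target - term_sum l) <= 4 * (Cg + 1) * (th / 2) ^ m).
  { apply target_approx; auto.
    - intros j Hj. apply filter_In in Hj. destruct Hj as [_ Hj]. apply andb_prop in Hj. destruct Hj as [_ Hj].
      unfold p in Hj. destruct (Rle_dec (dist j) (2 ^ m)); auto; discriminate.
    - intros j Hj1 Hj2 Hj3. assert (Hjo : in_other j = true) by (apply in_other_spec; auto).
      apply filter_In. split.
      + apply in_seq. split. lia. simpl. apply Nat.lt_nge. intros Hge.
        assert (C1 : b (S j) <= Sb) by apply Hb. unfold b in C1. simpl in C1. fold b in C1.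
        assert (C2 : b n2 <= b j) by (apply Hbm; lia).
        change (rsum (fun j => Cmod (term j)) j) with (b j) in C1.
        rewrite Cmod_term, Hjo in C1.
        assert (Pd : 0 < dist j).
        { apply Cmod_gt_0, Cminus_eq_contra. intros K. apply (Hk' j Hj2). rewrite <- K. exact Hj1. }
        assert (/ 2 ^ m <= / dist j) by (apply Rinv_le_contravar; auto). lra.
      + rewrite Hjo. unfold p. destruct (Rle_dec (dist j) (2 ^ m)); auto. }
  assert (B2 := fsum_diff p (S n) n1 ltac:(lia)).
  assert (B3 : Cmod (fsum term (S n) - term_sum l) <= b (S n) - b n1).
  { unfold l. rewrite term_sum_seq. apply B2. intros j Hj _. unfold p.
    destruct (Rle_dec (dist j) (2 ^ m)) as [|L]; auto. exfalso. apply L. specialize (HR1 j Hj). lra. }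
  specialize (Hb (S n)).
  replace (fsum term (S n) - target)%C with ((fsum term (S n) - term_sum l) - (target - term_sum l))%C by ring.
  eapply Rle_lt_trans. apply Cmod_tri3. lra.
Qed.

End Hadamard.

(** * The zeros of [z * P (z ^ 2)] *)

Lemma zero_and_pm_plus : forall zs j, zero_and_pm zs (S (2 * j)) = zs j.
Proof.
  intros zs j. unfold zero_and_pm. rewrite Nat.even_even, Nat.div2_double. reflexivity.
Qed.

Lemma zero_and_pm_minus : forall zs j, zero_and_pm zs (S (S (2 * j))) = option_map Copp (zs j).
Proof.
  intros zs j. unfold zero_and_pm.
  replace (S (2 * j)) with (2 * j + 1)%nat by lia. rewrite Nat.even_odd.
  replace (2 * j + 1)%nat with (S (2 * j)) by lia. rewrite Nat.div2_succ_double. reflexivity.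
Qed.

Lemma index_cases : forall n, n = 0%nat \/ (exists j, n = S (2 * j)) \/ (exists j, n = S (S (2 * j))).
Proof.
  intros [|n]; auto. right. destruct (Nat.Even_or_Odd n) as [[j ->]|[j ->]].
  left; exists j; auto. right; exists j; lia.
Qed.

Lemma Some_C_inj : forall a b : C, Some a = Some b -> a = b.
Proof. intros a b H. congruence. Qed.

(** For [w <> 0], each index of [w ^ 2] among the zeros of [P] gives exactly one index of [w], as only one
    of the two square roots is [w]. At the origin it gives two, and the factor [z] adds one. *)
Theorem lists_zeros_square : forall f P s zs, ent P -> (forall z, f z = (z * P (z * z))%C) ->
  lists_zeros P s -> (forall j, s j = option_map (fun z : C => z ^ 2)%C (zs j)) ->
  lists_zeros f (zero_and_pm zs).
Proof.
  intros f P s zs HP Hf Hs Hzs w.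
  destruct (zero_order_list P s Hs (w * w)%C) as [m [H [lu [H1 [H2 [H3 [L1 [L2 L3]]]]]]]].
  assert (HH : ent (fun z => H (z * z)%C)).
  { intros z. eexists. apply (hasd_comp H (fun z => z * z)%C). apply ent_hasd; auto. apply hasd_sq. }
  assert (Sq : forall v : C, (v ^ 2)%C = (v * v)%C) by (intros v; simpl; ring).
  assert (Pow : forall q, ent q -> forall n, ent (fun z => q z ^ n)%C).
  { intros q Hq n. induction n; simpl. apply ent_const. apply ent_mult; auto. }
  destruct (classic (w = 0%C)) as [->|Hw].
  - exists (S (2 * m)). split.
    + exists (fun z => H (z * z)%C). split. apply ent_entire; auto. split.
      exact H2.
      intros z. rewrite Hf, H3. replace (z * z - 0 * 0)%C with (z * z)%C by ring.
      rewrite Cpow_S, Cpow_mult_r, Sq. replace (z - 0)%C with z by ring. ring.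
    + assert (Z : forall j, In j lu <-> zs j = Some (RtoC 0)).
      { intros j. rewrite L3, Hzs. destruct (zs j) as [v|]; simpl; split; try discriminate.
        - intros E. apply Some_C_inj in E. f_equal. replace (v * (v * 1))%C with (v * v)%C in E by ring.
          replace (0 * 0)%C with (RtoC 0) in E by ring. destruct (Cmult_integral _ _ E); auto.
        - intros E. apply Some_C_inj in E. subst v. f_equal. ring. }
      exists (0%nat :: map (fun j => S (2 * j)) lu ++ map (fun j => S (S (2 * j))) lu). split; [|split].
      * constructor.
        { intros K. apply in_app_or in K. destruct K as [K|K]; apply in_map_iff in K; destruct K as [j [K _]]; discriminate. }
        apply NoDup_app.
        { apply Injective_map_NoDup; auto. intros i j E; lia. }
        { apply Injective_map_NoDup; auto. intros i j E; lia. }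
        { intros n K1 K2. apply in_map_iff in K1, K2. destruct K1 as [i [K1 _]], K2 as [j [K2 _]]. lia. }
      * simpl length. rewrite length_app, !length_map, L2. lia.
      * intros n. split.
        { intros [<-|K]. reflexivity. apply in_app_or in K.
          destruct K as [K|K]; apply in_map_iff in K; destruct K as [j [<- K]]; apply Z in K.
          rewrite zero_and_pm_plus; auto. rewrite zero_and_pm_minus, K. simpl. f_equal. ring. }
        { intros K. destruct (index_cases n) as [->|[[j ->]|[j ->]]].
          - left; auto.
          - right. apply in_or_app. left. apply (in_map (fun j => S (2 * j))). apply Z. rewrite zero_and_pm_plus in K; auto.
          - right. apply in_or_app. right. apply (in_map (fun j => S (S (2 * j)))). apply Z. rewrite zero_and_pm_minus in K.
            destruct (zs j) as [v|]; [|discriminate]. simpl in K. apply Some_C_inj in K. f_equal.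
            replace v with (- - v)%C by ring. rewrite K. ring. }
  - exists m. split.
    + exists (fun z => z * (z + w) ^ m * H (z * z))%C. split; [|split].
      * apply ent_entire. apply ent_mult; auto. apply ent_mult. apply ent_id. apply Pow. apply ent_plus. apply ent_id. apply ent_const.
      * apply Cmult_neq_0; auto. apply Cmult_neq_0; auto. apply Cpow_nz. replace (w + w)%C with (2 * w)%C by ring.
        apply Cmult_neq_0; auto. intros E. apply RtoC_inj in E. lra.
      * intros z. rewrite Hf, H3. replace (z * z - w * w)%C with ((z - w) * (z + w))%C by ring. rewrite Cpow_mult_l. ring.
    + set (idx := fun j => if excluded_middle_informative (zs j = Some w) then S (2 * j) else S (S (2 * j))).
      assert (Z : forall j v, zs j = Some v -> (In j lu <-> v = w \/ v = (- w)%C)).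
      { intros j v E. rewrite L3, Hzs, E. simpl. split.
        - intros K. apply Some_C_inj in K. replace (v * (v * 1))%C with (v * v)%C in K by ring. apply Csquare_eq; auto.
        - intros [->| ->]; f_equal; ring. }
      assert (Hww : (- w)%C <> w).
      { intros E. apply Hw. assert (E2 : (2 * w)%C = 0%C). { replace (2 * w)%C with (w - - w)%C by ring. rewrite E. ring. }
        destruct (Cmult_integral _ _ E2) as [K|K]; auto. apply RtoC_inj in K. lra. }
      exists (map idx lu). split; [|split].
      * apply Injective_map_NoDup; auto. intros i j E. unfold idx in E.
        destruct (excluded_middle_informative (zs i = Some w)), (excluded_middle_informative (zs j = Some w)); lia.
      * rewrite length_map; auto.
      * intros n. split.
        { intros K. apply in_map_iff in K. destruct K as [j [<- K]]. unfold idx.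
          destruct (excluded_middle_informative (zs j = Some w)) as [E|E].
          rewrite zero_and_pm_plus; auto. rewrite zero_and_pm_minus.
          assert (K' := K). apply L3 in K'. rewrite Hzs in K'. destruct (zs j) as [v|] eqn:Ev; [|discriminate].
          simpl. apply (Z j v Ev) in K. destruct K as [->| ->]. contradiction. f_equal. ring. }
        { intros K. destruct (index_cases n) as [->|[[j ->]|[j ->]]].
          - simpl in K. apply Some_C_inj in K. exfalso; auto.
          - rewrite zero_and_pm_plus in K. apply in_map_iff. exists j. split.
            unfold idx. destruct (excluded_middle_informative (zs j = Some w)); [auto|contradiction].
            apply (Z j w K). auto.
          - rewrite zero_and_pm_minus in K. destruct (zs j) as [v|] eqn:Ev; [|discriminate].
            simpl in K. apply Some_C_inj in K. assert (Ev2 : v = (- w)%C) by (rewrite <- K; ring).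
            apply in_map_iff. exists j. split.
            unfold idx. rewrite Ev. destruct (excluded_middle_informative (Some v = Some w)) as [E|E]; auto.
            apply Some_C_inj in E. exfalso. apply Hww. rewrite <- Ev2. exact E.
            apply (Z j v Ev). auto. }
Qed.

(** * Branches of zeros *)

Section Branch.
Variables (Psi : C -> C -> C).
Hypotheses (Pz : ent_z Psi)
  (PD : forall k, locbd (fun t => Dn k (Psi t)) /\
    derive_t (fun t => Dn k (Psi t))
      (fun t w => (6 + 4 * RtoC (INR k)) * Dn (S k) (Psi t) w + 4 * w * Dn (S (S k)) (Psi t) w)%C).

Lemma hasd_along : forall m t dm k, hasd m t dm ->
  hasd (fun t => Dn k (Psi t) (m t)) t
    ((6 + 4 * RtoC (INR k)) * Dn (S k) (Psi t) (m t) + 4 * m t * Dn (S (S k)) (Psi t) (m t)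
      + dm * Dn (S k) (Psi t) (m t))%C.
Proof.
  intros m t dm k Hm. destruct (PD k) as [P1 P2].
  exact (hasd_curve (fun t => Dn k (Psi t)) _ m t dm P1 (fun u => ent_Dn k _ (Pz u)) P2 Hm).
Qed.

Lemma hasd_zero_on : forall (f : C -> C) a r t, disc a r t -> (forall t, disc a r t -> f t = 0%C) -> hasd f t 0%C.
Proof.
  intros f a r t Ht H. apply (hasd_ext_loc (fun _ => 0%C)); [|apply hasd_const].
  apply locally_Cmod. exists (r - Cmod (t - a)). split. unfold disc in Ht; lra.
  intros y Hy. symmetry. apply H. eapply disc_sub; [|exact Hy]. lra.
Qed.

(** Differentiating along the branch, the transformed heat equation makes each next derivative vanish:
    from the term with [4 * w] where the branch is nonzero, and from the coefficient [6 + 4 k] where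
    it is identically zero. So [Psi t] has a zero of infinite order. *)
Lemma double_branch : forall (m : C -> C) a r, 0 < r -> holo a r m ->
  (forall t, disc a r t -> Psi t (m t) = 0%C) ->
  (forall t, disc a r t -> C_derive (Psi t) (m t) = 0%C) ->
  exists t, forall w, Psi t w = 0%C.
Proof.
  intros m a r Hr Hm H0 H1.
  (* A smaller disc on which the branch is either identically zero or nowhere zero. *)
  assert (Hsub : exists b r', 0 < r' /\ (forall t, disc b r' t -> disc a r t) /\
     ((forall t, disc b r' t -> m t = 0%C) \/ (forall t, disc b r' t -> m t <> 0%C))).
  { destruct (classic (exists b, disc a r b /\ m b <> 0%C)) as [[b [Hb Hmb]]|N].
    - destruct (Hm b Hb) as [l Hl]. assert (Cm := hasd_cont _ _ _ Hl).
      assert (P : 0 < Cmod (m b)) by (apply Cmod_gt_0; auto).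
      destruct (proj1 (locally_Cmod _ _) (Cm _ P)) as [d [Hd Hdd]].
      exists b, (Rmin d (r - Cmod (b - a))). split. apply Rmin_pos; auto. unfold disc in Hb; lra. split.
      + intros t Ht. apply (disc_sub a r b (Rmin d (r - Cmod (b - a)))); auto. apply Rmin_r.
      + right. intros t Ht E. assert (Ht' : Cmod (t - b) < d) by (eapply Rlt_le_trans; [exact Ht|apply Rmin_l]).
        specialize (Hdd t Ht'). rewrite E in Hdd. replace (0 - m b)%C with (- m b)%C in Hdd by ring.
        rewrite Cmod_opp in Hdd. lra.
    - exists a, r. split; auto. split; auto. left. intros t Ht. apply NNPP. intros K. apply N. exists t; auto. }
  destruct Hsub as [b [r' [Hr' [Hin Hcase]]]].
  assert (Hk : forall k, (forall t, disc b r' t -> Dn k (Psi t) (m t) = 0%C) /\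
     (forall t, disc b r' t -> Dn (S k) (Psi t) (m t) = 0%C)).
  { induction k as [|k [IH1 IH2]].
    - split; intros t Ht. apply H0; auto. apply H1; auto.
    - split; auto. intros t Ht. destruct (Hm t (Hin t Ht)) as [dm Hdm].
      destruct Hcase as [Hc|Hc].
      + assert (E := hasd_unique _ _ _ _ (hasd_along m t dm (S k) Hdm)
           (hasd_zero_on (fun t => Dn (S k) (Psi t) (m t)) b r' t Ht IH2)).
        assert (E2 := hasd_unique _ _ _ _ Hdm (hasd_zero_on m b r' t Ht Hc)).
        rewrite E2, (Hc t Ht) in E.
        assert (E3 : ((6 + 4 * RtoC (INR (S k))) * Dn (S (S k)) (Psi t) 0)%C = 0%C).
        { etransitivity; [|exact E]. cring. }
        rewrite (Hc t Ht). destruct (Cmult_integral _ _ E3) as [K|K]; auto.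
        exfalso. rewrite <- RtoC_mult, <- RtoC_plus in K. apply RtoC_inj in K. generalize (pos_INR (S k)). lra.
      + assert (E := hasd_unique _ _ _ _ (hasd_along m t dm k Hdm)
           (hasd_zero_on (fun t => Dn k (Psi t) (m t)) b r' t Ht IH1)).
        rewrite (IH2 t Ht) in E.
        assert (E3 : (4 * m t * Dn (S (S k)) (Psi t) (m t))%C = 0%C).
        { etransitivity; [|exact E]. cring. }
        destruct (Cmult_integral _ _ E3) as [K|K]; auto.
        exfalso. apply (Cmult_neq_0 4 (m t)); auto. intros K'. apply RtoC_inj in K'. lra. }
  assert (Hb : disc b r' b). { unfold disc. rewrite Cmod_self; auto. }
  exists b. intros w. refine (cser_zero _ _ _ (taylor_ent (Psi b) (m b) w (Pz b))).
  intros n. rewrite (proj1 (Hk n) b Hb). unfold Cdiv; ring.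
Qed.

Lemma simple_zero_index : forall g s u, ent g -> lists_zeros g s -> g u = 0%C -> C_derive g u <> 0%C ->
  exists k, s k = Some u /\ forall j, j <> k -> s j <> Some u.
Proof.
  intros g s u Hg Hs H0 Hd.
  destruct (zero_order_list g s Hs u) as [m [H [lu [H1 [H2 [H3 [L1 [L2 L3]]]]]]]].
  destruct m as [|[|m]].
  - exfalso. rewrite H3 in H0. simpl in H0. apply H2. rewrite <- H0. ring.
  - destruct lu as [|k [|? ?]]; try discriminate. exists k. split. apply L3. simpl; auto.
    intros j Hj K. apply L3 in K. destruct K as [K|[]]. auto.
  - exfalso. apply Hd. apply C_derive_eq. apply (hasd_ext (fun z => (z - u) ^ S (S m) * H z)%C). intros; symmetry; auto.
    eapply hasd_eq. apply hasd_mult. apply (hasd_comp (fun z => z ^ S (S m))%C (fun z => z - u)%C). apply hasd_pow. apply hasd_shift.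
    apply ent_hasd; auto. change (Init.Nat.pred (S (S m))) with (S m). rewrite !Cpow_S. ring.
Qed.

(** The dynamics at a simple zero: the implicit function rule and the logarithmic derivative. *)
Lemma simple_branch : forall m t dm s sig B, hasd m t dm ->
  (exists d, 0 < d /\ forall t', Cmod (t' - t) < d -> Psi t' (m t') = 0%C) ->
  C_derive (Psi t) (m t) <> 0%C -> lists_zeros (Psi t) s ->
  / 2 <= sig < 1 -> 0 <= B ->
  (forall w, Cmod (Psi t w) <= B * exp (16 * Rpower (3 + Cmod w) sig)) ->
  exists k Sm, s k = Some (m t) /\ (forall j, j <> k -> s j <> Some (m t)) /\
    is_sum_others s k (m t) Sm /\ dm = (- 6 - 8 * m t * Sm)%C.
Proof.
  intros m t dm s sig B Hm [d [Hdp Hz]] Hd Hs Hsig HB Hgr.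
  set (w := m t) in *. set (D := C_derive (Psi t) w) in *.
  assert (P : 0 < Cmod D) by (apply Cmod_gt_0; auto).
  assert (H0 : Psi t w = 0%C).
  { apply Hz. rewrite Cmod_self; auto. }
  destruct (simple_zero_index (Psi t) s w (Pz t) Hs H0 Hd) as [k [K1 K2]].
  (* On the disc of radius [4 * 2 ^ n] around [w] one has [3 + Cmod z <= c * 2 ^ n]; the second term
     of [Cg] absorbs the constant [B]. *)
  set (th := Rpower 2 sig). set (c := 7 + Cmod w). assert (Hw := Cmod_ge_0 w).
  set (Cg := 16 * Rpower c sig + B / Cmod D).
  assert (Hth : 1 <= th < 2).
  { unfold th. split.
    - rewrite <- (Rpower_O 2) by lra. apply Rle_Rpower; lra.
    - rewrite <- (Rpower_1 2) at 2 by lra. apply Rpower_lt; lra. }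
  assert (Pc : 0 < Rpower c sig) by apply exp_pos.
  assert (PB : 0 <= B / Cmod D) by (apply Rle_div_r; lra).
  exists k, (target (Psi t) w). split; auto. split; auto. split.
  - apply sum_over_zeros with Cg th; auto.
    + unfold Cg; lra.
    + intros n z Hzn. fold D. eapply Rle_trans. apply Hgr.
      assert (P2 := pow2_ge_1 n). assert (Pth : 1 <= th ^ n) by (apply pow_R1_Rle; lra).
      assert (E1 : Rpower (3 + Cmod z) sig <= Rpower c sig * th ^ n).
      { replace (th ^ n) with (Rpower (2 ^ n) sig).
        - rewrite Rpower_mult_distr by (unfold c; lra). apply Rle_Rpower_l. lra. split. generalize (Cmod_ge_0 z); lra.
          replace z with ((z - w) + w)%C by ring. generalize (Cmod_triangle (z - w) w). unfold c. nra.
        - unfold th. rewrite <- Rpower_pow by lra. rewrite <- (Rpower_pow n (Rpower 2 sig)) by apply exp_pos.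
          rewrite !Rpower_mult. f_equal. ring. }
      assert (E2 : B <= Cmod D * exp (B / Cmod D * th ^ n)).
      { assert (X1 : 1 + B / Cmod D <= exp (B / Cmod D)).
        { destruct PB as [PB|PB]. left; apply exp_ineq1; lra. rewrite <- PB, exp_0; lra. }
        assert (X2 : exp (B / Cmod D) <= exp (B / Cmod D * th ^ n)) by (apply exp_le; nra).
        apply Rle_trans with (Cmod D * (B / Cmod D)). right; field; lra. apply Rmult_le_compat_l; lra. }
      apply Rle_trans with ((Cmod D * exp (B / Cmod D * th ^ n)) * exp (16 * Rpower c sig * th ^ n)).
      * apply Rmult_le_compat; auto. left; apply exp_pos. apply exp_le. nra.
      * rewrite Rmult_assoc, <- exp_plus. right. f_equal. f_equal. unfold Cg. ring.
  - assert (E := hasd_unique _ _ _ _ (hasd_along m t dm 0 Hm)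
      (hasd_zero_on (fun t => Psi t (m t)) t d t ltac:(unfold disc; replace (t - t)%C with (RtoC 0) by ring; rewrite Cmod_0; auto) Hz)).
    fold w in E. unfold target. change (Dn 1 (Psi t) w) with D in E.
    set (D2 := Dn 2 (Psi t) w) in *. fold D.
    replace dm with ((((6 + 4 * RtoC (INR 0)) * D + 4 * w * D2 + dm * D) - (6 * D + 4 * w * D2)) / D)%C.
    2:{ simpl INR. field. auto. }
    rewrite E. field. auto.
Qed.

End Branch.

Open Scope C_scope.

Theorem mainTheorem9 :
  forall F : C -> C -> C,
    entire2 F ->
    (exists t z : C, F t z <> 0) ->
    heat_equation F ->
    (forall z : C, F 0 (- z) = - F 0 z) ->
    Rbar_lt (z_order F) (Finite 2) ->
    (forall t z : C, F t (- z) = - F t z) /\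
    exists Psi : C -> C -> C,
      entire2 Psi /\
      (forall t z : C, F t z = z * Psi t (z ^ 2)) /\
      forall mu : C -> nat -> option C,
        (forall t : C, lists_zeros (Psi t) (mu t)) ->
        (forall (t : C) (zs : nat -> option C),
           (forall j : nat, mu t j = option_map (fun z : C => z ^ 2) (zs j)) ->
           lists_zeros (F t) (zero_and_pm zs)) /\
        forall (D : C -> Prop) (muk : C -> C),
          complex_domain D ->
          holomorphic_on D muk ->
          (forall t : C, D t -> Psi t (muk t) = 0) ->
          exists E : C -> Prop,
            discrete_subset D E /\
            forall t : C, D t -> ~ E t ->
              exists (k : nat) (S : C),
                mu t k = Some (muk t) /\
                (forall j : nat, j <> k -> mu t j <> Some (muk t)) /\
                is_sum_others (mu t) k (muk t) S /\
                is_derive (K := C_AbsRing) (V := C_NormedModule) muk t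
                  (- 6 - 8 * muk t * S).
Proof.
  intros F HF [t1 [z1 Hne]] [Fz [Fzz Hheat]] Hodd Hord.
  assert (Fbd := entire2_locbd F HF).
  assert (D1 : forall t z, hasd (F t) z (Fz t z)) by (intros; apply hasd_is_derive, Hheat).
  assert (Fent : ent_z F) by (intros t z; exists (Fz t z); apply D1).
  assert (D2 : forall t z, Dn 2 (F t) z = Fzz t z).
  { intros t z. simpl Dn. apply C_derive_eq. apply (hasd_ext (Fz t)).
    intros y. symmetry. apply C_derive_eq, D1. apply hasd_is_derive, Hheat. }
  assert (Fheat : derive_t F (fun t => Dn 2 (F t))).
  { intros t z. rewrite D2. apply hasd_is_derive, Hheat. }
  assert (Fodd := heat_odd F Fbd Fent Fheat Hodd).
  split; [exact Fodd|].
  destruct (growth_order_bound (F 0) (Fent 0) Hord) as [s [K [Hs [HK Hgr0]]]].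
  assert (Fgr := heat_growth F s K Fbd Fent Fheat Hs HK Hgr0).
  destruct (Psi_exists F Fent Fodd) as [Psi [Pz PF]].
  assert (PD := Psi_Dn F s Fheat Hs Fgr Psi Pz PF).
  assert (PX := Psi_heat F s Fheat Hs Fgr Psi Pz PF).
  assert (Pnz : forall t, ~ forall w, Psi t w = 0).
  { intros t Hz. apply Hne. apply (heat_zero F Fbd Fent Fheat t). intros z. rewrite PF, Hz. ring. }
  exists Psi. split; [|split].
  - apply (separately_entire2 Psi _ (proj1 (PD 0%nat)) Pz PX).
  - intros t z. rewrite PF. do 2 f_equal. simpl. ring.
  - intros mu Hmu. split.
    + intros t zs Hzs. apply (lists_zeros_square (F t) (Psi t) (mu t) zs); auto.
    + intros D muk [Dopen _] Hmuk Hzero.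
      assert (Hm : forall t, D t -> exists l, hasd muk t l).
      { intros t Ht. destruct (Hmuk t Ht) as [l Hl]. exists l. apply hasd_is_derive, Hl. }
      assert (Hdisc : forall a, D a -> exists r, (0 < r)%R /\ forall t, disc a r t -> D t).
      { intros a Ha. apply (proj1 (locally_Cmod a D)). apply Dopen, Ha. }
      exists (fun t => D t /\ C_derive (Psi t) (muk t) = 0). split; [split|].
      * intros t Ht. apply Ht.
      * intros a Ha Hacc. destruct (Hdisc a Ha) as [r [Hr Hin]].
        set (g := fun t => C_derive (Psi t) (muk t)).
        assert (Hg : holo a r g).
        { intros t Ht. destruct (Hm t (Hin t Ht)) as [l Hl]. eexists. apply (hasd_along Psi Pz PD muk t l 1 Hl). }
        assert (Hg0 : forall t, Cmod (t - a) < r / 2 -> g t = 0).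
        { apply (identity_local g a r Hr Hg). intros d Hd. destruct (Hacc d Hd) as [t [[_ Ht1] [Ht2 Ht3]]].
          exists t. auto. }
        assert (Hin2 : forall t, disc a (r / 2) t -> D t).
        { intros t Ht. apply Hin. unfold disc in *. lra. }
        destruct (double_branch Psi Pz PD muk a (r / 2)) as [t Ht]; auto.
        { lra. } { intros t Ht. auto. }
        apply (Pnz t Ht).
      * intros t Ht HE. destruct (Hm t Ht) as [dm Hdm].
        destruct (Hdisc t Ht) as [r [Hr Hin]].
        destruct (Psi_growth F s Hs Fgr Psi Pz PF (Cmod t + 1)) as [B [HB HBB]].
        { generalize (Cmod_ge_0 t). lra. }
        destruct (simple_branch Psi Pz PD muk t dm (mu t) (s / 2) B) as [k [Sm [K1 [K2 [K3 K4]]]]]; auto.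
        { exists r. split; auto. }
        { lra. }
        { intros w. apply HBB. lra. }
        exists k, Sm. split; auto. split; auto. split; auto.
        apply hasd_is_derive. rewrite <- K4. exact Hdm.
Qed.
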